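(* Let $n\ge1$, let $1<p_1,q_1,p_2,q_2<\infty$ and let $r$ satisfy $\frac1r=\frac1{p_1}+\frac1{q_1}=\frac1{p_2}+\frac1{q_2}$. Let $s\in\mathbf R$ satisfy $s\le\max\left(\frac nr-n,0\right)$ and $s\notin2\mathbf N\cup\{0\}$. Then both of the inequalities $$\|D^s(fg)\|_{L^r(\mathbf R^n)}\le C\left[\|D^sf\|_{L^{p_1}(\mathbf R^n)}\|g\|_{L^{q_1}(\mathbf R^n)}+\|f\|_{L^{p_2}(\mathbf R^n)}\|D^sg\|_{L^{q_2}(\mathbf R^n)}\right],$$ $$\|J^s(fg)\|_{L^r(\mathbf R^n)}\le C\left[\|f\|_{L^{p_1}(\mathbf R^n)}\|J^sg\|_{L^{q_1}(\mathbf R^n)}+\|J^sf\|_{L^{p_2}(\mathbf R^n)}\|g\|_{L^{q_2}(\mathbf R^n)}\right]$$ fail; that is, for each of the two inequalities and for every constant $C<\infty$ there exist $f,g\in\mathcal S(\mathbf R^n)$, for which all the expressions occurring in it are defined, such that the left-hand side (possibly $+\infty$) is strictly greater than the right-hand side.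
   Context: $\mathbf N=\{1,2,3,\dots\}$, so $2\mathbf N$ is the set of positive even integers. $\mathcal S(\mathbf R^n)$ is the space of Schwartz functions. The Fourier transform is $\widehat f(\xi)=\int_{\mathbf R^n}f(x)e^{-2\pi i\langle x,\xi\rangle}\,dx$. $D^s=(-\Delta)^{s/2}$ and $J^s=(1-\Delta)^{s/2}$ are the Fourier multiplier operators which, in the paper's normalization (factors of $2\pi$ suppressed), are given by $$D^sf(x)=\int_{\mathbf R^n}|\xi|^s\widehat f(\xi)e^{2\pi i\langle\xi,x\rangle}\,d\xi,\qquad J^sf(x)=\int_{\mathbf R^n}(1+|\xi|^2)^{s/2}\widehat f(\xi)e^{2\pi i\langle\xi,x\rangle}\,d\xi .$$ For $f\in\mathcal S(\mathbf R^n)$, $D^sf$ is regarded as defined when $|\xi|^s\widehat f(\xi)$ is integrable (which is automatic if $s>-n$). When $r<1$, $\|\cdot\|_{L^r}$ is the usual quasi-norm $(\int|h|^r)^{1/r}$. Norms take values in $[0,\infty]$. *)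

(* Defs.v *)
From HB Require Import structures.
From mathcomp Require Import all_boot all_order all_algebra.
From mathcomp Require Import all_classical all_reals all_analysis.
From mathcomp Require Import complex.

Set Implicit Arguments.
Unset Strict Implicit.
Unset Printing Implicit Defensive.

Import Order.TTheory GRing.Theory Num.Theory.
Import numFieldNormedType.Exports.
Import ComplexField.Normc.

Local Open Scope classical_set_scope.
Local Open Scope ring_scope.
Local Open Scope complex_scope.

(* ['rV[T]_n] carries the product sigma-algebra, generated by the coordinates;
   for [T = R] these are the Borel sets of R^n. *)
Definition measure_rV_display : measure_display -> measure_display.
Proof. exact. Qed.

Section measurable_rV.
Context {d} {T : measurableType d}.
Variable n : nat.

Let coord : 'I_n -> 'rV[T]_n -> T := fun i v => v ord0 i.

Let rV_set0 : g_sigma_preimage coord set0.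
Proof. exact: sigma_algebra0. Qed.

Let rV_setC A : g_sigma_preimage coord A -> g_sigma_preimage coord (~` A).
Proof. exact: sigma_algebraC. Qed.

Let rV_bigcup (F : (set 'rV[T]_n)^nat) : (forall i, g_sigma_preimage coord (F i)) ->
  g_sigma_preimage coord (\bigcup_i (F i)).
Proof. exact: sigma_algebra_bigcup. Qed.

HB.instance Definition _ := @isMeasurable.Build (measure_rV_display d)
  'rV[T]_n (g_sigma_preimage coord) rV_set0 rV_setC rV_bigcup.

End measurable_rV.


Section lebesgue_rV.
Variable R : realType.

Definition cons_rV n (p : R * 'rV[R]_n) : 'rV[R]_n.+1 :=
  row_mx (const_mx p.1 : 'rV[R]_1) p.2.

Lemma measurable_coord_rV n (i : 'I_n) :
  measurable_fun [set: 'rV[R]_n] (fun v : 'rV[R]_n => v ord0 i).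
Proof.
move=> _ Y mY; rewrite setTI; apply: sub_sigma_algebra => /=.
rewrite -bigcup_seq/=; exists i => /=; first by rewrite mem_index_enum.
by exists Y => //; rewrite setTI.
Qed.

Lemma measurable_fun_rVP d (T : measurableType d) n (f : T -> 'rV[R]_n) :
  (forall i, measurable_fun [set: T] (fun t => f t ord0 i)) ->
  measurable_fun [set: T] f.
Proof.
move=> mf _ A mA; rewrite setTI.
suff : preimage_set_system [set: T] f
    (g_sigma_preimage (fun i (v : 'rV[R]_n) => v ord0 i)) `<=` measurable.
  by apply; exists A => //; rewrite setTI.
rewrite -(@g_sigma_preimage_comp _ _ _ _ (fun i (v : 'rV[R]_n) => v ord0 i)).
apply: smallest_sub; first exact: sigma_algebra_measurable.
rewrite -bigcup_seq => B [i _ [C mC <-]]; exact: mf.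
Qed.

Lemma cons_rV0 n (p : R * 'rV[R]_n) : cons_rV p ord0 ord0 = p.1.
Proof.
rewrite /cons_rV (_ : ord0 = lshift n (ord0 : 'I_1)); last exact/val_inj.
by rewrite (@row_mxEl R 1 1 n) mxE.
Qed.

Lemma cons_rVS n (p : R * 'rV[R]_n) i :
  cons_rV p ord0 (lift ord0 i) = p.2 ord0 i.
Proof.
rewrite /cons_rV (_ : lift ord0 i = rshift 1 i); last exact/val_inj.
by rewrite (@row_mxEr R 1 1 n).
Qed.

Lemma measurable_cons_rV n : measurable_fun setT (@cons_rV n).
Proof.
apply: measurable_fun_rVP => i; case: (unliftP ord0 i) => [j|] ->.
  under eq_fun do rewrite cons_rVS.
  exact: (measurableT_comp (measurable_coord_rV j) measurable_snd).
under eq_fun do rewrite cons_rV0.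
exact: measurable_fst.
Qed.

Section cons_measure.
Variables (n : nat) (mu : {sigma_finite_measure set 'rV[R]_n -> \bar R}).

Definition cons_measure : set 'rV[R]_n.+1 -> \bar R :=
  pushforward (lebesgue_measure \x mu)%E (@cons_rV n).

Let measurable_preimage_cons A : measurable A -> measurable (@cons_rV n @^-1` A).
Proof.
by move=> mA; rewrite -[X in measurable X]setTI; exact: measurable_cons_rV.
Qed.

Let nu0 : cons_measure set0 = 0%E.
Proof. by rewrite /cons_measure /pushforward preimage_set0 measure0. Qed.

Let nu_ge0 A : (0 <= cons_measure A)%E.
Proof. exact: (@measure_ge0 _ _ _ (@lebesgue_measure R \x mu)%E). Qed.

Let nu_sigma_additive : semi_sigma_additive cons_measure.
Proof.
move=> F mF tF mUF; rewrite /cons_measure /pushforward preimage_bigcup.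
apply: measure_semi_sigma_additive.
- by move=> k; exact: measurable_preimage_cons.
- apply/trivIsetP => /= i j _ _ ij; rewrite -preimage_setI.
  by move/trivIsetP : tF => /(_ _ _ _ _ ij) ->//; rewrite preimage_set0.
- by rewrite -preimage_bigcup; exact: measurable_preimage_cons.
Qed.

HB.instance Definition _ := isMeasure.Build _ _ _ cons_measure
  nu0 nu_ge0 nu_sigma_additive.

Let nu_sigma_finite : sigma_finite setT cons_measure.
Proof.
have [F FT Foo] : sigma_finite setT (lebesgue_measure \x mu)%E.
  have /sigma_finiteP[F [TF ndF Foo]] := sigma_finiteT (@lebesgue_measure R).
  have /sigma_finiteP[G [TG ndG Goo]] := sigma_finiteT mu.
  exists (fun k => F k `*` G k).
    rewrite -setXTT TF TG predeqE => -[x y]; split.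
      move=> [/= [j _ Fjx] [k _ Gky]]; exists (maxn j k) => //; split.
      - by move: x Fjx; exact/subsetPset/ndF/leq_maxl.
      - by move: y Gky; exact/subsetPset/ndG/leq_maxr.
    by move=> [k _ []/= ? ?]; split; exists k.
  move=> k; have [? ?] := Foo k; have [? ?] := Goo k.
  split; first exact: measurableX.
  by rewrite product_measure1E// lte_mul_pinfty// ge0_fin_numE.
pose h (v : 'rV[R]_n.+1) := (v ord0 ord0, rsubmx (v : 'rV_(1 + n))).
have mh : measurable_fun setT h.
  apply: measurable_fun_pair; first exact: measurable_coord_rV.
  by apply: measurable_fun_rVP => i /=; under eq_fun do rewrite mxE;
    exact: measurable_coord_rV.
have hK : cancel (@cons_rV n) h.
  by move=> [x v]; rewrite /h cons_rV0 /cons_rV row_mxKr.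
exists (fun k => h @^-1` F k); first by rewrite -preimage_bigcup -FT preimage_setT.
move=> k; have [mF Fk] := Foo k; split.
  by rewrite -[X in measurable X]setTI; exact: mh.
rewrite /cons_measure /pushforward -comp_preimage (_ : h \o _ = id)//.
by apply/funext => p; exact: hK.
Qed.

HB.instance Definition _ := Measure_isSigmaFinite.Build _ _ _ cons_measure
  nu_sigma_finite.

End cons_measure.

(* The n-fold product of [lebesgue_measure], transported along
   R * R^m ~ R^(m+1); see [lebesgue_rV_box]. *)
Fixpoint lebesgue_rV n : set 'rV[R]_n -> \bar R :=
  match n with
  | 0 => \d_(0 : 'rV[R]_0)
  | m.+1 => pushforward (lebesgue_measure \x @lebesgue_rV m)%E (@cons_rV m)
  end.

Lemma lebesgue_rV_measure n :
  exists mu : {sigma_finite_measure set 'rV[R]_n -> \bar R}, @lebesgue_rV n = mu.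
Proof.
elim: n => [|n [mu muE]]; first by exists (\d_(0 : 'rV[R]_0)).
by exists (cons_measure mu); rewrite /= muE.
Qed.

Section instances.
Variable n : nat.

Let lebesgue_rV0 : @lebesgue_rV n set0 = 0%E.
Proof. by have [mu ->] := lebesgue_rV_measure n. Qed.

Let lebesgue_rV_ge0 A : (0 <= @lebesgue_rV n A)%E.
Proof. by have [mu ->] := lebesgue_rV_measure n. Qed.

Let lebesgue_rV_sigma_additive : semi_sigma_additive (@lebesgue_rV n).
Proof.
by have [mu ->] := lebesgue_rV_measure n; exact: measure_semi_sigma_additive.
Qed.

HB.instance Definition _ := isMeasure.Build _ _ _ (@lebesgue_rV n)
  lebesgue_rV0 lebesgue_rV_ge0 lebesgue_rV_sigma_additive.

Let lebesgue_rV_sigma_finite : sigma_finite setT (@lebesgue_rV n).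
Proof. by have [mu ->] := lebesgue_rV_measure n; exact: sigma_finiteT. Qed.

HB.instance Definition _ := Measure_isSigmaFinite.Build _ _ _ (@lebesgue_rV n)
  lebesgue_rV_sigma_finite.

End instances.

Lemma lebesgue_rV_box n (A : 'I_n -> set R) : (forall i, measurable (A i)) ->
  lebesgue_rV [set v : 'rV[R]_n | forall i, A i (v ord0 i)] =
  (\prod_(i < n) lebesgue_measure (A i))%E.
Proof.
elim: n A => [|n IHn] A mA.
  rewrite big_ord0 /= diracE mem_set//= => -[]//.
have mB : measurable [set v : 'rV[R]_n |
    forall i : 'I_n, A (lift ord0 i) (v ord0 i)].
  rewrite (_ : [set v | _] = \bigcap_(i : 'I_n)
      ((fun v : 'rV[R]_n => v ord0 i) @^-1` A (lift ord0 i))).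
    apply: fin_bigcap_measurable => // i _.
    by rewrite -[X in measurable X]setTI; exact: measurable_coord_rV.
  by apply/seteqP; split => v /= vA i; [move=> _|]; exact: vA.
rewrite big_ord_recl -IHn//= /pushforward.
rewrite -product_measure1E; [|exact: mA|exact: mB].
apply: congr1; apply/seteqP; split => -[x v] /=.
  move=> vA; split => [|i]; first by have := vA ord0; rewrite cons_rV0.
  by have := vA (lift ord0 i); rewrite cons_rVS.
by move=> [Ax vA] i; case: (unliftP ord0 i) => [j|] ->;
  rewrite ?cons_rVS ?cons_rV0.
Qed.

End lebesgue_rV.

Arguments lebesgue_rV : clear implicits.

Section fourier.
Variables (R : realType) (n : nat).
Implicit Types (f h : 'rV[R]_n -> R[i]) (x xi : 'rV[R]_n) (m : 'rV[R]_n -> R).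

Definition dotp x xi : R := \sum_(i < n) x ord0 i * xi ord0 i.

(* The norm [`|x|] of the library on ['rV[R]_n] is the sup norm. *)
Definition enorm x : R := Num.sqrt (\sum_(i < n) x ord0 i ^+ 2).

Definition expi (t : R) : R[i] := cos t +i* sin t.

Definition cintegrable h : Prop :=
  (lebesgue_rV R n).-integrable setT (fun x => (complex.Re (h x))%:E) /\
  (lebesgue_rV R n).-integrable setT (fun x => (complex.Im (h x))%:E).

(* Takes junk values unless [cintegrable h]. *)
Definition cintegral h : R[i] :=
  (\int[lebesgue_rV R n]_x complex.Re (h x)) +i*
  (\int[lebesgue_rV R n]_x complex.Im (h x)).

(* For [0 < p < 1] this is still [(\int |h|^p)^(1/p)]: the library places no
   restriction on the exponent. *)
Definition Lpnorm (p : R) h : \bar R :=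
  Lnorm (lebesgue_rV R n) p%:E (fun x => (normc (h x))%:E).

Definition partial (i : 'I_n) f : 'rV[R]_n -> R[i] := fun x =>
  'D_(delta_mx ord0 i) (fun y => complex.Re (f y)) x +i*
  'D_(delta_mx ord0 i) (fun y => complex.Im (f y)) x.

Definition partials (a : seq 'I_n) f : 'rV[R]_n -> R[i] := foldr partial f a.

(* All iterated partial derivatives exist and are continuous. A multi-index is
   encoded by the list of successive directions of differentiation. *)
Definition smooth f : Prop := forall a : seq 'I_n,
  [/\ continuous (fun x => complex.Re (partials a f x)),
      continuous (fun x => complex.Im (partials a f x)) &
      forall (i : 'I_n) x,
        derivable (fun y => complex.Re (partials a f y)) x (delta_mx ord0 i) /\
        derivable (fun y => complex.Im (partials a f y)) x (delta_mx ord0 i)].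

Definition schwartz f : Prop :=
  smooth f /\
  forall (b : 'I_n -> nat) (a : seq 'I_n), exists M : R, forall x,
    `|\prod_(i < n) x ord0 i ^+ b i| * normc (partials a f x) <= M.

Definition fourier f : 'rV[R]_n -> R[i] := fun xi =>
  cintegral (fun x => f x * expi (- (2 * pi * dotp x xi))).

Definition fmultiplier_defined m f : Prop :=
  cintegrable (fun xi => (m xi)%:C * fourier f xi).

Definition fmultiplier m f : 'rV[R]_n -> R[i] := fun x =>
  cintegral (fun xi => (m xi)%:C * fourier f xi * expi (2 * pi * dotp xi x)).

(* For [s < 0] the library sets [0 `^ s = 0]; this only affects the point
   [xi = 0], which is negligible as soon as [0 < n]. *)
Definition Dsymbol (s : R) xi : R := enorm xi `^ s.

Definition Jsymbol (s : R) xi : R := (1 + enorm xi ^+ 2) `^ (s / 2).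

Definition Dop (s : R) := fmultiplier (Dsymbol s).
Definition Dop_defined (s : R) := fmultiplier_defined (Dsymbol s).

Definition Jop (s : R) := fmultiplier (Jsymbol s).
Definition Jop_defined (s : R) := fmultiplier_defined (Jsymbol s).

End fourier.

(* Main.v *)
(** Both operators have, up to a constant, the symbol (d + pi |xi|^2)^(s/2), with
    d = 0 for D^s and d = pi for J^s.

    For s > 0, r (n + s) <= n and take f = g Gaussian. Then f and D^s f lie in
    every L^p with p > 1, but since s is not an even integer |xi|^s is not smooth
    at the origin and D^s(f g) decays exactly like |x|^(- n - s), which is not in
    L^r. Subordination writes (d + pi |xi|^2)^(- b), b > 0, as a superposition of
    Gaussians and reduces the asymptotics to explicit heat kernels. For J^s,
    dilating the Gaussian replaces d by a parameter tending to 0, so by Fatou the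
    ratio of the two sides is unbounded.

    For s < 0, f and g are finite sums of translates of a Gaussian modulated by k
    and - k in the first variable. The product f g does not depend on k, while
    D^s f and D^s g tend to 0 in every L^p as k tends to infinity, the symbol
    being small near the frequencies k and - k. The Fourier transforms of f, g
    and f g are Gaussians times polynomials in an exponential of xi_1; these
    polynomials are chosen divisible by a high power of 1 - X, which cancels the
    singularity of the symbol at the origin. The left-hand side is positive by
    Parseval. *)
Require Import Defs.
From HB Require Import structures.
From mathcomp Require Import all_boot all_order all_algebra.
From mathcomp Require Import all_classical all_reals all_analysis.
From mathcomp Require Import complex measurable_realfun ring lra.

Set Implicit Arguments.
Unset Strict Implicit.
Unset Printing Implicit Defensive.

Import Order.TTheory GRing.Theory Num.Theory.
Import numFieldNormedType.Exports.

Local Open Scope classical_set_scope.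
Local Open Scope ring_scope.

(** * Integration, measurability and derivatives *)

(** All estimates are pointwise, against the weight [wgt], which lies in every L^p with p > 1: one
    bound settles all norms on the right, and this is where the exponents have to exceed 1. Since
    1/r = 1/p + 1/q, dilations multiply both sides by the same factor, so the scale is free when s >
    0.

    For s > 0 write s = 2 (m - b) with 0 < b < 1. Up to nonzero Gamma factors, the coefficient of
    |x|^(- n - s) at infinity is the product of the b - j, 1 <= j <= m; an even s is exactly what
    would bring in a zero factor.

    For s < 0 the obstacle is that |xi|^s need not be integrable at the origin, so the transforms of
    f, g and f g must all vanish there. The product of trains with polynomials P and Q does not have
    the polynomial P Q: Gaussians centred at j and l overlap with the weight e^(- pi (j - l)^2 / 2),
    and the vanishing of P and Q at 1 is lost. It is recovered by linear algebra, leaving the second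
    polynomial enough free coefficients; the deformed product of nonzero polynomials is still
    nonzero, which keeps the left side positive. *)

Section nonneg_integral.
Context d (T : measurableType d) (R : realType).
Variable mu : {measure set T -> \bar R}.

(* Unlike [ge0_le_integral], no measurability is required. *)
Lemma ge0_le_integralT (f g : T -> \bar R) :
  (forall x, 0 <= f x)%E -> (forall x, f x <= g x)%E ->
  (\int[mu]_x f x <= \int[mu]_x g x)%E.
Proof.
move=> f0 fg; have g0 x : (0 <= g x)%E := le_trans (f0 x) (fg x).
rewrite !ge0_integralTE//; apply: le_ereal_sup => _ [h hf <-].
by exists h => // x; exact: le_trans (hf x) (fg x).
Qed.

Lemma integrable_le (f g : T -> R) : measurable_fun setT f ->
  (forall x, `|f x| <= g x) -> mu.-integrable setT (EFin \o g) ->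
  mu.-integrable setT (EFin \o f).
Proof.
move=> mf fg ig; apply: (le_integrable _ _ _ ig) => //.
  exact/measurable_EFinP.
by move=> x _ /=; rewrite lee_fin (le_trans (fg x))// ler_norm.
Qed.

Lemma integrable_lt (f : T -> R) : measurable_fun setT f ->
  (forall x, 0 <= f x) -> (\int[mu]_x (f x)%:E < +oo)%E ->
  mu.-integrable setT (EFin \o f).
Proof.
move=> mf f0 fi; apply/integrableP; split; first exact/measurable_EFinP.
apply: le_lt_trans fi; by apply: ge0_le_integralT => x /=; rewrite lee_fin ?normr_ge0// ger0_norm.
Qed.

Lemma ge0_integral_fin (f : T -> R) : mu.-integrable setT (EFin \o f) ->
  (\int[mu]_x f x)%:E = (\int[mu]_x (f x)%:E)%E.
Proof. by move=> fi; rewrite fineK//; exact: integrable_fin_num. Qed.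

Lemma Rintegral_le (f g : T -> R) : mu.-integrable setT (EFin \o f) ->
  mu.-integrable setT (EFin \o g) -> (forall x, f x <= g x) ->
  \int[mu]_x f x <= \int[mu]_x g x.
Proof. by move=> *; apply: le_Rintegral. Qed.

Lemma normr_Rintegral_le (f g : T -> R) : measurable_fun setT f ->
  (forall x, `|f x| <= g x) -> mu.-integrable setT (EFin \o g) ->
  `|\int[mu]_x f x| <= \int[mu]_x g x.
Proof.
move=> mf fg ig; have fi := integrable_le mf fg ig.
apply: le_trans (le_normr_Rintegral measurableT fi) _.
by apply: Rintegral_le => //; exact: integrable_norm.
Qed.

Lemma integrableZ (f : T -> R) c : mu.-integrable setT (EFin \o f) ->
  mu.-integrable setT (EFin \o (fun x => c * f x)).
Proof.
move=> fi; have := integrableZl measurableT c fi.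
by apply: eq_integrable => // x _ /=; rewrite EFinM.
Qed.

Lemma integrable_plus (f g : T -> R) : mu.-integrable setT (EFin \o f) ->
  mu.-integrable setT (EFin \o g) ->
  mu.-integrable setT (EFin \o (fun x => f x + g x)).
Proof.
move=> fi gi; have := integrableD measurableT fi gi.
by apply: eq_integrable.
Qed.

Lemma measurable_of_integrable (f : T -> R) :
  mu.-integrable setT (EFin \o f) -> measurable_fun setT f.
Proof. by move=> /integrableP[/measurable_EFinP]. Qed.

Lemma integrable_sumr (I : Type) (s : seq I) (f : I -> T -> R) :
  (forall i, mu.-integrable setT (EFin \o f i)) ->
  mu.-integrable setT (EFin \o (fun x => \sum_(i <- s) f i x)).
Proof.
move=> fi; elim: s => [|i s IH].
  by under eq_fun do rewrite big_nil; exact: integrable0.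
by under eq_fun do rewrite big_cons; exact: integrable_plus.
Qed.

Lemma Rintegral_sum (I : Type) (s : seq I) (f : I -> T -> R) :
  (forall i, mu.-integrable setT (EFin \o f i)) ->
  \int[mu]_x (\sum_(i <- s) f i x) = \sum_(i <- s) \int[mu]_x f i x.
Proof.
move=> fi; elim: s => [|i s IH].
  under eq_Rintegral do rewrite big_nil.
  by rewrite big_nil /Rintegral integral0_eq.
under eq_Rintegral do rewrite big_cons.
by rewrite big_cons RintegralD ?IH//; exact: integrable_sumr.
Qed.

(* A change of variables formula extends from nonnegative functions to
   integrable ones. *)
Lemma change_of_variables (phi : T -> T) (c : R) : 0 < c ->
  (forall g : T -> R, measurable_fun setT g -> measurable_fun setT (g \o phi)) ->
  (forall g : T -> R, measurable_fun setT g -> (forall x, 0 <= g x) ->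
    (\int[mu]_x (g x)%:E = c%:E * \int[mu]_x (g (phi x))%:E)%E) ->
  forall f : T -> R, mu.-integrable setT (EFin \o f) ->
  mu.-integrable setT (EFin \o (f \o phi)) /\
  \int[mu]_x f x = c * \int[mu]_x f (phi x).
Proof.
move=> c0 mphi ge0.
have I (f : T -> R) : mu.-integrable setT (EFin \o f) ->
    mu.-integrable setT (EFin \o (f \o phi)).
  move=> fi; have mf := measurable_of_integrable fi.
  apply/integrableP; split; first by apply/measurable_EFinP; exact: mphi.
  case/integrableP : fi => _; rewrite (ge0 (fun x => `|f x|)) => [H||//]; last first.
    exact: measurableT_comp.
  apply/negPn/negP; rewrite -leNgt leye_eq => /eqP E.
  by move: H; rewrite E mulry gtr0_sg// mul1e.
have E (g : T -> R) : mu.-integrable setT (EFin \o g) ->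
    \int[mu]_x g x = \int[mu]_x (`|g x| + g x) - \int[mu]_x `|g x|.
  move=> gi; have ni := integrable_norm gi; have si := integrable_plus ni gi.
  by rewrite -RintegralB//; apply: eq_Rintegral => x _; rewrite addrAC subrr add0r.
have G (g : T -> R) : (forall x, 0 <= g x) -> mu.-integrable setT (EFin \o g) ->
    \int[mu]_x g x = c * \int[mu]_x g (phi x).
  move=> g0 gi; have mg := measurable_of_integrable gi.
  by rewrite /Rintegral ge0// fineM//; apply: integrable_fin_num => //; exact: I.
move=> f fi; split; first exact: I.
have ni := integrable_norm fi; have si := integrable_plus ni fi.
rewrite [LHS]E// [in RHS]E; last exact: I.
rewrite G//; last by move=> x; rewrite addrC -lerBlDr sub0r lerNl -normrN ler_norm.
by rewrite [X in _ - X]G// mulrBr.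
Qed.

End nonneg_integral.

Section measurability.
Context d (T : measurableType d) (R : realType).
Implicit Types f g : T -> R.

Lemma measD f g : measurable_fun setT f -> measurable_fun setT g ->
  measurable_fun setT (fun x => f x + g x).
Proof. exact: measurable_funD. Qed.

Lemma measB f g : measurable_fun setT f -> measurable_fun setT g ->
  measurable_fun setT (fun x => f x - g x).
Proof. exact: measurable_funB. Qed.

Lemma measM f g : measurable_fun setT f -> measurable_fun setT g ->
  measurable_fun setT (fun x => f x * g x).
Proof. exact: measurable_funM. Qed.

Lemma measN f : measurable_fun setT f -> measurable_fun setT (fun x => - f x).
Proof. by move=> mf; exact: measurableT_comp. Qed.

Lemma measX f n : measurable_fun setT f -> measurable_fun setT (fun x => f x ^+ n).
Proof. exact: measurable_funX. Qed.

Lemma meas_norm f : measurable_fun setT f -> measurable_fun setT (fun x => `|f x|).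
Proof. by move=> mf; exact: measurableT_comp. Qed.

Lemma meas_exp f : measurable_fun setT f -> measurable_fun setT (fun x => expR (f x)).
Proof. by move=> mf; exact: measurableT_comp. Qed.

Lemma meas_continuous (h : R -> R) f : continuous h -> measurable_fun setT f ->
  measurable_fun setT (fun x => h (f x)).
Proof.
by move=> ch mf; apply: (measurableT_comp _ mf); exact: continuous_measurable_fun.
Qed.

Lemma meas_cos f : measurable_fun setT f -> measurable_fun setT (fun x => cos (f x)).
Proof. by apply: meas_continuous; exact: continuous_cos. Qed.

Lemma meas_sin f : measurable_fun setT f -> measurable_fun setT (fun x => sin (f x)).
Proof. by apply: meas_continuous; exact: continuous_sin. Qed.

Lemma meas_powR f p : measurable_fun setT f ->
  measurable_fun setT (fun x => f x `^ p).
Proof. by move=> mf; exact: (measurableT_comp (measurable_powR p)). Qed.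

Lemma meas_sum I (s : seq I) (P : pred I) (f : I -> T -> R) :
  (forall i, measurable_fun setT (f i)) ->
  measurable_fun setT (fun x => \sum_(i <- s | P i) f i x).
Proof.
move=> mf; elim: s => [|a s IH].
  by under eq_fun do rewrite big_nil; exact: measurable_cst.
under eq_fun do rewrite big_cons; case: (P a) => //.
exact: measD.
Qed.

Lemma meas_prod I (s : seq I) (P : pred I) (f : I -> T -> R) :
  (forall i, measurable_fun setT (f i)) ->
  measurable_fun setT (fun x => \prod_(i <- s | P i) f i x).
Proof.
move=> mf; elim: s => [|a s IH].
  by under eq_fun do rewrite big_nil; exact: measurable_cst.
under eq_fun do rewrite big_cons; case: (P a) => //.
exact: measM.
Qed.

Lemma meas_inv1D f : measurable_fun setT f ->
  measurable_fun setT (fun x => (1 + `|f x|)^-1).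
Proof.
move=> mf; apply: (@meas_continuous (fun y => (1 + `|y|)^-1)) => // y.
apply: cvgV; first by rewrite gt_eqF// ltr_pwDl.
by apply: cvgD; [exact: cvg_cst|apply: cvg_norm; exact: cvg_id].
Qed.

Lemma meas_horner f (p : {poly R}) : measurable_fun setT f ->
  measurable_fun setT (fun x => p.[f x]).
Proof.
move=> mf; under eq_fun do rewrite horner_coef.
by apply: meas_sum => i; apply: measM; [exact: measurable_cst|exact: measX].
Qed.

End measurability.

Ltac mtac := repeat (first
  [ exact: measurable_cst
  | assumption
  | apply: measD | apply: measB | apply: measN | apply: measM | apply: measX
  | apply: meas_exp | apply: meas_cos | apply: meas_sin | apply: meas_norm
  | apply: meas_inv1D | apply: meas_powR | apply: meas_horner
  | apply: meas_sum => ? | apply: meas_prod => ?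
  | exact: measurable_fst | exact: measurable_snd | exact: measurable_id
  | exact: measurable_coord_rV
  | exact: (measurableT_comp (@measurable_coord_rV _ _ _ _) measurable_fst)
  | exact: (measurableT_comp (@measurable_coord_rV _ _ _ _) measurable_snd)]).

Section derivatives.
Context (R : realType).
Implicit Types (f g h : R -> R) (x a b c : R).

(* A copy of [is_derive] that is not a type class, so that [apply:] does not
   trigger the search for instances. *)
Definition hasder f x a := is_derive x 1 f a.

Lemma derE f x a b : hasder f x a -> a = b -> hasder f x b.
Proof. by move=> + <-. Qed.

Lemma derD f g x a b : hasder f x a -> hasder g x b ->
  hasder (fun y => f y + g y) x (a + b).
Proof. by move=> df dg; exact: (is_deriveD df dg). Qed.

Lemma derB f g x a b : hasder f x a -> hasder g x b ->
  hasder (fun y => f y - g y) x (a - b).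
Proof. by move=> df dg; exact: (is_deriveB df dg). Qed.

Lemma derM f g x a b : hasder f x a -> hasder g x b ->
  hasder (fun y => f y * g y) x (a * g x + f x * b).
Proof.
move=> df dg; apply: derE; first exact: (is_deriveM df dg).
by rewrite /GRing.scale/= addrC (mulrC (g x)).
Qed.

Lemma derC c x : hasder (fun=> c : R) x 0.
Proof. exact: is_derive_cst. Qed.

Lemma derid x : hasder (fun y : R => y) x 1.
Proof. exact: is_derive_id. Qed.

Lemma derN f x a : hasder f x a -> hasder (fun y => - f y) x (- a).
Proof. by move=> df; exact: (is_deriveN df). Qed.

Lemma derX f x a n : hasder f x a ->
  hasder (fun y => f y ^+ n.+1) x (n.+1%:R * f x ^+ n * a).
Proof. by rewrite /hasder => df; rewrite -(exprfctE f); exact: (is_deriveX n.+1 df). Qed.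

Lemma der_comp h f x a b : hasder h (f x) b ->
  hasder f x a -> hasder (fun y => h (f y)) x (b * a).
Proof. by move=> dh df; exact: (is_derive1_comp dh df). Qed.

Lemma der_exp f x a : hasder f x a ->
  hasder (fun y => expR (f y)) x (expR (f x) * a).
Proof. by move=> df; apply: (@der_comp expR) df; exact: is_derive_expR. Qed.

Lemma der_cos f x a : hasder f x a ->
  hasder (fun y => cos (f y)) x (- sin (f x) * a).
Proof. by move=> df; apply: (@der_comp (@cos R)) df; exact: is_derive_cos. Qed.

Lemma der_sin f x a : hasder f x a ->
  hasder (fun y => sin (f y)) x (cos (f x) * a).
Proof. by move=> df; apply: (@der_comp (@sin R)) df; exact: is_derive_sin. Qed.

Lemma der_ln f x a : 0 < f x -> hasder f x a ->
  hasder (fun y => ln (f y)) x ((f x)^-1 * a).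
Proof. by move=> fx df; apply: (@der_comp (@ln R)) df; exact: is_derive1_ln. Qed.

Lemma der_continuous f x a : hasder f x a -> {for x, continuous f}.
Proof.
by rewrite /hasder => df; apply/differentiable_continuous/derivable1_diffP.
Qed.

Lemma der_derive1 f x a : hasder f x a -> derive1 f x = a.
Proof. by rewrite /hasder => df; rewrite derive1E; exact: derive_val. Qed.

Lemma der_derivable f x a : hasder f x a -> derivable f x 1.
Proof. by case. Qed.

End derivatives.

Ltac dtac := repeat (first [ exact: derC | exact: derid | eassumption
  | apply: der_exp | apply: der_cos | apply: der_sin | apply: derX
  | apply: derN | apply: derM | apply: derB | apply: derD ]).

(** * Lebesgue integration on the line and on [R^n] *)

Section affine.
Context (R : realType).
Local Notation mu := (@lebesgue_measure R).

(** By uniqueness of Lebesgue measure it suffices to compare both sides on half-open intervals,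
    whose preimages are again half-open intervals. *)
Lemma lebesgue_measure_affine (c d : R) (A : set R) : 0 < c -> measurable A ->
  mu A = (c%:E * pushforward mu (fun x : R => (c * x + d)%R : measurableTypeR R) A)%E.
Proof.
move=> c0 mA.
have mphi : @measurable_fun _ _ (measurableTypeR R) (measurableTypeR R) setT
    (fun x : R => (c * x + d)%R).
  have : measurable_fun setT (fun x : R => (c * x + d)%R) by mtac.
  exact.
pose phi : {mfun measurableTypeR R >-> measurableTypeR R} :=
  HB.pack (fun x : R => (c * x + d)%R : measurableTypeR R)
    (@isMeasurableFun.Build _ _ (measurableTypeR R) (measurableTypeR R) _ mphi).
have := @lebesgue_measure_unique R (mscale (NngNum (ltW c0)) (pushforward mu phi)) _ A mA.
apply => _ [[a b] _ <-]; rewrite /=.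
change (mu `]a, b] = (c%:E * mu ((fun x : R => (c * x + d)%R) @^-1` `]a, b]))%E).
rewrite (_ : _ @^-1` _ = `]((a - d) / c), ((b - d) / c)]%classic); last first.
  apply/seteqP; split => x; rewrite /= !in_itv/= ltr_pdivrMr// ler_pdivlMr//;
  by rewrite ltrBlDr lerBrDr mulrC.
rewrite !lebesgue_measure_itv/= !lte_fin ltr_pM2r ?invr_gt0// ltrD2r.
case: ifP => ab; last by rewrite mule0.
rewrite -!EFinD -EFinM; congr EFin; field.
by rewrite gt_eqF.
Qed.

Lemma ge0_integral_affine (c d : R) (f : R -> \bar R) : 0 < c ->
  measurable_fun setT f -> (forall x, 0 <= f x)%E ->
  (\int[mu]_x f x = c%:E * \int[mu]_x f (c * x + d)%R)%E.
Proof.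
move=> c0 mf f0.
have mphi : @measurable_fun _ _ (measurableTypeR R) (measurableTypeR R) setT
    (fun x : R => (c * x + d)%R).
  have : measurable_fun setT (fun x : R => (c * x + d)%R) by mtac.
  exact.
pose phi : {mfun measurableTypeR R >-> measurableTypeR R} :=
  HB.pack (fun x : R => (c * x + d)%R : measurableTypeR R)
    (@isMeasurableFun.Build _ _ (measurableTypeR R) (measurableTypeR R) _ mphi).
rewrite (@eq_measure_integral _ _ _ setT
  (mscale (NngNum (ltW c0)) (pushforward mu phi))); last first.
  by move=> A mA _; exact: lebesgue_measure_affine.
rewrite ge0_integral_mscale//= ge0_integral_pushforward//=.

Qed.

Lemma Rintegral_translate (d : R) (f : R -> R) : mu.-integrable setT (EFin \o f) ->
  mu.-integrable setT (EFin \o (fun x : R => f (x + d))) /\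
  \int[mu]_x f x = \int[mu]_x f (x + d).
Proof.
move=> fi; rewrite -[\int[mu]_x f (x + d)]mul1r.
apply: (@change_of_variables _ _ _ mu (fun x : R => x + d) 1) => // g mg.
  by apply: (measurableT_comp mg); mtac.
move=> g0; rewrite (@ge0_integral_affine 1 d)//.
  by congr (_ * _)%E; apply: eq_integral => x _; rewrite mul1r.
exact/measurable_EFinP.
Qed.

Lemma Rintegral_opp (f : R -> R) : mu.-integrable setT (EFin \o f) ->
  mu.-integrable setT (EFin \o (fun x : R => f (- x))) /\
  \int[mu]_x f x = \int[mu]_x f (- x).
Proof.
move=> fi; rewrite -[\int[mu]_x f (- x)]mul1r.
have mN : @measurable_fun _ _ (measurableTypeR R) (measurableTypeR R) setT
    (fun x : R => (- x)%R).
  have : measurable_fun setT (fun x : R => (- x)%R) by mtac.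
  exact.
pose phi : {mfun measurableTypeR R >-> measurableTypeR R} :=
  HB.pack (fun x : R => (- x)%R : measurableTypeR R)
    (@isMeasurableFun.Build _ _ (measurableTypeR R) (measurableTypeR R) _ mN).
apply: (@change_of_variables _ _ _ mu (fun x : R => - x) 1) => // g mg.
  exact: (measurableT_comp mg).
move=> g0; rewrite mul1e.
rewrite (@eq_measure_integral _ _ _ setT (pushforward mu phi)); last first.
  by move=> A mA _; exact/esym/lebesgue_measureN.
rewrite ge0_integral_pushforward//; first exact/measurable_EFinP.
by move=> x _; rewrite lee_fin.
Qed.

End affine.

Section inverse_powers.
Context (R : realType).
Local Notation mu := (@lebesgue_measure R).

(** [F p] is the primitive of (1 + x)^(- p) that vanishes at infinity. Powers are written through
    [expR] and [ln] so that the differentiation rules apply. *)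
Let F (p x : R) : R := (1 - p)^-1 * expR ((1 - p) * ln (1 + x)).
Let f (p x : R) : R := expR (- p * ln (1 + x)).

Let dF (p x : R) : 1 < p -> 0 <= x -> hasder (F p) x (f p x).
Proof.
move=> p1 x0; have x1 : 0 < 1 + x by rewrite ltr_pwDl.
apply: derE.
  rewrite /F; apply: derM; first exact: derC.
  apply: der_exp; apply: derM; first exact: derC.
  by apply: (der_ln x1); dtac.
rewrite /= mul0r add0r mul0r !add0r mulr1.
have p2 : 1 - p != 0 by rewrite subr_eq0 lt_eqF.
rewrite /f mulrBl mul1r expRD lnK ?posrE// mulNr.
by field; rewrite p2 gt_eqF.
Qed.

Let F_cvg (p : R) : 1 < p -> F p x @[x --> +oo] --> (0 : R).
Proof.
move=> p1; rewrite -(mulr0 (1 - p)^-1); apply: cvgM; first exact: cvg_cst.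
apply/cvgrPdist_le => e e0; near=> x.
rewrite sub0r normrN ger0_norm ?expR_ge0// -[leRHS]lnK ?posrE// ler_expR.
have x1 : 0 < 1 + x by rewrite ltr_pwDl//; near: x; exact: nbhs_pinfty_ge.
rewrite -(opprB p) mulNr lerNl mulrC -ler_pdivrMr ?subr_gt0//.
rewrite -[leLHS]expRK ler_ln ?posrE ?expR_gt0// -lerBlDl.
by near: x; apply: nbhs_pinfty_ge; rewrite num_real.
Unshelve. all: by end_near. Qed.

Lemma integrable_inv1D (p : R) : 1 < p ->
  mu.-integrable setT (EFin \o (fun x : R => (1 + `|x|)^-1 `^ p)).
Proof.
move=> p1.
have fE (x : R) : (1 + `|x|)^-1 `^ p = f p `|x|.
  have x1 : 0 < 1 + `|x| by rewrite ltr_pwDl.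
  by rewrite /powR invr_eq0 gt_eqF// lnV ?posrE// mulrN -mulNr.
have cf : continuous (fun x : R => f p `|x|).
  move=> x; apply: (@continuous_comp _ _ _ (fun x : R => `|x|) (f p)).
    exact: norm_continuous.
  have x1 : 0 < 1 + `|x| by rewrite ltr_pwDl.
  rewrite /f; apply: der_continuous; apply: der_exp; apply: derM; first exact: derC.
  by apply: (der_ln x1); dtac.
apply: integrable_lt => [|x|].
- apply: meas_powR; apply: meas_inv1D; exact: measurable_id.
- exact: powR_ge0.
under eq_integral do rewrite fE.
rewrite ge0_symfun_integralT//; last 2 first.
- by move=> x; exact: expR_ge0.
- by move=> x /=; rewrite normrN.
rewrite -set_itvcy.
under eq_integral => x.
  rewrite inE/= in_itv/= andbT => x0; rewrite ger0_norm//.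
  over.
rewrite (@ge0_continuous_FTC2y _ (f p) (F p) 0 0).
- by rewrite -EFinB -EFinM ltry.
- by move=> x _; exact: expR_ge0.
- apply: (@subspace_eq_continuous _ _ _ (fun x : R => f p `|x|)).
    by move=> x /=; rewrite inE/= in_itv/= andbT => x0; rewrite ger0_norm.
  exact: continuous_subspaceT.
- exact: F_cvg.
- by move=> x x0; apply: der_derivable; apply: dF => //; exact: ltW.
- by apply: cvg_at_right_filter; apply: der_continuous; exact: dF.
- move=> x; rewrite in_itv/= andbT => x0; apply: der_derive1; apply: dF => //.
  exact: ltW.
Qed.

Lemma integrable_inv1D2 :
  mu.-integrable setT (EFin \o (fun x : R => (1 + `|x|)^-1 ^+ 2)).
Proof.
have := @integrable_inv1D 2 (ltr1n _ 2).
apply: eq_integrable => // x _ /=.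
by rewrite -powR_mulrn// invr_ge0 addr_ge0.
Qed.

Lemma integral_inv1D2_translate (c : R) :
  \int[mu]_x ((1 + `|x + c|)^-1 ^+ 2) = \int[mu]_x ((1 + `|x|)^-1 ^+ 2) /\
  mu.-integrable setT (EFin \o (fun x : R => (1 + `|x + c|)^-1 ^+ 2)).
Proof.
have mf : measurable_fun setT (fun x : R => (1 + `|x + c|)^-1 ^+ 2) by mtac.
have E : (\int[mu]_x ((1 + `|x + c|)^-1 ^+ 2)%:E =
    \int[mu]_x ((1 + `|x|)^-1 ^+ 2)%:E)%E.
  rewrite [RHS](@ge0_integral_affine _ 1 c) ?mul1e//.
  - by apply: eq_integral => x _; rewrite mul1r.
  - by apply/measurable_EFinP; mtac.
split; first by rewrite /Rintegral E.
apply: integrable_lt => //.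
by rewrite E -ge0_integral_fin ?ltry//; exact: integrable_inv1D2.
Qed.

(* The fundamental theorem of calculus on the whole line, for a primitive
   vanishing at infinity. *)
Lemma Rintegral_derive0 (G g : R -> R) :
  (forall x : R, hasder G x (g x)) -> continuous g ->
  mu.-integrable setT (EFin \o g) ->
  (G k%:R @[k --> \oo] --> (0 : R)) -> (G (- k%:R) @[k --> \oo] --> (0 : R)) ->
  \int[mu]_x g x = 0.
Proof.
move=> dG cg ig Gy GNy.
have mg : measurable_fun setT g by exact: continuous_measurable_fun.
pose I k : set R := `[- k%:R, k%:R]%classic.
(* The index is [k.+1] because the fundamental theorem is applied on a nondegenerate interval. *)
have E k : (\int[mu]_x ((EFin \o g) \_ (I k.+1)) x)%E = (G k.+1%:R - G (- k.+1%:R))%:E.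
  rewrite -integral_mkcond (@continuous_FTC2 _ g G)//.
  - by rewrite (@lt_trans _ _ 0) ?oppr_lt0 ?ltr0n.
  - exact: continuous_subspaceT.
  - split=> [x _||].
    + by apply: der_derivable; exact: dG.
    + by apply: cvg_at_right_filter; apply: der_continuous; exact: dG.
    + by apply: cvg_at_left_filter; apply: der_continuous; exact: dG.
  - by move=> x _; apply: der_derive1; exact: dG.
have c1 : (\int[mu]_x ((EFin \o g) \_ (I k.+1)) x)%E @[k --> \oo] -->
    (\int[mu]_x (EFin \o g) x)%E.
  apply: (@dominated_cvg _ _ _ mu setT measurableT
    (fun k => (EFin \o g) \_ (I k.+1)) _ (fun x => `|g x|%:E)) => //.
  - move=> k; apply: (measurable_restrictT (EFin \o g) _).1; first exact: measurable_itv.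
    by apply/measurable_EFinP; exact: measurable_funTS.
  - move=> x _; apply: cvg_near_cst; near=> k.
    rewrite /patch mem_set// /I /= in_itv/=.
    rewrite -ler_norml (le_trans (ltW (truncnS_gt _)))// ler_nat ltnS.
    by near: k; exact: nbhs_infty_ge.
  - exact: integrable_norm.
  - by move=> k x _; rewrite /patch; case: ifP => _ //=; rewrite normr0 lee_fin.
have c2 : (\int[mu]_x ((EFin \o g) \_ (I k.+1)) x)%E @[k --> \oo] --> (0%R)%:E.
  under eq_fun do rewrite E.
  apply: cvg_EFin; first by near=> k.
  rewrite -(subr0 (0 : R)); apply: cvgB.
    by move: Gy; rewrite -(cvg_shiftS (fun k => G k%:R)).
  by move: GNy; rewrite -(cvg_shiftS (fun k => G (- k%:R))).
by rewrite /Rintegral (cvg_unique _ c1 c2).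
Unshelve. all: by end_near. Qed.

End inverse_powers.

(** * Fubini for real-valued integrals *)

Section fubini.
Context d1 d2 (T1 : measurableType d1) (T2 : measurableType d2) (R : realType).
Variable m1 : {sigma_finite_measure set T1 -> \bar R}.
Variable m2 : {sigma_finite_measure set T2 -> \bar R}.

(** The integral is the difference of the integrals of the positive and negative parts, each
    measurable by Tonelli. This covers every point, also those whose section fails to be
    integrable. *)
Lemma measurable_fun_fubini_F (g : T1 * T2 -> \bar R) : measurable_fun setT g ->
  measurable_fun setT (fun x => \int[m2]_y g (x, y))%E.
Proof.
move=> mg; rewrite (_ : (fun x => _) = (fun x => (\int[m2]_y g^\+ (x, y)) -
    (\int[m2]_y g^\- (x, y)))%E); last first.
  apply/funext => x; rewrite [LHS]integralE.
  under eq_integral do rewrite funepos_comp/=.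
  by under [X in (_ - X = _)%E]eq_integral do rewrite funeneg_comp/=.
apply: emeasurable_funB.
  by apply: measurable_fun_fubini_tonelli_F => //; exact: measurable_funepos.
by apply: measurable_fun_fubini_tonelli_F => //; exact: measurable_funeneg.
Qed.

Lemma meas_Rintegral (f : T1 * T2 -> R) : measurable_fun setT f ->
  measurable_fun setT (fun x => \int[m2]_y f (x, y)).
Proof.
move=> mf; apply: measurableT_comp; first exact: fine_measurable.
by apply: (@measurable_fun_fubini_F (EFin \o f)); exact/measurable_EFinP.
Qed.

(** The inner real integral is a [fine], hence takes a default value where a section is not
    integrable; such points form a null set, so the extended-valued Fubini theorem transfers. *)
Lemma RFubini (f : T1 * T2 -> R) : (m1 \x m2)%E.-integrable setT (EFin \o f) ->
  \int[m1]_x \int[m2]_y f (x, y) = \int[m2]_y \int[m1]_x f (x, y).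
Proof.
move=> fi; have H := Fubini fi.
transitivity (fine (\int[m1]_x \int[m2]_y (f (x, y))%:E)%E).
  congr fine; apply: ae_eq_integral => //.
  - apply/measurable_EFinP; apply: meas_Rintegral.
    exact: measurable_of_integrable fi.
  - exact: (measurable_fubini_F fi).
  - apply: filterS (ae_integrable1 fi) => a ia _ /=.
    by rewrite fineK//; apply: integrable_fin_num.
rewrite H; congr fine; apply: ae_eq_integral => //.
- exact: (measurable_fubini_G fi).
- apply/measurable_EFinP.
  apply: measurableT_comp; first exact: fine_measurable.
  exact: (measurable_fubini_G fi).
- apply: filterS (ae_integrable2 fi) => a ia _ /=.
  by rewrite fineK//; apply: integrable_fin_num.
Qed.

End fubini.

Section rV_integral.
Context (R : realType).
Local Notation mu := (@lebesgue_measure R).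
Local Notation leb n := (lebesgue_rV R n).

Lemma meas_cons_rV d (T : measurableType d) n (f : 'rV[R]_n.+1 -> T) :
  measurable_fun setT f -> measurable_fun setT (fun p => f (cons_rV p)).
Proof. by move=> mf; apply: (measurableT_comp mf); exact: measurable_cons_rV. Qed.

Let mcons n : @measurable_fun _ _ (measurableTypeR R * 'rV[R]_n)%type
  'rV[R]_n.+1 setT (@cons_rV R n).
Proof. exact: measurable_cons_rV. Qed.

Lemma rV_affineE n c (x v : 'rV[R]_n) i :
  (c *: x + v) ord0 i = c * x ord0 i + v ord0 i.
Proof. by rewrite !mxE. Qed.

Lemma ge0_integral_rVS n (f : 'rV[R]_n.+1 -> \bar R) : measurable_fun setT f ->
  (forall x, 0 <= f x)%E ->
  (\int[leb n.+1]_x f x = \int[mu]_a \int[leb n]_v f (cons_rV (a, v)))%E.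
Proof.
move=> mf f0.
transitivity (\int[mu \x leb n]_p f (cons_rV p))%E.
  have := @ge0_integral_pushforward _ _ _ _ R _ (@mcons n)
    (mu \x leb n)%E setT f measurableT mf (fun y _ => f0 y).
  by rewrite preimage_setT.
by rewrite fubini_tonelli1//; exact: meas_cons_rV.
Qed.

Lemma ge0_measurable_rVS n (f : 'rV[R]_n.+1 -> \bar R) : measurable_fun setT f ->
  (forall x, 0 <= f x)%E ->
  measurable_fun setT (fun a : R => \int[leb n]_v f (cons_rV (a, v)))%E.
Proof.
move=> mf f0; apply: (@measurable_fun_fubini_tonelli_F _ _ (measurableTypeR R) _ R (leb n)
  (f \o @cons_rV R n)) => //=; exact: meas_cons_rV.
Qed.

Lemma integral_rV0 (f : 'rV[R]_0 -> \bar R) : (\int[leb 0]_x f x = f 0%R)%E.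
Proof.
rewrite integral_dirac ?diracT ?mul1e//.
rewrite (_ : f = cst (f 0%R)); first exact: measurable_cst.
by apply/funext => x; rewrite [x]thinmx0.
Qed.

Lemma cons_rV_surj n (v : 'rV[R]_n.+1) :
  v = cons_rV (v ord0 ord0, rsubmx (v : 'rV_(1 + n))).
Proof.
apply/rowP => i; case: (unliftP ord0 i) => [j|] ->.
  rewrite cons_rVS mxE; congr (v _ _); exact/val_inj.
by rewrite cons_rV0.
Qed.

Lemma Rintegral_rVS n (f : 'rV[R]_n.+1 -> R) :
  (leb n.+1).-integrable setT (EFin \o f) ->
  \int[leb n.+1]_x f x = \int[mu]_a \int[leb n]_v f (cons_rV (a, v)).
Proof.
move=> fi.
have mf := measurable_of_integrable fi.
have fi' : (mu \x leb n)%E.-integrable setT (EFin \o (fun p => f (cons_rV p))).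
  apply/integrableP; split.
    by apply/measurable_EFinP; exact: meas_cons_rV.
  case/integrableP : fi => _.
  have := @ge0_integral_pushforward _ _ _ _ R _ (@mcons n)
    (mu \x leb n)%E setT (fun x => `|(f x)%:E|)%E measurableT.
  rewrite preimage_setT => <-//.
  by apply/measurable_EFinP; exact: meas_norm.
rewrite /Rintegral.
have -> : (\int[leb n.+1]_x (f x)%:E = \int[mu \x leb n]_p (f (cons_rV p))%:E)%E.
  have := @integral_pushforward _ _ _ _ R _ (@mcons n)
    (mu \x leb n)%E setT (EFin \o f).
  rewrite preimage_setT => -> //.
  exact/measurable_EFinP.
rewrite -(integral12_prod_meas1 fi'); congr fine.
apply: ae_eq_integral => //.
- exact: (measurable_fubini_F fi').
- apply/measurable_EFinP; apply: measurableT_comp; first exact: fine_measurable.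
  exact: (measurable_fubini_F fi').
- apply: filterS (ae_integrable1 fi') => a ia _ /=.
  by rewrite fineK//; apply: integrable_fin_num.
Qed.

Lemma cons_rV_affine n (c : R) (v : 'rV[R]_n.+1) (a : R) (w : 'rV[R]_n) :
  cons_rV (c * a + v ord0 ord0, c *: w + rsubmx (v : 'rV_(1 + n))) =
  c *: cons_rV (a, w) + v.
Proof.
rewrite [v in RHS]cons_rV_surj; apply/rowP => i; rewrite rV_affineE.
by case: (unliftP ord0 i) => [j|] ->; rewrite ?cons_rVS ?cons_rV0//= rV_affineE.
Qed.

Lemma meas_rV_affine d (T : measurableType d) n (c : R) (v : 'rV[R]_n) (f : 'rV[R]_n -> T) :
  measurable_fun setT f ->
  measurable_fun setT (fun x : 'rV[R]_n => f (c *: x + v)).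
Proof.
move=> mf; apply: (measurableT_comp mf).
apply: (measurable_fun_rVP (T := 'rV[R]_n)) => i.
under eq_fun do rewrite rV_affineE.
by mtac.
Qed.

Lemma ge0_integral_rV_affine n (c : R) (v : 'rV[R]_n) (f : 'rV[R]_n -> \bar R) :
  0 < c -> measurable_fun setT f -> (forall x, 0 <= f x)%E ->
  (\int[leb n]_x f x = (c ^+ n)%:E * \int[leb n]_x f (c *: x + v)%R)%E.
Proof.
move=> c0; elim: n v f => [|n IH] v f mf f0.
  by rewrite !integral_rV0 expr0 mul1e [(_ + _)%R]thinmx0.
have mg := meas_rV_affine c v mf.
have cn0 : (0 <= (c ^+ n)%:E)%E by rewrite lee_fin exprn_ge0// ltW.
pose h a := (\int[leb n]_x f (cons_rV (a, c *: x + rsubmx (v : 'rV_(1 + n)))%R))%E.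
have h0 a : (0 <= h a)%E by apply: integral_ge0 => x _.
have mh : measurable_fun setT h.
  pose g (x : 'rV[R]_n.+1) := f (cons_rV (x ord0 ord0,
    c *: rsubmx (x : 'rV_(1 + n)) + rsubmx (v : 'rV_(1 + n)))%R).
  have mgg : measurable_fun setT g.
    apply: (measurableT_comp mf).
    apply: (measurable_fun_rVP (T := 'rV[R]_n.+1)) => i.
    case: (unliftP ord0 i) => [j|] ->.
      under eq_fun do rewrite cons_rVS rV_affineE /= mxE.
      by mtac.
    under eq_fun do rewrite cons_rV0 /=.
    by mtac.
  have := ge0_measurable_rVS mgg (fun x => f0 _).
  apply: eq_measurable_fun => a _; apply: eq_integral => x _.
  by rewrite /g cons_rV0 /cons_rV row_mxKr.
rewrite !ge0_integral_rVS//.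
transitivity (\int[mu]_a ((c ^+ n)%:E * h a))%E.
  apply: eq_integral => a _; rewrite (IH (rsubmx (v : 'rV_(1 + n))))//.
  exact: (measurableT_comp (meas_cons_rV mf) (measurable_pair1 a)).
transitivity ((c ^+ n)%:E * \int[mu]_a h a)%E; first exact: ge0_integralZl.
rewrite (@ge0_integral_affine _ c (v ord0 ord0) h)//.
rewrite muleA -EFinM -exprSr; congr (_ * _)%E.
by apply: eq_integral => a _; apply: eq_integral => w _; rewrite cons_rV_affine.
Qed.

Lemma Rintegral_rV_affine n (c : R) (v : 'rV[R]_n) (f : 'rV[R]_n -> R) : 0 < c ->
  (leb n).-integrable setT (EFin \o f) ->
  (leb n).-integrable setT (EFin \o (fun x : 'rV[R]_n => f (c *: x + v))) /\
  \int[leb n]_x f x = c ^+ n * \int[leb n]_x f (c *: x + v).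
Proof.
move=> c0; apply: (@change_of_variables _ _ _ (leb n) (fun x : 'rV[R]_n => c *: x + v)).
- exact: exprn_gt0.
- by move=> g mg; exact: meas_rV_affine.
- by move=> g mg g0; apply: ge0_integral_rV_affine => //; exact/measurable_EFinP.
Qed.

(** A majorant in every L^p with p > 1, whatever the dimension. Its product form lets integrability,
    heat kernel bounds and decay in the first variable be treated one coordinate at a time. *)
Definition wgt n (x : 'rV[R]_n) : R := \prod_(i < n) (1 + `|x ord0 i|)^-1.

Lemma wgt_gt0 n (x : 'rV[R]_n) : 0 < wgt x.
Proof. by apply: prodr_gt0 => i _; rewrite invr_gt0 ltr_pwDl. Qed.

Lemma meas_wgt n : measurable_fun setT (@wgt n).
Proof. by rewrite /wgt; mtac. Qed.

Lemma wgt_cons n (a : R) (v : 'rV[R]_n) : wgt (cons_rV (a, v)) = (1 + `|a|)^-1 * wgt v.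
Proof.
rewrite /wgt big_ord_recl cons_rV0; congr (_ * _).
by apply: eq_bigr => i _; rewrite cons_rVS.
Qed.

Lemma integrable_wgt n (p : R) : 1 < p ->
  (leb n).-integrable setT (EFin \o (fun x => wgt x `^ p)).
Proof.
move=> p1; elim: n => [|n IH].
  apply: integrable_lt; first by apply: meas_powR; exact: meas_wgt.
    by move=> x; exact: powR_ge0.
  by rewrite integral_rV0 ltry.
have m1 := meas_powR p (@meas_wgt n.+1).
apply: integrable_lt => //; first by move=> x; exact: powR_ge0.
rewrite ge0_integral_rVS//; last 2 first.
- exact/measurable_EFinP.
- by move=> x; rewrite lee_fin powR_ge0.
rewrite (_ : (\int[mu]_a _ = \int[mu]_a
    ((1 + `|a|)^-1 `^ p * \int[leb n]_v (wgt v `^ p))%:E)%E); last first.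
  apply: eq_integral => a _; rewrite EFinM (ge0_integral_fin IH).
  rewrite -ge0_integralZl//; last 2 first.
  - by apply/measurable_EFinP; apply: meas_powR; exact: meas_wgt.
  - by move=> v _; rewrite lee_fin powR_ge0.
  apply: eq_integral => v _.
  by rewrite wgt_cons powRM ?EFinM ?invr_ge0 ?addr_ge0//; exact: ltW (wgt_gt0 _).
have ii : mu.-integrable setT (EFin \o (fun a : R =>
    (1 + `|a|)^-1 `^ p * \int[leb n]_v (wgt v `^ p))).
  rewrite [X in EFin \o X](_ : _ = (fun a : R =>
      \int[leb n]_v (wgt v `^ p) * (1 + `|a|)^-1 `^ p)).
    by apply: integrableZ; exact: integrable_inv1D.
  by apply/funext => a; rewrite mulrC.
by rewrite -ge0_integral_fin ?ltry.
Qed.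

Lemma integrable_wgt2 n : (leb n).-integrable setT (EFin \o (fun x => wgt x ^+ 2)).
Proof.
have := @integrable_wgt n 2 (ltr1n _ 2).
apply: eq_integrable => // x _ /=.
by rewrite -powR_mulrn// ltW// wgt_gt0.
Qed.

End rV_integral.

(** * Polynomials against exponentials and Gaussians *)

Section bounds.
Context (R : realType).
Local Notation mu := (@lebesgue_measure R).

Lemma polynomial_exp_bound K (c : R) : 0 < c ->
  exists2 C, 0 < C & forall u, 0 <= u -> (1 + u) ^+ K * expR (- (c * u)) <= C.
Proof.
(* From 1 + u <= (1 + 1/d) e^(d u), the K-th power costs e^(K d u) and leaves e^(- d u) <= 1.
   Dividing by [K.+1] also covers K = 0. *)
move=> c0; pose d := c / K.+1%:R; have d0 : 0 < d by rewrite divr_gt0.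
exists ((1 + d^-1) ^+ K); first by rewrite exprn_gt0// addr_gt0 ?invr_gt0.
move=> u u0.
have H : 1 + u <= (1 + d^-1) * expR (d * u).
  apply: (@le_trans _ _ ((1 + d^-1) * (1 + d * u))); last first.
    by rewrite ler_pM2l ?expR_ge1Dx// addr_gt0 ?invr_gt0.
  have -> : (1 + d^-1) * (1 + d * u) = 1 + u + (d^-1 + d * u).
    by field; rewrite gt_eqF.
  by rewrite lerDl addr_ge0 ?invr_ge0 ?mulr_ge0// ltW.
have H2 : (1 + u) ^+ K <= (1 + d^-1) ^+ K * expR (K%:R * (d * u)).
  by rewrite expRM_natl -exprMn lerXn2r// nnegrE ?addr_ge0// mulr_ge0 ?expR_ge0// addr_ge0 ?invr_ge0// ltW.
apply: le_trans (ler_wpM2r (expR_ge0 _) H2) _.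
rewrite -mulrA -expRD ler_piMr ?exprn_ge0 ?addr_ge0 ?invr_ge0 ?(ltW d0)//.
rewrite expR_le1 (_ : _ + _ = - (d * u)); last first.
  by rewrite /d -natr1; field; rewrite natr1.
by rewrite oppr_le0 mulr_ge0// ltW.
Qed.

Lemma horner_bound (p : {poly R}) :
  exists2 C, 0 < C & forall u, 0 <= u -> `|p.[u]| <= C * (1 + u) ^+ size p.
Proof.
exists (1 + \sum_(i < size p) `|p`_i|); first by rewrite ltr_pwDl// sumr_ge0.
move=> u u0; rewrite horner_coef.
apply: le_trans (ler_norm_sum _ _ _) _.
apply: (@le_trans _ _ ((\sum_(i < size p) `|p`_i|) * (1 + u) ^+ size p)).
  rewrite mulr_suml; apply: ler_sum => i _; rewrite normrM; apply: ler_wpM2l => //.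
  rewrite normrX ger0_norm//; apply: (@le_trans _ _ ((1 + u) ^+ i)).
    by rewrite lerXn2r ?nnegrE ?addr_ge0// lerDr.
  by apply: ler_weXn2l; [rewrite lerDl|exact: ltnW].
by apply: ler_wpM2r; rewrite ?exprn_ge0 ?addr_ge0// lerDr.
Qed.

Lemma inv1D_sqr (x : R) : 1 <= (2 * (1 + x ^+ 2)) * (1 + `|x|)^-1 ^+ 2.
Proof.
have x1 : 0 < 1 + `|x| by rewrite ltr_pwDl.
rewrite exprVn ler_pdivlMr ?exprn_gt0// mul1r -(real_normK (num_real x)).
set y := `|x|; have : 0 <= (y - 1) ^+ 2 by exact: sqr_ge0.
by nra.
Qed.

Definition nsq n (x : 'rV[R]_n) : R := \sum_(i < n) x ord0 i ^+ 2.

Lemma nsq_ge0 n (x : 'rV[R]_n) : 0 <= nsq x.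
Proof. by apply: sumr_ge0 => i _; exact: sqr_ge0. Qed.

Lemma meas_nsq n : measurable_fun setT (@nsq n).
Proof. by rewrite /nsq; mtac. Qed.

Lemma nsq_cons n (a : R) (v : 'rV[R]_n) : nsq (cons_rV (a, v)) = a ^+ 2 + nsq v.
Proof.
rewrite /nsq big_ord_recl cons_rV0; congr (_ + _).
by apply: eq_bigr => i _; rewrite cons_rVS.
Qed.

Lemma dotp_cons n (a b : R) (v w : 'rV[R]_n) :
  dotp (cons_rV (a, v)) (cons_rV (b, w)) = a * b + dotp v w.
Proof.
rewrite /dotp big_ord_recl !cons_rV0; congr (_ + _).
by apply: eq_bigr => i _; rewrite !cons_rVS.
Qed.

Lemma nsq_coord n (x : 'rV[R]_n) i : x ord0 i ^+ 2 <= nsq x.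
Proof.
by rewrite /nsq (bigD1 i)//= lerDl sumr_ge0// => j _; exact: sqr_ge0.
Qed.

(** Stated as a factor at least 1 by which a Gaussian bound can be multiplied: the Gaussian then
    absorbs the polynomial and the squared weight remains. *)
Lemma wgt_sqr n (x : 'rV[R]_n) : 1 <= (2 * (1 + nsq x)) ^+ n * wgt x ^+ 2.
Proof.
rewrite /wgt -prodrXl -[X in _ ^+ X]card_ord -prodr_const -big_split/=.
apply: (@le_trans _ _ (\prod_(i < n) (1 : R))); first by rewrite big1_eq.
apply: ler_prod => i _; rewrite ler01/=.
apply: le_trans (inv1D_sqr (x ord0 i)) _.
apply: ler_wpM2r; first by rewrite exprn_ge0// invr_ge0 addr_ge0.
by rewrite ler_pM2l// lerD2l nsq_coord.
Qed.

Lemma wgt_le1 n (x : 'rV[R]_n) : wgt x <= 1.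
Proof.
apply: (@le_trans _ _ (\prod_(i < n) (1 : R))); last by rewrite big1_eq.
apply: ler_prod => i _; rewrite invr_ge0 addr_ge0//= invf_le1 ?lerDl//.
Qed.

Lemma wgt2_le n (x : 'rV[R]_n) : wgt x ^+ 2 <= wgt x.
Proof. by rewrite expr2 ler_piMr ?wgt_le1// ltW// wgt_gt0. Qed.

Lemma exp_wgt_bound n K (c : R) : 0 < c -> exists2 C, 0 < C &
  forall x : 'rV[R]_n, (1 + nsq x) ^+ K * expR (- (c * nsq x)) <= C * wgt x ^+ 2.
Proof.
move=> c0; have [C C0 H] := polynomial_exp_bound (K + n) c0.
exists (2 ^+ n * C); first by rewrite mulr_gt0// exprn_gt0.
move=> x; have x2 := nsq_ge0 x.
have P : 0 <= (1 + nsq x) ^+ K * expR (- (c * nsq x)).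
  by rewrite mulr_ge0 ?expR_ge0 ?exprn_ge0 ?addr_ge0.
apply: le_trans (_ : (1 + nsq x) ^+ K * expR (- (c * nsq x)) *
  ((2 * (1 + nsq x)) ^+ n * wgt x ^+ 2) <= _).
  by rewrite ler_peMr// wgt_sqr.
rewrite exprMn (_ : _ * _ = 2 ^+ n * ((1 + nsq x) ^+ (K + n) *
  expR (- (c * nsq x))) * wgt x ^+ 2); last by rewrite exprD; ring.
apply: ler_wpM2r; first by rewrite exprn_ge0// ltW// wgt_gt0.
by apply: ler_wpM2l; rewrite ?exprn_ge0// H.
Qed.

Lemma exp_inv1D_bound K (c : R) : 0 < c -> exists2 C, 0 < C &
  forall x, (1 + x ^+ 2) ^+ K * expR (- (c * x ^+ 2)) <= C * (1 + `|x|)^-1 ^+ 2.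
Proof.
move=> c0; have [C C0 H] := @exp_wgt_bound 1 K c c0; exists C => // x.
by have := H (const_mx x); rewrite /nsq /wgt !big_ord1 !mxE.
Qed.

Lemma integrable_exp_bound n (f : 'rV[R]_n -> R) K (c C : R) :
  0 < c -> measurable_fun setT f ->
  (forall x, `|f x| <= C * ((1 + nsq x) ^+ K * expR (- (c * nsq x)))) ->
  (lebesgue_rV R n).-integrable setT (EFin \o f).
Proof.
move=> c0 mf fC; have [D D0 H] := @exp_wgt_bound n K c c0.
have C0 : 0 <= `|C| by [].
apply: (integrable_le mf (g := fun x => `|C| * (D * wgt x ^+ 2))) => [x|]; last first.
  by do 2 apply: integrableZ; exact: integrable_wgt2.
apply: le_trans (fC x) _; apply: (@le_trans _ _ (`|C| *
    ((1 + nsq x) ^+ K * expR (- (c * nsq x))))).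
  apply: ler_wpM2r; last exact: ler_norm.
  by rewrite mulr_ge0 ?expR_ge0 ?exprn_ge0 ?addr_ge0 ?nsq_ge0.
by apply: ler_wpM2l.
Qed.

Lemma integrable_inv1D_le (f : R -> R) (C : R) : measurable_fun setT f ->
  (forall x, `|f x| <= C * (1 + `|x|)^-1 ^+ 2) ->
  mu.-integrable setT (EFin \o f).
Proof.
move=> mf fC.
apply: (@integrable_le _ _ _ mu f (fun x => C * (1 + `|x|)^-1 ^+ 2)) => //.
by apply: integrableZ; exact: integrable_inv1D2.
Qed.

Lemma cvg_inv1D_le (G : R -> R) (C : R) (u : nat -> R) :
  (forall x, `|G x| <= C * (1 + `|x|)^-1 ^+ 2) -> (forall k, `|u k| = k%:R) ->
  G (u k) @[k --> \oo] --> (0 : R).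
Proof.
move=> GC uk; apply: norm_cvg0.
have H : `|C| * harmonic k @[k --> \oo] --> (0 : R).
  by rewrite -(mulr0 `|C|); apply: cvgMr; exact: cvg_harmonic.
apply: squeeze_cvgr (cvg_cst 0) H.
apply: nearW => k; rewrite normr_ge0/=; apply: le_trans (GC _) _.
rewrite uk /harmonic /= -natr1 addrC.
apply: le_trans (_ : `|C| * (k%:R + 1)^-1 ^+ 2 <= _).
  by apply: ler_wpM2r (ler_norm _); rewrite exprn_ge0// invr_ge0 addr_ge0.
apply: ler_wpM2l => //; rewrite expr2 ler_piMr ?invr_ge0 ?addr_ge0//.
by rewrite invf_le1 ?lerDr// ltr_wpDl.
Qed.

Lemma Rintegral_derive0_bound (G g : R -> R) (C : R) :
  (forall x : R, hasder G x (g x)) -> continuous g ->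
  (forall x, `|G x| <= C * (1 + `|x|)^-1 ^+ 2) ->
  (forall x, `|g x| <= C * (1 + `|x|)^-1 ^+ 2) ->
  \int[mu]_x g x = 0.
Proof.
move=> dG cg GC gC; apply: (Rintegral_derive0 dG cg).
- by apply: integrable_inv1D_le gC; exact: continuous_measurable_fun.
- by apply: (cvg_inv1D_le GC) => k; rewrite normr_nat.
- by apply: (cvg_inv1D_le GC) => k; rewrite normrN normr_nat.
Qed.

End bounds.

(** * Fourier transforms of Gaussians *)

Section gauss1.
Context (R : realType).
Local Notation mu := (@lebesgue_measure R).

(** The phase [th] treats cosine ([th = 0]) and sine ([th = - pi / 2]) at once, and in higher
    dimension it receives the contribution of the other coordinates. *)
Let g (t x th y : R) := expR (- (pi * t * y ^+ 2)) * cos (2 * pi * x * y + th).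

Let g' (t x th y : R) :=
  expR (- (pi * t * y ^+ 2)) * (- sin (2 * pi * x * y + th) * (2 * pi * y)).

Let F t th x := \int[mu]_y g t x th y.

Let pit (t : R) : 0 < t -> 0 < pi * t.
Proof. by move=> t0; rewrite mulr_gt0 ?pi_gt0. Qed.

Let expb (t : R) : 0 < t -> exists2 C, 0 < C &
  forall y, (1 + y ^+ 2) * expR (- (pi * t * y ^+ 2)) <= C * (1 + `|y|)^-1 ^+ 2.
Proof.
move=> t0; have [C C0 H] := exp_inv1D_bound 1 (pit t0).
by exists C => // y; have := H y; rewrite expr1.
Qed.

Let expb0 (t C : R) : (forall y : R, (1 + y ^+ 2) * expR (- (pi * t * y ^+ 2)) <= C * (1 + `|y|)^-1 ^+ 2) ->
  forall y z : R, `|z| <= 1 + y ^+ 2 -> `|expR (- (pi * t * y ^+ 2)) * z| <= C * (1 + `|y|)^-1 ^+ 2.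
Proof.
move=> H y z zy; apply: le_trans (H y).
rewrite normrM ger0_norm ?expR_ge0// mulrC; exact: ler_wpM2r.
Qed.

Let intg (t x th : R) : 0 < t -> mu.-integrable setT (EFin \o g t x th).
Proof.
move=> t0; have [C C0 H] := expb t0.
apply: (@integrable_inv1D_le _ _ C); first by rewrite /g; mtac.
move=> y; apply: (expb0 H); rewrite (le_trans (cos_max _))// lerDl.
exact: sqr_ge0.
Qed.

Let leM2 (y : R) : `|y| <= 1 + y ^+ 2.
Proof.
rewrite -(real_normK (num_real y)); set z := `|y|.
by have := sqr_ge0 (z - 1); have := normr_ge0 y; rewrite -/z; nra.
Qed.

Let dF (t th x : R) : 0 < t -> hasder (F t th) x (\int[mu]_y g' t x th y).
Proof.
move=> t0; have [C C0 H] := expb t0.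
have dg (x' y : R) : hasder (fun x' => g t x' th y) x' (g' t x' th y).
  apply: derE.
    by rewrite /g; dtac.
  by rewrite /g' /= !(mul0r, mulr0, mulr1, addr0, add0r).
have xI : `]x - 1, x + 1[%classic x.
  by rewrite /= in_itv/= ltrDl ltr01 gtrDl oppr_lt0 ltr01.
have i1 : forall x', `]x - 1, x + 1[%classic x' -> mu.-integrable setT (EFin \o (fun y => g t x' th y)).
  by move=> x' _; exact: intg.
have d1 (x' y : R) : `]x - 1, x + 1[%classic x' -> setT y -> derivable (fun x' => g t x' th y) x' 1.
  by move=> _ _; exact: der_derivable (dg _ _).
pose B (y : R) := 2 * pi * C * (1 + `|y|)^-1 ^+ 2.
have B0 y : 0 <= B y.
  by rewrite mulr_ge0 ?exprn_ge0 ?mulr_ge0 ?pi_ge0// ?(ltW C0)// invr_ge0 addr_ge0.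
have iB : mu.-integrable setT (EFin \o B).
  by apply: integrableZ; exact: integrable_inv1D2.
have bd (x' y : R) : `]x - 1, x + 1[%classic x' -> setT y ->
    `|partial1of2 (fun x' => g t x' th) x' y| <= B y.
  move=> _ _; rewrite /partial1of2 (der_derive1 (dg _ _)) /g'.
  rewrite (_ : _ * _ = 2 * pi * (expR (- (pi * t * y ^+ 2)) * (- sin (2 * pi * x' * y + th) * y))); last by ring.
  rewrite normrM [X in X * _]ger0_norm ?mulr_ge0 ?pi_ge0//.
  rewrite (_ : B y = 2 * pi * (C * (1 + `|y|)^-1 ^+ 2)); last by rewrite /B; ring.
  apply: ler_wpM2l; first by rewrite mulr_ge0 ?pi_ge0.
  apply: (expb0 H); rewrite normrM normrN (le_trans _ (leM2 y))// ler_piMl// sin_max.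
  by [].
have D := derivable_under_integral measurableT xI i1 d1 B0 iB bd.
have E := differentiation_under_integral measurableT xI i1 d1 B0 iB bd.
rewrite /hasder; apply: DeriveDef => //; rewrite -derive1E /F E.
by apply: eq_Rintegral => y _; rewrite /partial1of2 (der_derive1 (dg _ _)).
Qed.

(** The function [P] vanishes at infinity, so its derivative has integral 0. Together with [dF] this
    is the differential equation F' = - (2 pi x / t) F. *)
Let parts (t x th : R) : 0 < t ->
  \int[mu]_y g' t x th y = - (2 * pi * x / t) * F t th x.
Proof.
move=> t0; have [C C0 H] := expb t0.
pose P (y : R) := expR (- (pi * t * y ^+ 2)) * sin (2 * pi * x * y + th).
pose p (y : R) := t * g' t x th y + 2 * pi * x * g t x th y.
have dP (y : R) : hasder P y (p y).
  apply: derE; first by rewrite /P; dtac.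
  rewrite /p /g /g' /= !(mul0r, mulr0, mulr1, addr0, add0r).
  by rewrite expr1; ring.
have gb (y : R) : `|g t x th y| <= C * (1 + `|y|)^-1 ^+ 2.
  apply: (expb0 H); rewrite (le_trans (cos_max _))// lerDl.
  exact: sqr_ge0.
have g'b (y : R) : `|g' t x th y| <= 2 * pi * (C * (1 + `|y|)^-1 ^+ 2).
  rewrite /g' (_ : _ * _ = 2 * pi * (expR (- (pi * t * y ^+ 2)) * (- sin (2 * pi * x * y + th) * y))); last by ring.
  rewrite normrM ger0_norm ?mulr_ge0 ?pi_ge0//.
  apply: ler_wpM2l; first by rewrite mulr_ge0 ?pi_ge0.
  by apply: (expb0 H); rewrite normrM normrN (le_trans _ (leM2 y))// ler_piMl// sin_max.
have ig' : mu.-integrable setT (EFin \o g' t x th).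
  apply: (@integrable_inv1D_le _ _ (2 * pi * C)); first by rewrite /g'; mtac.
  by move=> y; rewrite -mulrA.
have : \int[mu]_y p y = 0.
  apply: (@Rintegral_derive0_bound R P p (C + t * (2 * pi * C) + `|2 * pi * x| * C)) => //.
  - by move=> y; rewrite /p /g /g'; apply: der_continuous; dtac.
  - move=> y; apply: (@le_trans _ _ (C * (1 + `|y|)^-1 ^+ 2)).
      by apply: (expb0 H); rewrite (le_trans (sin_max _))// lerDl sqr_ge0.
    apply: ler_wpM2r; first by rewrite exprn_ge0// invr_ge0 addr_ge0.
    by rewrite -addrA lerDl addr_ge0 ?mulr_ge0 ?pi_ge0// ltW.
  - move=> y; apply: le_trans (ler_normD _ _) _; rewrite (normrM t) (gtr0_norm t0) (normrM (2 * pi * x)).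
    have := ler_wpM2l (ltW t0) (g'b y).
    have := ler_wpM2l (normr_ge0 (2 * pi * x)) (gb y).
    have : 0 <= C * (1 + `|y|)^-1 ^+ 2.
      by rewrite mulr_ge0 ?exprn_ge0 ?invr_ge0 ?addr_ge0// ltW.
    set W := _ ^+ 2; set q := `|2 * pi * x|; set a := `|g t x th y|; set b := `|g' t x th y|.
    by move=> h1 h2 h3; rewrite !mulrDl -!(mulrA _ C W); lra.
rewrite /p RintegralD//; last 2 first.
- exact: integrableZ.
- by apply: integrableZ; exact: intg.
rewrite !RintegralZl//; last exact: intg.
move/eqP; rewrite addr_eq0 => /eqP E.
apply: (mulfI (lt0r_neq0 t0)); rewrite E /F; field.
by rewrite gt_eqF.
Qed.

Lemma gauss_cos1 (t x th : R) : 0 < t ->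
  \int[mu]_y (expR (- (pi * t * y ^+ 2)) * cos (2 * pi * x * y + th)) =
  expR (- (2^-1 * ln t)) * expR (- (pi * x ^+ 2 / t)) * cos th.
Proof.
move=> t0.
(* The differential equation makes F e^(pi x^2 / t) constant; its value at 0 is the Gaussian
   integral times cos th. *)
have H (x' : R) : hasder (fun x => F t th x * expR (pi * x ^+ 2 / t)) x' 0.
  apply: derE.
    apply: derM; first exact: dF.
    by dtac.
  rewrite parts//= !(mul0r, mulr0, mulr1, addr0, add0r) expr1; field.
  by rewrite gt_eqF.
have /= := @is_derive_0_is_cst R _ x 0 H.
rewrite expr0n/= mulr0 mul0r expR0 mulr1 => E.
have -> : \int[mu]_y (expR (- (pi * t * y ^+ 2)) * cos (2 * pi * x * y + th)) = F t th x by [].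
rewrite -[F t th x](mulfK (lt0r_neq0 (expR_gt0 (pi * x ^+ 2 / t)))) E -expRN.
rewrite [RHS]mulrAC; congr (_ * _).
rewrite /F /g.
under eq_Rintegral do rewrite mulr0 mul0r add0r.
have ie : mu.-integrable setT (EFin \o (fun y => expR (- (pi * t * y ^+ 2)))).
  have := intg 0 0 t0; apply: eq_integrable => // y _ /=.
  by rewrite /g mulr0 mul0r add0r cos0 mulr1.
rewrite RintegralZr//; congr (_ * _).
have [s s0 sE] : exists2 s, 0 < s & s ^+ 2 = pi * t.
  by exists (Num.sqrt (pi * t)); rewrite ?sqrtr_gt0 ?pit// sqr_sqrtr// ltW// pit.
have : Num.sqrt pi = s * \int[mu]_y expR (- (pi * t * y ^+ 2)).
  have := @integralT_gauss R.
  rewrite (@ge0_integral_affine _ s 0)//; last 2 first.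
  - by apply/measurable_EFinP; exact: measurable_gauss_fun.
  - by move=> y; rewrite lee_fin gauss_fun_ge0.
  rewrite (_ : (fun _ => _) = (fun y => (expR (- (pi * t * y ^+ 2)))%:E)); last first.
    by apply/funext => y; rewrite addr0 /gauss_fun exprMn sE.
  by rewrite -ge0_integral_fin// -EFinM => -[].
have -> : expR (- (2^-1 * ln t)) = Num.sqrt pi / s.
  have -> : s = Num.sqrt pi * Num.sqrt t.
    by rewrite -sqrtrM ?pi_ge0// -sE sqrtr_sqr ger0_norm// ltW.
  have -> : Num.sqrt t = expR (2^-1 * ln t).
    by rewrite -powR12_sqrt ?(ltW t0)// /powR gt_eqF.
  rewrite expRN.
  by field; rewrite !gt_eqF ?expR_gt0 ?sqrtr_gt0 ?pi_gt0.
by move=> ->; field; rewrite gt_eqF.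
Qed.

End gauss1.

(* The heat kernels: the Fourier transforms of [(pi |xi|^2)^i e^(- pi t |xi|^2)]
   are [t^(- n / 2 - i) P_i(rho / t) e^(- rho / t)], [rho := pi |x|^2]. *)
Section gauss_rV.
Context (R : realType).
Local Notation mu := (@lebesgue_measure R).
Local Notation leb n := (lebesgue_rV R n).

(** This is t^(- n / 2), written so that it is differentiated by the rules for [expR] and [ln] and
    is visibly multiplicative in the dimension. *)
Definition heat n (t : R) : R := expR (- (n%:R / 2 * ln t)).

Lemma heat_gt0 n t : 0 < heat n t. Proof. exact: expR_gt0. Qed.

Lemma integrable_gauss_cos n (t : R) (q : 'rV[R]_n -> R) K (C : R) : 0 < t ->
  measurable_fun setT q -> (forall x, `|q x| <= C * (1 + nsq x) ^+ K) ->
  (leb n).-integrable setT (EFin \o (fun xi => expR (- (pi * t * nsq xi)) * q xi)).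
Proof.
move=> t0 mq qC; apply: (@integrable_exp_bound R n _ K (pi * t) C).
- by rewrite mulr_gt0 ?pi_gt0.
- by apply: measM => //; apply: meas_exp; apply: measN; apply: measM;
    [exact: measurable_cst|exact: meas_nsq].
- move=> x; rewrite normrM ger0_norm ?expR_ge0// mulrC mulrA.
  by apply: ler_wpM2r => //; exact: expR_ge0.
Qed.

Lemma meas_dotp n (x : 'rV[R]_n) : measurable_fun setT (fun xi => dotp x xi).
Proof. by rewrite /dotp; mtac. Qed.

Lemma gauss_cos n (t th : R) (x : 'rV[R]_n) : 0 < t ->
  \int[leb n]_xi (expR (- (pi * t * nsq xi)) * cos (2 * pi * dotp x xi + th)) =
  heat n t * expR (- (pi * nsq x / t)) * cos th.
Proof.
move=> t0; elim: n x th => [|n IH] x th.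
  rewrite /Rintegral integral_rV0 /= /heat /nsq /dotp !big_ord0 !(mulr0, mul0r) oppr0.
  by rewrite expR0 add0r !mul1r.
rewrite Rintegral_rVS; last first.
  apply: (@integrable_gauss_cos _ _ _ 0 1) => //.
    apply: meas_cos; apply: measD; last exact: measurable_cst.
    by apply: measM; [exact: measurable_cst|exact: meas_dotp].
  by move=> y; rewrite expr0 mulr1 cos_max.
rewrite [x]cons_rV_surj; set a := x ord0 ord0; set v := rsubmx _.
transitivity (\int[mu]_b (heat n t * expR (- (pi * nsq v / t)) *
    (expR (- (pi * t * b ^+ 2)) * cos (2 * pi * a * b + th)))).
  apply: eq_Rintegral => b _.
  (* The first coordinate enters the inner integral only through the phase, for which the induction
     hypothesis is general. *)
  rewrite mulrCA -(IH v (2 * pi * a * b + th)) -RintegralZl//.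
    apply: eq_Rintegral => w _.
    rewrite nsq_cons dotp_cons mulrDr opprD expRD -mulrA; congr (_ * (_ * cos _)).
    by ring.
  apply: (@integrable_gauss_cos _ _ _ 0 1) => //.
    apply: meas_cos; apply: measD; last exact: measurable_cst.
    by apply: measM; [exact: measurable_cst|exact: meas_dotp].
  by move=> y; rewrite expr0 mulr1 cos_max.
rewrite RintegralZl//; last first.
  have [C C0 H] := @exp_inv1D_bound R 0 (pi * t) (mulr_gt0 (pi_gt0 R) t0).
  apply: (@integrable_inv1D_le R _ C); first by mtac.
  move=> y; rewrite normrM ger0_norm ?expR_ge0//.
  by apply: le_trans (H y); rewrite expr0 mul1r ler_piMr ?expR_ge0// cos_max.
rewrite gauss_cos1// nsq_cons.
have -> : heat n.+1 t = heat n t * expR (- (2^-1 * ln t)).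
  by rewrite /heat -natr1 -expRD; congr expR; field.
have -> : expR (- (pi * (a ^+ 2 + nsq v) / t)) =
    expR (- (pi * nsq v / t)) * expR (- (pi * a ^+ 2 / t)).
  by rewrite -expRD; congr expR; field; rewrite gt_eqF.
by ring.
Qed.

(** The recursion is the effect of - d/dt on t^(- n / 2 - i) P(rho / t) e^(- rho / t). The solution
    is i! times the Laguerre polynomial of degree i and parameter n / 2 - 1. *)
Fixpoint heat_poly n i : {poly R} := match i with
  | 0 => 1
  | j.+1 => let P := heat_poly n j in (n%:R / 2 + j%:R) *: P + 'X * P^`() - 'X * P
  end.

Definition heat_term n i (t rho : R) : R :=
  heat n t * expR (- (i%:R * ln t)) * (heat_poly n i).[rho / t] * expR (- (rho / t)).

Lemma heat_term_derive n i (t rho : R) : 0 < t ->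
  hasder (fun t => heat_term n i t rho) t (- heat_term n i.+1 t rho).
Proof.
move=> t0; have tn0 : t != 0 by rewrite gt_eqF.
have dV : hasder (fun t => rho / t) t (- rho / t ^+ 2).
  apply: derE.
    apply: derM; first exact: derC.
    by apply: (is_deriveV tn0); exact: derid.
  by rewrite /GRing.scale /=; field.
apply: derE.
  rewrite /heat_term; apply: derM; last by dtac.
  apply: derM; last first.
    by apply: (@der_comp R (fun z => (heat_poly n i).[z])) dV; exact: is_derive_poly.
  apply: derM.
    by rewrite /heat; apply: der_exp; apply: derN; apply: derM;
      [exact: derC|apply: (der_ln t0); exact: derid].
  by apply: der_exp; apply: derN; apply: derM;
    [exact: derC|apply: (der_ln t0); exact: derid].
have Et : expR (- ln t) = t^-1 by rewrite expRN lnK ?posrE.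
have -> : heat_term n i.+1 t rho = heat n t * (expR (- (i%:R * ln t)) / t) *
    ((n%:R / 2 + i%:R) * (heat_poly n i).[rho / t] +
     rho / t * (heat_poly n i)^`().[rho / t] - rho / t * (heat_poly n i).[rho / t]) *
    expR (- (rho / t)).
  rewrite /heat_term /= !hornerE -natr1 mulrDl mul1r opprD expRD.
  by congr (_ * _ * _); rewrite Et mulrA.
rewrite /heat_term /heat /=; set A := expR _; set B := expR _; set D := expR _.
by field.
Qed.

Lemma gauss_cos_heat n i (t th : R) (x : 'rV[R]_n) : 0 < t ->
  \int[leb n]_xi (expR (- (pi * t * nsq xi)) *
    ((pi * nsq xi) ^+ i * cos (2 * pi * dotp x xi + th))) =
  heat_term n i t (pi * nsq x) * cos th.
Proof.
elim: i t => [|i IH] t t0.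
  rewrite /heat_term /= hornerC mul0r oppr0 expR0 !mulr1 -gauss_cos//.
  by apply: eq_Rintegral => xi _; rewrite expr0 mul1r.
pose g t xi := expR (- (pi * t * nsq xi)) *
    ((pi * nsq xi) ^+ i * cos (2 * pi * dotp x xi + th)).
have mc : measurable_fun setT (fun xi => cos (2 * pi * dotp x xi + th)).
  apply: meas_cos; apply: measD; last exact: measurable_cst.
  by apply: measM; [exact: measurable_cst|exact: meas_dotp].
have mi k : measurable_fun setT (fun xi => (pi * nsq xi) ^+ k * cos (2 * pi * dotp x xi + th)).
  apply: measM => //; apply: measX; apply: measM; [exact: measurable_cst|exact: meas_nsq].
have bi k xi : `|(pi * nsq xi) ^+ k * cos (2 * pi * dotp x xi + th)| <=
    pi ^+ k * (1 + nsq xi) ^+ k.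
  rewrite normrM -exprMn ger0_norm ?exprn_ge0 ?mulr_ge0 ?pi_ge0 ?nsq_ge0//.
  apply: (@le_trans _ _ ((pi * nsq xi) ^+ k)).
    by rewrite ler_piMr ?cos_max// exprn_ge0// mulr_ge0 ?pi_ge0 ?nsq_ge0.
  by rewrite lerXn2r ?nnegrE ?mulr_ge0 ?pi_ge0 ?nsq_ge0 ?addr_ge0 ?nsq_ge0// ler_wpM2l ?pi_ge0// lerDr.
have ig t' : 0 < t' -> (leb n).-integrable setT (EFin \o g t').
  by move=> t'0; exact: (integrable_gauss_cos t'0 (mi i) (bi i)).
have dg t' xi : hasder (fun t => g t xi) t'
    (- (expR (- (pi * t' * nsq xi)) * ((pi * nsq xi) ^+ i.+1 * cos (2 * pi * dotp x xi + th)))).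
  apply: derE; first by rewrite /g; dtac.
  by rewrite /= exprS; ring.
(* On this neighbourhood t' stays above t / 2, so the Gaussian of parameter t / 2 dominates all the
   t-derivatives. *)
have tI : `]t / 2, t * 2[%classic t.
  by rewrite /= in_itv/= ltr_pdivrMr// ltr_pMr// ltr1n.
have tI0 t' : `]t / 2, t * 2[%classic t' -> t / 2 < t'.
  by rewrite /= in_itv/= => /andP[].
have t20 : 0 < t / 2 by rewrite divr_gt0.
have i1 t' : `]t / 2, t * 2[%classic t' -> (leb n).-integrable setT (EFin \o g t').
  by move=> /tI0 H; apply: ig; exact: lt_trans H.
have d1 t' xi : `]t / 2, t * 2[%classic t' -> setT xi -> derivable (fun t => g t xi) t' 1.
  by move=> _ _; exact: der_derivable (dg _ _).
pose B (xi : 'rV[R]_n) := expR (- (pi * (t / 2) * nsq xi)) * (pi ^+ i.+1 * (1 + nsq xi) ^+ i.+1).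
have B0 xi : 0 <= B xi.
  by rewrite !mulr_ge0 ?expR_ge0 ?exprn_ge0 ?pi_ge0 ?addr_ge0 ?nsq_ge0.
have iB : (leb n).-integrable setT (EFin \o B).
  apply: (@integrable_gauss_cos _ _ _ i.+1 (pi ^+ i.+1)) => //.
    by apply: measM; [exact: measurable_cst|apply: measX; apply: measD;
      [exact: measurable_cst|exact: meas_nsq]].
  by move=> y; rewrite ger0_norm// mulr_ge0 ?exprn_ge0 ?pi_ge0 ?addr_ge0 ?nsq_ge0.
have bd t' xi : `]t / 2, t * 2[%classic t' -> setT xi ->
    `|partial1of2 g t' xi| <= B xi.
  move=> /tI0 H _; rewrite /partial1of2 (der_derive1 (dg _ _)) normrN normrM.
  rewrite [`|expR _|]ger0_norm ?expR_ge0//; apply: ler_pM; [exact: expR_ge0|exact: normr_ge0| |exact: bi].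
  rewrite ler_expR lerN2 ler_wpM2r ?nsq_ge0// ler_wpM2l ?pi_ge0//.
  exact: ltW.
have D := derivable_under_integral measurableT tI i1 d1 B0 iB bd.
have E := differentiation_under_integral measurableT tI i1 d1 B0 iB bd.
(* The induction hypothesis holds for all positive t', hence near t, so both sides have the same
   derivative. *)
have : derive1 (fun t => \int[leb n]_xi g t xi) t = derive1 (fun t => heat_term n i t (pi * nsq x) * cos th) t.
  rewrite !derive1E; apply: near_eq_derive.
  near=> t'; rewrite -IH//.
  by near: t'; exact: lt_nbhsr.
rewrite E => H.
have -> : \int[leb n]_xi (expR (- (pi * t * nsq xi)) *
    ((pi * nsq xi) ^+ i.+1 * cos (2 * pi * dotp x xi + th))) =
    - \int[leb n]_y partial1of2 g t y.
  rewrite -[RHS]mulN1r -RintegralZl//.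
    by apply: eq_Rintegral => xi _; rewrite /partial1of2 (der_derive1 (dg _ _)) mulN1r opprK.
  apply: integrable_le iB; last by move=> xi; exact: bd.
  rewrite (_ : partial1of2 g t = (fun xi => - (expR (- (pi * t * nsq xi)) *
    ((pi * nsq xi) ^+ i.+1 * cos (2 * pi * dotp x xi + th))))).
    apply: measN; apply: measM => //; apply: meas_exp; apply: measN; apply: measM.
      exact: measurable_cst.
    exact: meas_nsq.
  by apply/funext => xi; rewrite /partial1of2 (der_derive1 (dg _ _)).
rewrite H (der_derive1 (derM (heat_term_derive n i (pi * nsq x) t0) (derC _ _))).
by rewrite mulr0 addr0 mulNr opprK.
Unshelve. all: by end_near. Qed.

End gauss_rV.

(* Euler's Gamma function, after the substitution [t = e^y]. *)
(** * Subordination to the heat kernel *)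

Section gamma.
Context (R : realType).
Local Notation mu := (@lebesgue_measure R).

(** The left side decays like e^(b y) at minus infinity and like e^(- (N - b) y) at plus infinity;
    [d] is the smaller of the two rates. *)
Lemma exp_frac_bound (b : R) N : 0 < b -> b < N%:R -> exists2 C, 0 < C &
  forall y, expR (b * y) * (1 + expR y)^-1 ^+ N <= C * (1 + `|y|)^-1 ^+ 2.
Proof.
move=> b0 bN; pose d := Num.min b (N%:R - b).
have d0 : 0 < d by rewrite lt_min b0 subr_gt0.
have [C C0 H] := polynomial_exp_bound 2 d0; exists C => // y.
rewrite [X in _ <= _ * X]exprVn ler_pdivlMr ?exprn_gt0 ?ltr_pwDl// mulrC.
apply: le_trans (H _ (normr_ge0 y)).
apply: ler_wpM2l; first by rewrite exprn_ge0// addr_ge0.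
have e1 : 0 < 1 + expR y by rewrite ltr_pwDl// expR_ge0.
rewrite exprVn ler_pdivrMr ?exprn_gt0//.
have [y0|/ltW y0] := leP 0 y.
  rewrite (ger0_norm y0).
  apply: (@le_trans _ _ (expR (- (d * y)) * expR (N%:R * y))).
    rewrite -expRD ler_expR -mulNr -mulrDl; apply: ler_wpM2r => //.
    by rewrite addrC lerBrDr -lerBrDl ge_min lexx orbT.
  apply: ler_wpM2l; first exact: expR_ge0.
  by rewrite expRM_natl lerXn2r ?nnegrE ?expR_ge0 ?(ltW e1)// lerDr.
rewrite (ler0_norm y0).
apply: (@le_trans _ _ (expR (d * y))).
  rewrite ler_expR -subr_ge0 -mulrBl mulr_le0// subr_le0.
  by rewrite ge_min lexx.
by rewrite mulrN opprK ler_peMr ?expR_ge0// exprn_ege1// lerDl expR_ge0.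
Qed.

Lemma integrable_exp_frac (b : R) N : 0 < b -> b < N%:R ->
  mu.-integrable setT (EFin \o (fun y => expR (b * y) * (1 + expR y)^-1 ^+ N)).
Proof.
move=> b0 bN; have [C C0 H] := exp_frac_bound b0 bN.
apply: (@integrable_inv1D_le R _ C).
  apply: measM; first by mtac.
  apply: measX; have := @meas_inv1D _ _ R (fun y => expR y) (@measurable_expR R).
  by under eq_fun do rewrite ger0_norm ?expR_ge0//.
by move=> y; rewrite ger0_norm// mulr_ge0 ?expR_ge0// exprn_ge0// invr_ge0 addr_ge0 ?expR_ge0.
Qed.

Definition gamk (b L y : R) := expR (b * y - L * expR y).

Definition gam (b : R) := \int[mu]_y gamk b 1 y.

Lemma gamk_bound (b : R) N : exists2 C, 0 < C &
  forall y, gamk b 1 y <= C * (expR (b * y) * (1 + expR y)^-1 ^+ N).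
Proof.
have [C C0 H] := polynomial_exp_bound N (@ltr01 R); exists C => // y.
rewrite /gamk expRD mulrCA; apply: ler_wpM2l; first exact: expR_ge0.
rewrite exprVn ler_pdivlMr ?exprn_gt0 ?ltr_pwDl ?expR_ge0// mulrC.
exact: H (expR_ge0 y).
Qed.

Lemma gamk_bound2 (b : R) : 0 < b -> exists2 C, 0 < C &
  forall y, gamk b 1 y <= C * (1 + `|y|)^-1 ^+ 2.
Proof.
move=> b0; have [N bN] : exists N : nat, b < N%:R.
  by exists (Num.trunc b).+1; exact: truncnS_gt.
have [C C0 H] := gamk_bound b N; have [D D0 K] := exp_frac_bound b0 bN.
exists (C * D); first exact: mulr_gt0.
move=> y; apply: le_trans (H y) _; rewrite -mulrA; apply: ler_wpM2l (K y).
exact: ltW.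
Qed.

Lemma meas_gamk b L : measurable_fun setT (gamk b L).
Proof. by rewrite /gamk; mtac; exact: measurable_expR. Qed.

Lemma integrable_gamk1 b : 0 < b -> mu.-integrable setT (EFin \o gamk b 1).
Proof.
move=> b0; have [C C0 H] := gamk_bound2 b0.
apply: (@integrable_inv1D_le R _ C); first exact: meas_gamk.
by move=> y; rewrite ger0_norm// expR_ge0.
Qed.

Lemma gamk_scale b L y : 0 < L ->
  gamk b 1 (1 * y + ln L) = expR (b * ln L) * gamk b L y.
Proof.
move=> L0; have E : expR (y + ln L) = expR y * L by rewrite expRD lnK ?posrE.
by rewrite /gamk !mul1r E -expRD; congr expR; ring.
Qed.

Lemma ge0_integral_gamk b L : 0 < b -> 0 < L ->
  (\int[mu]_y (gamk b L y)%:E = (gam b * expR (- (b * ln L)))%:E)%E.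
Proof.
move=> b0 L0; have : (gam b)%:E = (\int[mu]_y (gamk b 1 y)%:E)%E.
  by apply: ge0_integral_fin; exact: integrable_gamk1.
rewrite (@ge0_integral_affine _ 1 (ln L))//; last 2 first.
- by apply/measurable_EFinP; exact: meas_gamk.
- by move=> y; rewrite lee_fin expR_ge0.
under eq_integral do rewrite gamk_scale// EFinM.
rewrite mul1e ge0_integralZl//; last 2 first.
- by apply/measurable_EFinP; exact: meas_gamk.
- by move=> y _; rewrite lee_fin expR_ge0.
rewrite EFinM => ->; rewrite muleC muleA -EFinM -expRD addrC subrr expR0.
by rewrite mul1e.
Qed.

Lemma integrable_gamk b L : 0 < b -> 0 < L -> mu.-integrable setT (EFin \o gamk b L).
Proof.
move=> b0 L0; apply: integrable_lt; first exact: meas_gamk.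
  by move=> y; exact: expR_ge0.
by rewrite ge0_integral_gamk// ltry.
Qed.

Lemma integral_gamk b L : 0 < b -> 0 < L ->
  \int[mu]_y gamk b L y = gam b * expR (- (b * ln L)).
Proof. by move=> b0 L0; rewrite /Rintegral ge0_integral_gamk. Qed.

Lemma gam_gt0 b : 0 < b -> 0 < gam b.
Proof.
move=> b0; rewrite -lte_fin /gam ge0_integral_fin; last exact: integrable_gamk1.
apply: (@lt_le_trans _ _ (\int[mu]_y (expR (- expR 1) * \1_(`[0, 1]%classic : set R) y)%:E)%E).
  under eq_integral do rewrite EFinM.
  rewrite ge0_integralZl//; last first.
    by apply/measurable_EFinP; exact: measurable_indic.
  have -> : (\int[mu]_y (\1_(`[0, 1]%classic : set R) y)%:E = 1)%E.
    by rewrite integral_indic//= setIT lebesgue_measure_itv/= lte_fin ltr01 -EFinB subr0.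
  by rewrite mule1 lte_fin expR_gt0.
apply: ge0_le_integralT => y; rewrite lee_fin.
  by rewrite mulr_ge0 ?expR_ge0.
rewrite indicE; case: (boolP (y \in _)) => [|_]; last by rewrite mulr0 expR_ge0.
rewrite inE/= in_itv/= mulr1 => /andP[y0 y1]; rewrite ler_expR mul1r.
have := mulr_ge0 (ltW b0) y0; have : expR y <= expR 1 by rewrite ler_expR.
by lra.
Qed.

End gamma.

Section subordination.
Context (R : realType).
Local Notation mu := (@lebesgue_measure R).
Local Notation leb n := (lebesgue_rV R n).

(** At [L = 0] the Gamma integral diverges, while [ln 0 = 0] turns the power into 1. The condition
    on [A] settles this case, which occurs at frequency zero when d = 0. *)
Let gamk_int (b L A : R) : 0 < b -> 0 <= L -> (L = 0 -> A = 0) ->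
  mu.-integrable setT (EFin \o (fun y => gamk b L y * A)) /\
  \int[mu]_y (gamk b L y * A) = gam b * (expR (- (b * ln L)) * A).
Proof.
move=> b0; rewrite le_eqVlt => /predU1P[<- /(_ erefl) ->|L0 _].
  under eq_fun do rewrite mulr0.
  split; first by apply: integrable0.
  by rewrite !mulr0 /Rintegral integral0_eq.
have ig := integrable_gamk b0 L0; split.
  by under eq_fun do rewrite mulrC; exact: integrableZ.
by rewrite RintegralZr// integral_gamk// mulrA.
Qed.

Lemma meas_gamk2 d (T : measurableType d) (b : R) (f g : T -> R) :
  measurable_fun setT f -> measurable_fun setT g ->
  measurable_fun setT (fun x => gamk b (f x) (g x)).
Proof. by move=> mf mg; rewrite /gamk; mtac. Qed.

(* The identity [L^(-b) Gamma(b) = \int e^(b y) exp(- L e^y) dy], integrated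
   against [A]. *)
Lemma subordination n (b : R) (L A : 'rV[R]_n -> R) : 0 < b ->
  measurable_fun setT L -> measurable_fun setT A ->
  (forall xi, 0 <= L xi) -> (forall xi, L xi = 0 -> A xi = 0) ->
  (leb n).-integrable setT (EFin \o (fun xi => expR (- (b * ln (L xi))) * A xi)) ->
  gam b * (\int[leb n]_xi (expR (- (b * ln (L xi))) * A xi)) =
  \int[mu]_y \int[leb n]_xi (gamk b (L xi) y * A xi).
Proof.
move=> b0 mL mA L0 LA iA.
rewrite -RintegralZl//.
transitivity (\int[leb n]_xi \int[mu]_y (gamk b (L xi) y * A xi)).
  apply: eq_Rintegral => xi _.
  by have [_ ->] := gamk_int b0 (L0 xi) (@LA xi).
have mF : measurable_fun setT (fun p : 'rV[R]_n * measurableTypeR R => gamk b (L p.1) p.2 * A p.1).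
  apply: measM; last exact: (measurableT_comp mA measurable_fst).
  by apply: meas_gamk2; [exact: (measurableT_comp mL measurable_fst)|exact: measurable_snd].
apply: (@RFubini _ _ _ (measurableTypeR R) R (leb n) mu (fun p => gamk b (L p.1) p.2 * A p.1)).
apply/integrable12ltyP; first exact/measurable_EFinP.
(* As [gamk] is positive, integrating the absolute value in y gives back the power times |A|, whose
   integrability is assumed. *)
have E xi : (\int[mu]_y `|(gamk b (L xi) y * A xi)%:E| =
    (gam b * (expR (- (b * ln (L xi))) * `|A xi|))%:E)%E.
  have LA' : L xi = 0 -> `|A xi| = 0 by move=> /LA ->; rewrite normr0.
  have [I1 <-] := gamk_int b0 (L0 xi) LA'; rewrite ge0_integral_fin//.
  by apply: eq_integral => y _; rewrite /= normrM (ger0_norm (expR_ge0 _)).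
rewrite (_ : (fun xi => _) = (fun xi => (gam b * (expR (- (b * ln (L xi))) * `|A xi|))%:E)).
  have I2 : (leb n).-integrable setT (EFin \o (fun xi => gam b * (expR (- (b * ln (L xi))) * `|A xi|))).
    apply: integrableZ; apply: eq_integrable (integrable_norm iA) => // xi _ /=.
    by rewrite normrM (ger0_norm (expR_ge0 _)).
  by rewrite -ge0_integral_fin// ltry.
by apply/funext => xi; rewrite -E.
Qed.

End subordination.

(** * Heat kernel bounds uniform in time *)

Section heat_bounds.
Context (R : realType).
Local Notation mu := (@lebesgue_measure R).
Local Notation leb n := (lebesgue_rV R n).

(** By e^u >= 1 + u the square of the left side is at most 1 / (t + 2 c x^2), and t + 2 c x^2 >=
    min(a, 2 c) (1 + x^2) for all t >= a. *)
Let heat_wgt1 (a c : R) : 0 < a -> 0 < c -> exists2 C, 0 < C &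
  forall t x, a <= t ->
    expR (- (2^-1 * ln t)) * expR (- (c * x ^+ 2 / t)) <= C * (1 + `|x|)^-1.
Proof.
move=> a0 c0; pose d := Num.min a (2 * c).
have d0 : 0 < d by rewrite lt_min a0 mulr_gt0.
exists (Num.sqrt (2 / d)); first by rewrite sqrtr_gt0 divr_gt0.
move=> t x at_; have t0 : 0 < t := lt_le_trans a0 at_.
have x1 : 0 < 1 + `|x| by rewrite ltr_pwDl.
rewrite -ler_sqr ?nnegrE ?mulr_ge0 ?expR_ge0 ?sqrtr_ge0 ?invr_ge0 ?(ltW x1)//.
rewrite exprMn [in leRHS]exprMn sqr_sqrtr; last by rewrite ltW// divr_gt0.
rewrite -!expRM_natl !mulrN mulrA mulfV// mul1r expRN lnK ?posrE//.
have q0 : 0 <= 2 * c * x ^+ 2 / t.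
  apply: divr_ge0; last exact: ltW.
  by apply: mulr_ge0; [rewrite mulr_ge0// ltW|exact: sqr_ge0].
have q1 : 0 < 1 + 2 * c * x ^+ 2 / t by rewrite ltr_pwDl.
apply: (@le_trans _ _ (t^-1 * (1 + 2 * c * x ^+ 2 / t)^-1)).
  apply: ler_wpM2l; first by rewrite invr_ge0 ltW.
  rewrite expRN lef_pV2 ?posrE ?expR_gt0//.
  by rewrite (le_trans _ (expR_ge1Dx _))// lerD2l !mulrA.
apply: (@le_trans _ _ (d * (1 + x ^+ 2))^-1).
  rewrite -invfM lef_pV2 ?posrE; last 2 first.
  - by rewrite mulr_gt0.
  - by rewrite mulr_gt0// ltr_pwDl// sqr_ge0.
  rewrite (_ : t * _ = t + 2 * c * x ^+ 2); last by field; rewrite gt_eqF.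
  rewrite mulrDr mulr1; apply: lerD.
    by rewrite (le_trans _ at_)// ge_min lexx.
  by apply: ler_wpM2r; [exact: sqr_ge0|rewrite ge_min lexx orbT].
have h : 0 < 1 + x ^+ 2 by rewrite ltr_pwDl// sqr_ge0.
have dh : 0 <= (d * (1 + x ^+ 2))^-1 by rewrite invr_ge0 mulr_ge0// ltW.
rewrite -[leLHS]mulr1; apply: le_trans (ler_wpM2l dh (inv1D_sqr x)) _.
rewrite le_eqVlt; apply/orP; left; apply/eqP; field.
by rewrite !gt_eqF.
Qed.

Lemma heat_wgt n (a c : R) : 0 < a -> 0 < c -> exists2 C, 0 < C &
  forall t (x : 'rV[R]_n), a <= t ->
    heat n t * expR (- (c * nsq x / t)) <= C * wgt x.
Proof.
move=> a0 c0; have [C C0 H] := heat_wgt1 a0 c0.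
exists (C ^+ n); first by rewrite exprn_gt0.
move=> t x at_; elim: n x => [|n IH] x.
  by rewrite /heat /nsq /wgt !big_ord0 !(mulr0, mul0r) oppr0 expR0 !mulr1.
rewrite [x]cons_rV_surj; set u := x ord0 ord0; set v := rsubmx _.
rewrite nsq_cons wgt_cons (exprS C) [leRHS]mulrACA.
have t0 : 0 < t := lt_le_trans a0 at_.
have -> : heat n.+1 t * expR (- (c * (u ^+ 2 + nsq v) / t)) =
  (expR (- (2^-1 * ln t)) * expR (- (c * u ^+ 2 / t))) *
  (heat n t * expR (- (c * nsq v / t))).
  rewrite /heat -!expRD -natr1; congr expR; field.
  by rewrite gt_eqF.
apply: ler_pM => //; last exact: H.
by rewrite mulr_ge0 ?expR_ge0.
Qed.

(** The factor t^(- i) is kept: summed against binomial coefficients it rebuilds a power of d + 1/t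
    in [pot_kernel_bound]. *)
Lemma heat_term_wgt n i (a : R) : 0 < a -> exists2 C, 0 < C &
  forall t (x : 'rV[R]_n), a <= t ->
    `|heat_term n i t (pi * nsq x)| <= C * t^-1 ^+ i * wgt x.
Proof.
move=> a0; have pi20 : (0 : R) < pi / 2 by rewrite divr_gt0 ?pi_gt0.
have [C C0 H] := heat_wgt n a0 pi20.
have [D D0 K] := horner_bound (heat_poly R n i).
have h2 : (0 : R) < 2^-1 by rewrite invr_gt0.
have [E E0 L] := polynomial_exp_bound (size (heat_poly R n i)) h2.
exists (C * (D * E)); first by rewrite !mulr_gt0.
move=> t x at_; have t0 : 0 < t := lt_le_trans a0 at_.
pose u := pi * nsq x / t; have u0 : 0 <= u.
  by rewrite !mulr_ge0 ?pi_ge0 ?nsq_ge0// invr_ge0 ltW.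
rewrite /heat_term -/u.
have -> : expR (- (i%:R * ln t)) = t^-1 ^+ i.
  by rewrite -mulrN expRM_natl expRN lnK ?posrE.
rewrite !normrM (ger0_norm (ltW (heat_gt0 _ _))) (ger0_norm (expR_ge0 _)).
rewrite (ger0_norm (exprn_ge0 _ _)); last by rewrite invr_ge0 ltW.
(* One half of the exponent gives the weight, the other half absorbs the polynomial. *)
have -> : expR (- u) = expR (- (pi / 2 * nsq x / t)) * expR (- (2^-1 * u)).
  by rewrite -expRD; congr expR; rewrite /u; field; rewrite gt_eqF.
have -> : heat n t * t^-1 ^+ i * `|(heat_poly R n i).[u]| *
  (expR (- (pi / 2 * nsq x / t)) * expR (- (2^-1 * u))) =
  (heat n t * expR (- (pi / 2 * nsq x / t))) *
  (`|(heat_poly R n i).[u]| * expR (- (2^-1 * u))) * t^-1 ^+ i by ring.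
have H1 := H t x at_.
have H2 : `|(heat_poly R n i).[u]| * expR (- (2^-1 * u)) <= D * E.
  apply: le_trans (ler_wpM2r (expR_ge0 _) (K _ u0)) _.
  by rewrite -mulrA; apply: ler_wpM2l; [exact: ltW|exact: L].
have -> : C * (D * E) * t^-1 ^+ i * wgt x = (C * wgt x) * (D * E) * t^-1 ^+ i by ring.
apply: ler_wpM2r; first by rewrite exprn_ge0// invr_ge0 ltW.
by apply: ler_pM => //; rewrite mulr_ge0 ?expR_ge0// ltW// heat_gt0.
Qed.

End heat_bounds.

(** * Gaussians under a multiplier of positive order *)

Section potential.
Context (R : realType).
Local Notation mu := (@lebesgue_measure R).
Local Notation leb n := (lebesgue_rV R n).
Variables (n m : nat) (b a : R).
Hypotheses (b0 : 0 < b) (bm : b < m%:R) (a0 : 0 < a).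

Let m0 : (0 < m)%N.
Proof. by rewrite -(ltr_nat R) (lt_trans b0 bm). Qed.

Let ae0 y : 0 < a + expR y. Proof. by rewrite addr_gt0// expR_gt0. Qed.

(** In (d + pi |xi|^2)^(m - b) the power - b is subordinated and the power m is expanded by the
    binomial formula. For each y the Gaussian e^(- pi a |xi|^2) then has its parameter raised to a +
    e^y, and [gauss_cos_heat] gives every term in closed form. *)
Definition pot_kernel (d : R) (x : 'rV[R]_n) (y : R) : R :=
  expR (b * y - d * expR y) *
  \sum_(i < m.+1) d ^+ (m - i) * heat_term n i (a + expR y) (pi * nsq x) *+ 'C(m, i).

(* The Fourier transform of [(d + pi |xi|^2)^(m - b) e^(- pi a |xi|^2)]. *)
Definition potential (d : R) (x : 'rV[R]_n) : R :=
  (gam b)^-1 * \int[mu]_y pot_kernel d x y.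

Let L (d : R) (xi : 'rV[R]_n) := d + pi * nsq xi.

Let L0 d xi : 0 <= d -> 0 <= L d xi.
Proof. by move=> d0; rewrite addr_ge0// mulr_ge0 ?pi_ge0 ?nsq_ge0. Qed.

Let mL d : measurable_fun setT (L d).
Proof.
by apply: measD; [exact: measurable_cst|apply: measM; [exact: measurable_cst|exact: meas_nsq]].
Qed.

Let mE c : measurable_fun setT (fun xi : 'rV[R]_n => expR (- (pi * c * nsq xi))).
Proof.
apply: meas_exp; apply: measN; apply: measM; [exact: measurable_cst|exact: meas_nsq].
Qed.

Let mC (x : 'rV[R]_n) th : measurable_fun setT (fun xi : 'rV[R]_n => cos (2 * pi * dotp x xi + th)).
Proof.
apply: meas_cos; apply: measD; last exact: measurable_cst.
by apply: measM; [exact: measurable_cst|exact: meas_dotp].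
Qed.

Lemma symbol_bound d (xi : 'rV[R]_n) : 0 <= d ->
  (d + pi * nsq xi) `^ (m%:R - b) <= (1 + d + pi) ^+ m * (1 + nsq xi) ^+ m.
Proof.
move=> d0; have pn : 0 <= pi * nsq xi by rewrite mulr_ge0 ?pi_ge0 ?nsq_ge0.
have L1 : 0 <= 1 + (d + pi * nsq xi) by rewrite !addr_ge0.
apply: (@le_trans _ _ ((1 + (d + pi * nsq xi)) `^ m%:R)).
  apply: (@le_trans _ _ ((1 + (d + pi * nsq xi)) `^ (m%:R - b))).
    by apply: ge0_ler_powR; rewrite ?nnegrE ?subr_ge0 ?(ltW bm) ?(addr_ge0 d0 pn)// lerDr.
  by apply: ler_powR; rewrite ?lerDl ?addr_ge0// gerBl ltW.
rewrite powR_mulrn// -exprMn; move: pn L1 (pi_ge0 R).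
move: (pi) (nsq xi) (nsq_ge0 xi) => p q q0 pq L1 p0.
have dq : 0 <= d * q by rewrite mulr_ge0.
by apply: lerXn2r; rewrite ?nnegrE// ?mulr_ge0 ?addr_ge0//; nra.
Qed.

Lemma integrable_symbol d (q : 'rV[R]_n -> R) : 0 <= d -> measurable_fun setT q ->
  (forall xi, `|q xi| <= 1) ->
  (leb n).-integrable setT (EFin \o (fun xi => (d + pi * nsq xi) `^ (m%:R - b) *
     (expR (- (pi * a * nsq xi)) * q xi))).
Proof.
move=> d0 mq q1.
rewrite (_ : (fun xi => _) = (fun xi => expR (- (pi * a * nsq xi)) *
   ((d + pi * nsq xi) `^ (m%:R - b) * q xi))); last by apply/funext => xi; ring.
apply: (@integrable_gauss_cos _ _ _ _ m ((1 + d + pi) ^+ m)) => //.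
  by apply: measM => //; apply: meas_powR; exact: mL.
move=> xi; rewrite normrM ger0_norm ?powR_ge0//.
apply: le_trans (symbol_bound xi d0); rewrite ler_piMr ?powR_ge0//.
Qed.

(** The constant is uniform in d over [0, pi]. This allows dominated convergence as d tends to 0,
    and norm bounds that do not see the dilation. *)
Lemma pot_kernel_bound : exists2 C, 0 < C & forall d (x : 'rV[R]_n) y,
  0 <= d -> d <= pi ->
  `|pot_kernel d x y| <= C * (expR (b * y) * (1 + expR y)^-1 ^+ m) * wgt x.
Proof.
have /choice[Cf HC] : forall i, exists C, 0 < C /\ forall t (x : 'rV[R]_n), a <= t ->
    `|heat_term n i t (pi * nsq x)| <= C * t^-1 ^+ i * wgt x.
  by move=> i; have [C ? ?] := heat_term_wgt n i a0; exists C.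
have [M M0 hM] : exists2 M, 0 < M & forall i : 'I_m.+1, Cf i <= M.
  exists (\sum_(i < m.+1) Cf i).
    rewrite big_ord_recl ltr_pwDl ?sumr_ge0//; first by have [] := HC (@ord0 m).
    by move=> i _; have [/ltW] := HC (lift ord0 i).
  by move=> i; rewrite (bigD1 i)//= lerDl sumr_ge0// => j _; have [/ltW] := HC j.
have [D D0 HD] := polynomial_exp_bound m (@ltr01 R).
(* Here pi bounds d, 1 + 1/a bounds (1 + e^y) / (a + e^y), and the last 1 is the coefficient of d
   e^y. *)
pose K := pi + (1 + a^-1) + 1 : R.
have K0 : 0 < K by rewrite /K; move: (pi) (pi_gt0 R) => p p0; rewrite !addr_gt0// invr_gt0.
exists (M * (K ^+ m * D)); first by rewrite !mulr_gt0// exprn_gt0.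
move=> d x y d0 dpi; have t0 := ae0 y.
have w0 := wgt_gt0 x; have e0 := expR_gt0 y; have e1 : 0 < 1 + expR y by rewrite addr_gt0.
rewrite /pot_kernel expRD.
set S := \sum_(i < _) _.
have HS : `|S| <= M * (d + (a + expR y)^-1) ^+ m * wgt x.
  apply: le_trans (ler_norm_sum _ _ _) _.
  rewrite exprDn [M * _]mulr_sumr [X in _ <= X]mulr_suml; apply: ler_sum => i _.
  have [_ /(_ (a + expR y) x)] := HC i; rewrite lerDl => /(_ (ltW e0)) Hi.
  rewrite normrMn normrM ger0_norm ?exprn_ge0// -[leLHS]mulr_natr -[X in M * X]mulr_natr.
  have h1 := hM i.
  have h2 : 0 <= (a + expR y)^-1 ^+ i by rewrite exprn_ge0// invr_ge0 ltW.
  have h3 : `|heat_term n i (a + expR y) (pi * nsq x)| <= M * (a + expR y)^-1 ^+ i * wgt x.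
    by apply: le_trans Hi _; rewrite -!mulrA; apply: ler_wpM2r => //; rewrite mulr_ge0// ltW.
  rewrite (_ : M * _ * _ = d ^+ (m - i) * (M * (a + expR y)^-1 ^+ i * wgt x) * 'C(m, i)%:R); last by ring.
  by apply: ler_wpM2r => //; apply: ler_wpM2l; rewrite ?exprn_ge0.
(* The term d of the binomial has no decay in y of its own; e^(- d e^y) pays for it, since (d + 1/(a
   + e^y)) (1 + e^y) is at most K (1 + d e^y). *)
have HE : expR (- (d * expR y)) * (d + (a + expR y)^-1) ^+ m <=
    K ^+ m * D * (1 + expR y)^-1 ^+ m.
  have v0 : 0 <= d * expR y by rewrite mulr_ge0// ltW.
  rewrite exprVn ler_pdivlMr ?exprn_gt0// -mulrA -exprMn.
  have h : (d + (a + expR y)^-1) * (1 + expR y) <= K * (1 + d * expR y).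
    have q : (a + expR y)^-1 * (1 + expR y) <= 1 + a^-1.
      rewrite mulrC ler_pdivrMr// mulrDr !mulrDl !mul1r mulVf ?gt_eqF//.
      have : 0 <= a^-1 * expR y by apply: mulr_ge0; rewrite ?invr_ge0; exact: ltW.
      by have := ltW a0; lra.
    have : 0 <= K - 1.
      by rewrite /K; move: (pi) (pi_ge0 R) => p p0; rewrite addrK !addr_ge0// invr_ge0 ltW.
    move=> K1; have KE : K = pi + (1 + a^-1) + 1 by [].
    have : 0 <= (K - 1) * (d * expR y) by rewrite mulr_ge0.
    have -> : (d + (a + expR y)^-1) * (1 + expR y) =
      d + d * expR y + (a + expR y)^-1 * (1 + expR y) by ring.
    have -> : K * (1 + d * expR y) = (K - 1) * (d * expR y) + K + d * expR y by ring.
    move: q KE dpi; set P := _ * (1 + expR y); set Q := (K - 1) * _.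
    move: (pi) (K) (a^-1) Q (d * expR y) => p k a' Q v; lra.
  apply: (@le_trans _ _ (expR (- (d * expR y)) * (K * (1 + d * expR y)) ^+ m)).
    apply: ler_wpM2l; first exact: expR_ge0.
    rewrite lerXn2r ?nnegrE//; first by rewrite mulr_ge0 ?addr_ge0 ?invr_ge0 ?(ltW t0) ?(ltW e0).
    by apply: mulr_ge0; [exact: ltW|exact: addr_ge0].
  rewrite exprMn mulrCA; apply: ler_wpM2l; first by rewrite exprn_ge0// ltW.
  by rewrite mulrC; have := HD _ v0; rewrite mul1r.
rewrite normrM ger0_norm ?mulr_ge0 ?expR_ge0//.
apply: le_trans (ler_wpM2l _ HS) _; first by rewrite mulr_ge0 ?expR_ge0.
have e2 : 0 <= M * expR (b * y) * wgt x by rewrite !mulr_ge0 ?expR_ge0// ltW.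
have := ler_wpM2l e2 HE.
move: (expR (b * y)) (expR (- (d * expR y))) ((d + _) ^+ m) (K ^+ m) ((1 + expR y)^-1 ^+ m) (wgt x).
move=> u v p k q w.
rewrite (_ : u * v * (M * p * w) = M * u * w * (v * p)); last by ring.
by rewrite (_ : M * (k * D) * (u * q) * w = M * u * w * (k * D * q)); last by ring.
Qed.

Lemma meas_heat_term d (T : measurableType d) (f g : T -> R) i :
  measurable_fun setT f -> measurable_fun setT g -> (forall x, 0 < f x) ->
  measurable_fun setT (fun x => heat_term n i (f x) (g x)).
Proof.
move=> mf mg f0; rewrite /heat_term /heat.
have ml : measurable_fun setT (fun x => ln (f x)).
  exact: (measurableT_comp (@measurable_ln R) mf).
have mq : measurable_fun setT (fun x => g x / f x).
  apply: measM => //.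
  rewrite (_ : (fun x => _) = (fun x => expR (- ln (f x)))).
    by apply: meas_exp; exact: measN.
  by apply/funext => x; rewrite expRN lnK ?posrE.
by mtac.
Qed.

Lemma meas_pot_kernel d :
  measurable_fun setT (fun p : 'rV[R]_n * R => pot_kernel d p.1 p.2).
Proof.
rewrite /pot_kernel; apply: measM; first by mtac.
apply: meas_sum => i.
under eq_fun do rewrite -mulr_natr.
apply: measM; last exact: measurable_cst.
apply: measM; first exact: measurable_cst.
apply: meas_heat_term => [||p]; last exact: ae0.
  by mtac.
apply: measM; first exact: measurable_cst.
exact: (measurableT_comp (@meas_nsq R n) measurable_fst).
Qed.

Lemma meas_pot_kernel2 d x : measurable_fun setT (fun y : R => pot_kernel d x y).
Proof. exact: (measurableT_comp (meas_pot_kernel d) (measurable_pair1 x)). Qed.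

Lemma integrable_pot_kernel d (x : 'rV[R]_n) : 0 <= d -> d <= pi ->
  mu.-integrable setT (EFin \o pot_kernel d x).
Proof.
move=> d0 dpi; have [C C0 H] := pot_kernel_bound.
apply: (@integrable_le _ _ _ mu _ (fun y => (C * wgt x) * (expR (b * y) * (1 + expR y)^-1 ^+ m))).
- exact: meas_pot_kernel2.
- by move=> y; apply: le_trans (H _ _ _ d0 dpi) _; rewrite mulrAC.
- by apply: integrableZ; exact: integrable_exp_frac.
Qed.

Lemma potential_bound : exists2 C, 0 < C & forall d (x : 'rV[R]_n),
  0 <= d -> d <= pi -> `|potential d x| <= C * wgt x.
Proof.
have [C C0 H] := pot_kernel_bound.
pose I := \int[mu]_y (expR (b * y) * (1 + expR y)^-1 ^+ m).
have I0 : 0 <= I.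
  by apply: Rintegral_ge0 => y _; rewrite mulr_ge0 ?expR_ge0 ?exprn_ge0 ?invr_ge0 ?addr_ge0 ?expR_ge0.
have g0 := gam_gt0 b0.
exists ((gam b)^-1 * (C * I) + 1); first by rewrite ltr_wpDl// !mulr_ge0 ?invr_ge0 ?(ltW g0) ?(ltW C0).
move=> d x d0 dpi; have w0 := wgt_gt0 x.
apply: (@le_trans _ _ ((gam b)^-1 * (C * I) * wgt x)); last first.
  by apply: ler_wpM2r; [exact: ltW|rewrite lerDl].
rewrite /potential normrM ger0_norm ?invr_ge0 ?(ltW g0)// -mulrA.
apply: ler_wpM2l; first by rewrite invr_ge0 ltW.
rewrite mulrAC /I -RintegralZl//; last exact: integrable_exp_frac.
apply: normr_Rintegral_le.
- exact: meas_pot_kernel2.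
- by move=> y; apply: le_trans (H _ _ _ d0 dpi) _; rewrite mulrAC.
- by apply: integrableZ; exact: integrable_exp_frac.
Qed.

Lemma meas_potential d : measurable_fun setT (potential d).
Proof.
apply: measM; first exact: measurable_cst.
exact: (@meas_Rintegral _ _ _ (measurableTypeR R) R mu _ (meas_pot_kernel d)).
Qed.

Lemma potential_cvg (x : 'rV[R]_n) (d_ : nat -> R) :
  (forall k, 0 <= d_ k) -> (forall k, d_ k <= pi) ->
  d_ k @[k --> \oo] --> (0 : R) ->
  potential (d_ k) x @[k --> \oo] --> potential 0 x.
Proof.
move=> d0 dpi dc; have [C C0 H] := pot_kernel_bound.
apply: cvgM; first exact: cvg_cst.
have := @dominated_cvg _ _ _ mu setT measurableT (fun k y => (pot_kernel (d_ k) x y)%:E)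
  (fun y => (pot_kernel 0 x y)%:E) (fun y => ((C * wgt x) * (expR (b * y) * (1 + expR y)^-1 ^+ m))%:E).
move=> DC; apply: fine_cvg.
rewrite fineK; last first.
  by apply: integrable_fin_num => //; apply: integrable_pot_kernel => //; exact: pi_ge0.
apply: DC => //.
- by move=> k; apply/measurable_EFinP; exact: meas_pot_kernel2.
- move=> y _; apply: cvg_EFin; first exact: nearW.
  rewrite /comp/= /pot_kernel; apply: cvgM.
    apply: (@continuous_cvg _ _ _ _ _ _ expR); first exact: continuous_expR.
    by apply: cvgB; [exact: cvg_cst|apply: cvgM => //; exact: cvg_cst].
  apply: cvg_big => [|i _]; first exact: add_continuous.
  apply: cvgMn; apply: cvgM; last exact: cvg_cst.
  by apply: (@continuous_cvg _ _ _ _ _ _ (fun d : R => d ^+ (m - i))) => //; exact: exprn_continuous.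
- by apply: integrableZ; exact: integrable_exp_frac.
- by move=> k y _; rewrite lee_fin; apply: le_trans (H _ _ _ (d0 k) (dpi k)) _; rewrite mulrAC.
Qed.

Lemma potentialE d (x : 'rV[R]_n) th : 0 <= d -> d <= pi ->
  \int[leb n]_xi ((d + pi * nsq xi) `^ (m%:R - b) *
     (expR (- (pi * a * nsq xi)) * cos (2 * pi * dotp x xi + th))) =
  potential d x * cos th.
Proof.
move=> d0 dpi.
pose A xi := L d xi ^+ m * (expR (- (pi * a * nsq xi)) * cos (2 * pi * dotp x xi + th)).
have mA : measurable_fun setT A.
  by apply: measM; [apply: measX; exact: mL|apply: measM].
have E xi : (d + pi * nsq xi) `^ (m%:R - b) *
     (expR (- (pi * a * nsq xi)) * cos (2 * pi * dotp x xi + th)) =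
     expR (- (b * ln (L d xi))) * A xi.
  rewrite /A [RHS]mulrA; congr (_ * _); rewrite -/(L d xi).
  (* If [L d xi = 0], both sides vanish: the power because m - b is nonzero, the other side because
     m > 0. *)
  have : 0 <= L d xi by exact: L0.
  rewrite le_eqVlt => /predU1P[<-|Lp].
    by rewrite powR0 ?subr_eq0 ?gt_eqF// expr0n gtn_eqF// mulr0.
  by rewrite /powR gt_eqF// mulrBl expRD expRM_natl lnK ?posrE// mulrC.
have iA : (leb n).-integrable setT (EFin \o (fun xi => expR (- (b * ln (L d xi))) * A xi)).
  have := integrable_symbol d0 (mC x th) (fun _ => cos_max _).
  by apply: eq_integrable => // xi _; rewrite /= E.
have LA xi : L d xi = 0 -> A xi = 0.
  by rewrite /A => ->; rewrite expr0n gtn_eqF// mul0r.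
under eq_Rintegral do rewrite E.
apply: (mulfI (lt0r_neq0 (gam_gt0 b0))).
rewrite (subordination b0 (mL d) mA (fun xi => L0 xi d0) LA iA).
rewrite /potential !mulrA mulfV ?gt_eqF ?gam_gt0// mul1r.
have inner y : \int[leb n]_xi (gamk b (L d xi) y * A xi) = pot_kernel d x y * cos th.
  have ii i : (leb n).-integrable setT (EFin \o (fun xi =>
     (expR (- (pi * (a + expR y) * nsq xi)) * ((pi * nsq xi) ^+ i * cos (2 * pi * dotp x xi + th))))).
    apply: (@integrable_gauss_cos _ _ _ _ i (pi ^+ i)) => //.
      by apply: measM => //; apply: measX; apply: measM; [exact: measurable_cst|exact: meas_nsq].
    move=> xi; have p0 : 0 <= pi * nsq xi by rewrite mulr_ge0 ?pi_ge0 ?nsq_ge0.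
    rewrite normrM ger0_norm ?exprn_ge0//.
    apply: (@le_trans _ _ ((pi * nsq xi) ^+ i)).
      by rewrite ler_piMr ?exprn_ge0// cos_max.
    rewrite -exprMn; apply: lerXn2r; rewrite ?nnegrE//.
      by rewrite mulr_ge0 ?pi_ge0// addr_ge0 ?nsq_ge0.
    by apply: ler_wpM2l; [exact: pi_ge0|rewrite lerDr].
  transitivity (\int[leb n]_xi (expR (b * y - d * expR y) * \sum_(i < m.+1)
     ((d ^+ (m - i) *+ 'C(m, i)) * (expR (- (pi * (a + expR y) * nsq xi)) *
       ((pi * nsq xi) ^+ i * cos (2 * pi * dotp x xi + th)))))).
    apply: eq_Rintegral => xi _; rewrite /gamk /A /L exprDn.
    rewrite (_ : b * y - _ = (b * y - d * expR y) + (- (pi * expR y * nsq xi))); last by ring.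
    rewrite expRD -mulrA; congr (_ * _).
    rewrite mulr_suml mulr_sumr; apply: eq_bigr => i _.
    rewrite (_ : - (pi * (a + expR y) * nsq xi) = - (pi * a * nsq xi) - (pi * expR y * nsq xi)); last by ring.
    rewrite expRD.
    move: (cos _) (expR (- (pi * a * nsq xi))) (expR (- (pi * expR y * nsq xi)))
      ((pi * nsq xi) ^+ i) (d ^+ (m - i)) => c e1 e2 q p.
    by rewrite -(mulr_natr (p * q)) -(mulr_natr p); move: ('C(m, i)%:R : R) => k; ring.
  rewrite RintegralZl//; last by apply: integrable_sumr => i; apply: integrableZ; exact: ii.
  rewrite /pot_kernel -mulrA; congr (_ * _).
  rewrite Rintegral_sum; last by move=> i; apply: integrableZ; exact: ii.
  rewrite mulr_suml; apply: eq_bigr => i _.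
  rewrite (RintegralZl _ measurableT (ii i)) gauss_cos_heat//.
  by move: (heat_term _ _ _ _) (d ^+ _) (cos _) => h p c; rewrite -(mulr_natr (p * h)) -(mulr_natr p); ring.
under eq_Rintegral do rewrite inner.
by rewrite RintegralZr//; exact: integrable_pot_kernel.
Qed.

End potential.

(** * Behaviour of the potential at infinity *)

Section asymptotics.
Context (R : realType).
Local Notation mu := (@lebesgue_measure R).
Local Notation leb n := (lebesgue_rV R n).

(** With u = e^z this is the integral of P(u) u^(g - 1) e^(- u) over u > 0. *)
Definition gamp (g : R) (P : {poly R}) := \int[mu]_z (P.[expR z] * gamk g 1 z).

Let gamp_bound (g : R) (P : {poly R}) : 0 < g -> exists2 C, 0 < C &
  forall z, `|P.[expR z] * gamk g 1 z| <= C * (1 + `|z|)^-1 ^+ 2.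
Proof.
move=> g0; have [N gN] : exists N : nat, g < N%:R.
  by exists (Num.trunc g).+1; exact: truncnS_gt.
have [C C0 H] := horner_bound P.
have [D D0 K] := gamk_bound g (N + size P); have [E E0 L] := exp_frac_bound g0 gN.
exists (C * D * E) => [|z]; first by rewrite !mulr_gt0.
have e1 : 0 < 1 + expR z by rewrite addr_gt0// expR_gt0.
rewrite normrM (ger0_norm (expR_ge0 _)).
apply: (@le_trans _ _ (C * (1 + expR z) ^+ size P *
    (D * (expR (g * z) * (1 + expR z)^-1 ^+ (N + size P))))).
  by apply: ler_pM; [|exact: expR_ge0|exact: H (expR_ge0 z)|exact: K].
rewrite (_ : _ * _ = C * D * (expR (g * z) * (1 + expR z)^-1 ^+ N)).
  by rewrite -!mulrA; do 2 (apply: ler_wpM2l; first exact: ltW).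
rewrite exprD (exprVn _ (size P)); field.
by rewrite expf_neq0// gt_eqF.
Qed.

Let meas_gamp g (P : {poly R}) : measurable_fun setT (fun z => P.[expR z] * gamk g 1 z).
Proof.
apply: measM; last exact: meas_gamk.
by apply: meas_horner; exact: measurable_expR.
Qed.

Lemma integrable_gamp (g : R) (P : {poly R}) : 0 < g ->
  mu.-integrable setT (EFin \o (fun z => P.[expR z] * gamk g 1 z)).
Proof.
move=> g0; have [C C0 H] := gamp_bound P g0.
exact: (integrable_inv1D_le (meas_gamp g P) H).
Qed.

(* Integration by parts: [\int (e^z P'(e^z) - e^z P(e^z)) = - g \int P(e^z)]
   with respect to [gamk g 1]. *)
Lemma gamp_rec (g c : R) (P : {poly R}) : 0 < g ->
  gamp g (c *: P + 'X * P^`() - 'X * P) = (c - g) * gamp g P.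
Proof.
move=> g0.
pose Q : {poly R} := 'X * P^`() - 'X * P + g *: P.
have dF (z : R) : hasder (fun z => P.[expR z] * gamk g 1 z) z (Q.[expR z] * gamk g 1 z).
  apply: derE.
    apply: derM; last by rewrite /gamk; dtac.
    apply: (@der_comp R (fun u => P.[u])); first exact: is_derive_poly.
    by dtac.
  rewrite /Q /gamk !hornerE /=.
  by move: (expR _) (P^`().[_]) (P.[_]) => *; ring.
have [C C0 H] := gamp_bound P g0; have [D D0 K] := gamp_bound Q g0.
have Z : \int[mu]_z (Q.[expR z] * gamk g 1 z) = 0.
  apply: (@Rintegral_derive0_bound R _ _ (C + D) dF).
  - move=> z; apply: der_continuous; apply: derM; last by rewrite /gamk; dtac.
    apply: (@der_comp R (fun u => Q.[u])); first exact: is_derive_poly.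
    by dtac.
  - move=> z; apply: le_trans (H z) _; apply: ler_wpM2r; last by rewrite lerDl ltW.
    by rewrite exprn_ge0// invr_ge0 addr_ge0.
  - move=> z; apply: le_trans (K z) _; apply: ler_wpM2r; last by rewrite lerDr ltW.
    by rewrite exprn_ge0// invr_ge0 addr_ge0.
rewrite /gamp -RintegralZl//; last exact: integrable_gamp.
rewrite -[RHS]add0r -Z -RintegralD//; last 2 first.
- exact: integrable_gamp.
- by apply: integrableZ; exact: integrable_gamp.
apply: eq_Rintegral => z _; rewrite /Q !hornerE /=.
by move: (expR _) (gamk _ _ _) (P^`().[_]) (P.[_]) => *; ring.
Qed.

(** The step from j to j + 1 in [heat_poly] is the expression of [gamp_rec] with c = n / 2 + j, so
    it contributes the factor n / 2 + j - g. *)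
Lemma gamp_heat n i (g : R) : 0 < g ->
  gamp g (heat_poly R n i) = (\prod_(j < i) (n%:R / 2 + j%:R - g)) * gam g.
Proof.
move=> g0; elim: i => [|i IH].
  by rewrite big_ord0 mul1r /gamp; apply: eq_Rintegral => z _; rewrite /= hornerC mul1r.
by rewrite /= gamp_rec// IH big_ord_recr/= mulrA; congr (_ * _); rewrite mulrC.
Qed.

Variables (n m : nat) (b a : R).
Hypotheses (b0 : 0 < b) (b1 : b < 1) (m0 : (0 < m)%N) (a0 : 0 < a).

Let bm : b < m%:R. Proof. by rewrite (lt_le_trans b1)// ler1n. Qed.

(** With rho = pi |x|^2, the potential at d = 0 is rho^(- g) I(a / rho) up to a constant, so its
    behaviour at infinity is read off from [I] near 0. *)
Let I (e : R) := \int[mu]_z (expR (b * z) * heat_term n m (e + expR z) 1).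

Let heat_lnV (t : R) : 0 < t -> heat_term n m t 1 =
  heat n t * t^-1 ^+ m * (heat_poly R n m).[t^-1] * expR (- t^-1).
Proof.
move=> t0; rewrite /heat_term !div1r; congr (_ * _ * _ * _).
by rewrite -mulrN expRM_natl expRN lnK ?posrE.
Qed.

(** With t = e + e^z, the factor e^(- 1/t) absorbs every power of 1 + 1/t and leaves (1 + t)^(- m),
    which decreases in t; so the bound at e = 0 serves all e >= 0. *)
Let I_bound : exists2 C, 0 < C & forall e z, 0 <= e ->
  `|expR (b * z) * heat_term n m (e + expR z) 1| <=
  C * (expR (b * z) * (1 + expR z)^-1 ^+ m).
Proof.
have [C C0 H] := horner_bound (heat_poly R n m).
have [D D0 K] := polynomial_exp_bound (n + size (heat_poly R n m) + m) (@ltr01 R).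
exists (C * D) => [|e z e0]; first exact: mulr_gt0.
pose t := e + expR z; have ez := expR_gt0 z; have t0 : 0 < t by rewrite ltr_wpDl.
have u0 : 0 < t^-1 by rewrite invr_gt0.
have u1 : 0 < 1 + t^-1 by rewrite addr_gt0.
rewrite normrM (ger0_norm (expR_ge0 _)) mulrCA; apply: ler_wpM2l; first exact: expR_ge0.
rewrite -/t heat_lnV// !normrM (ger0_norm (expR_ge0 _)) (ger0_norm (expR_ge0 _)).
rewrite (ger0_norm (exprn_ge0 _ (ltW u0))).
have h1 : heat n t <= (1 + t^-1) ^+ n.
  rewrite -[X in X ^+ n]lnK ?posrE// -expRM_natl ler_expR -mulrN -lnV ?posrE//.
  have l1 : ln t^-1 <= ln (1 + t^-1) by rewrite ler_ln ?posrE// lerDr.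
  have l2 : 0 <= ln (1 + t^-1) by rewrite ln_ge0// lerDl ltW.
  have n0 : (0 : R) <= n%:R by [].
  by have := ler_wpM2l n0 l1; have := mulr_ge0 n0 l2; lra.
have h2 := H _ (ltW u0).
have h3 := K _ (ltW u0); rewrite mul1r in h3.
apply: (@le_trans _ _ ((1 + t^-1) ^+ n * t^-1 ^+ m * (C * (1 + t^-1) ^+ size (heat_poly R n m)) * expR (- t^-1))).
  apply: ler_wpM2r; first exact: expR_ge0.
  apply: ler_pM => //; first by rewrite mulr_ge0 ?expR_ge0 ?exprn_ge0 ?(ltW u0).
  by apply: ler_wpM2r => //; rewrite exprn_ge0// ltW.
have -> : (1 + t^-1) ^+ n * t^-1 ^+ m * (C * (1 + t^-1) ^+ size (heat_poly R n m)) * expR (- t^-1) =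
  C * ((1 + t^-1) ^+ (n + size (heat_poly R n m) + m) * expR (- t^-1)) * (t^-1 / (1 + t^-1)) ^+ m.
  have F (u E c : R) k1 k2 k3 : 0 < 1 + u -> (1 + u) ^+ k1 * u ^+ k3 * (c * (1 + u) ^+ k2) * E =
      c * ((1 + u) ^+ (k1 + k2 + k3) * E) * (u / (1 + u)) ^+ k3.
    by move=> v0; rewrite expr_div_n !exprD; field; rewrite expf_neq0// gt_eqF.
  exact: F.
apply: (@le_trans _ _ (C * D * (t^-1 / (1 + t^-1)) ^+ m)).
  apply: ler_wpM2r; first by rewrite exprn_ge0// divr_ge0// ltW.
  by apply: ler_wpM2l => //; exact: ltW.
apply: ler_wpM2l; first by rewrite mulr_ge0// ltW.
have -> : t^-1 / (1 + t^-1) = (1 + t)^-1.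
  by field; rewrite !gt_eqF// addr_gt0.
have et : 1 + expR z <= 1 + t by rewrite /t; lra.
have z1 : 0 < 1 + expR z by rewrite addr_gt0.
by rewrite lerXn2r ?nnegrE ?invr_ge0 ?(le_trans (ltW z1) et) ?(ltW z1)// lef_pV2 ?posrE// (lt_le_trans z1).
Qed.

Let meas_I (e : R) : 0 <= e ->
  measurable_fun setT (fun z => expR (b * z) * heat_term n m (e + expR z) 1).
Proof.
move=> e0; apply: measM; first by mtac.
apply: meas_heat_term => [||z]; [|exact: measurable_cst|by rewrite ltr_wpDl ?expR_gt0].
by apply: measD; [exact: measurable_cst|exact: measurable_expR].
Qed.

Let integrable_I (e : R) : 0 <= e ->
  mu.-integrable setT (EFin \o (fun z => expR (b * z) * heat_term n m (e + expR z) 1)).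
Proof.
move=> e0; have [C C0 H] := I_bound.
apply: (@integrable_le _ _ _ mu _ _ (meas_I e0) (fun z => H e z e0)).
by apply: integrableZ; exact: integrable_exp_frac.
Qed.

(** For s = 2 (m - b) this is (n + s) / 2, so that rho^(- g) is a constant times |x|^(- n - s). *)
Let g := n%:R / 2 + m%:R - b.

Let g0 : 0 < g.
Proof. by rewrite /g -addrA ltr_wpDl ?divr_ge0// subr_gt0. Qed.

(** The reflection z -> - z exchanges time and its inverse: the polynomial is then evaluated at e^z
    and the remaining factors form the Gamma kernel of parameter [g]. *)
Let I0E : I 0 = gamp g (heat_poly R n m).
Proof.
rewrite /I /gamp; have [_ ->] := Rintegral_opp (integrable_I (lexx 0)).
apply: eq_Rintegral => z _; rewrite add0r heat_lnV ?expR_gt0//.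
rewrite -expRN opprK /heat expRK /gamk /g -expRM_natl.
rewrite (_ : (n%:R / 2 + m%:R - b) * z - 1 * expR z =
  b * - z + - (n%:R / 2 * - z) + m%:R * z + - expR z); last by ring.
by rewrite !expRD; ring.
Qed.

(** The factors are b - (m - i) with m - i >= 1 > b, hence all negative. At b = 1, that is for the
    even integer s = 2 (m - 1), the factor i = m - 1 would vanish. *)
Let I0_neq0 : I 0 != 0.
Proof.
rewrite I0E gamp_heat//; apply: mulf_neq0; last by rewrite gt_eqF ?gam_gt0.
apply/prodf_neq0 => i _.
rewrite /g (_ : _ - _ = b - (m%:R - i%:R)); last by ring.
rewrite lt_eqF// subr_lt0 -natrB; last exact: ltnW.
by rewrite (lt_le_trans b1)// ler1n subn_gt0.
Qed.

Let I_cvg (e_ : nat -> R) : (forall k, 0 <= e_ k) -> e_ k @[k --> \oo] --> (0 : R) ->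
  I (e_ k) @[k --> \oo] --> I 0.
Proof.
move=> e0 ec; have [C C0 H] := I_bound.
have := @dominated_cvg _ _ _ mu setT measurableT
  (fun k z => (expR (b * z) * heat_term n m (e_ k + expR z) 1)%:E)
  (fun z => (expR (b * z) * heat_term n m (0 + expR z) 1)%:E)
  (fun z => (C * (expR (b * z) * (1 + expR z)^-1 ^+ m))%:E).
move=> DC; apply: fine_cvg.
rewrite fineK; last first.
  by apply: integrable_fin_num => //; exact: integrable_I.
apply: DC => //.
- by move=> k; apply/measurable_EFinP; exact: meas_I.
- move=> z _; apply: cvg_EFin; first exact: nearW.
  rewrite /comp/=; apply: cvgM; first exact: cvg_cst.
  have t0 : 0 < 0 + expR z by rewrite add0r expR_gt0.
  apply: (@continuous_cvg _ _ _ _ _ _ (fun t => heat_term n m t 1)).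
    by have := heat_term_derive n m 1 t0; exact: der_continuous.
  by apply: cvgD => //; exact: cvg_cst.
- by apply: integrableZ; exact: integrable_exp_frac.
- by move=> k z _; rewrite lee_fin; exact: H.
Qed.

Let I_low : exists2 e, 0 < e & forall e', 0 <= e' -> e' < e -> `|I 0| / 2 <= `|I e'|.
Proof.
apply: contrapT => H.
have /choice[e_ He] : forall k : nat, exists e', [/\ 0 <= e', e' < k.+1%:R^-1 & `|I e'| < `|I 0| / 2].
  move=> k; apply: contrapT => K; apply: H; exists k.+1%:R^-1; first by rewrite invr_gt0.
  move=> e' e0 ek; rewrite leNgt; apply/negP => L; apply: K; exists e'; split => //.
have c1 : e_ k @[k --> \oo] --> (0 : R).
  apply: squeeze_cvgr (cvg_cst 0) (@cvg_harmonic R); apply: nearW => k.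
  by have [-> /ltW] := He k.
have c2 := I_cvg (fun k => let: And3 h _ _ := He k in h) c1.
have c3 : `|I (e_ k)| @[k --> \oo] --> `|I 0| by exact: cvg_norm.
have : `|I 0| <= `|I 0| / 2.
  apply: (ler_cvg_to c3 (cvg_cst _)).
  by apply: nearW => k; have [_ _ /ltW] := He k.
have : 0 < `|I 0| by rewrite normr_gt0.
lra.
Qed.

Let pot_kernel0 (x : 'rV[R]_n) y : pot_kernel m b a 0 x y =
  expR (b * y) * heat_term n m (a + expR y) (pi * nsq x).
Proof.
rewrite /pot_kernel mul0r subr0 big_ord_recr/= subnn expr0 mul1r binn mulr1n.
rewrite big1 ?add0r// => i _; rewrite expr0n subn_eq0 leqNgt ltn_ord/=.
by rewrite mul0r mul0rn.
Qed.

Lemma potential0E (x : 'rV[R]_n) : 0 < nsq x ->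
  potential m b a 0 x = (gam b)^-1 * (expR (- (g * ln (pi * nsq x))) * I (a / (pi * nsq x))).
Proof.
move=> x0; pose rho := pi * nsq x; have r0 : 0 < rho by rewrite mulr_gt0 ?pi_gt0.
rewrite /potential -/rho; congr (_ * _).
under eq_Rintegral do rewrite pot_kernel0.
have ii := integrable_pot_kernel b0 bm a0 x (lexx 0) (pi_ge0 R).
have {}ii : mu.-integrable setT (EFin \o (fun y => expR (b * y) * heat_term n m (a + expR y) rho)).
  by apply: eq_integrable ii => // y _; rewrite /= pot_kernel0.
(* Substituting e^y = rho e^z turns the time a + e^y into rho (a / rho + e^z) and extracts all
   powers of rho. *)
have [_ ->] := Rintegral_translate (ln rho) ii.
rewrite /I -RintegralZl//; last first.
  by apply: integrable_I; rewrite divr_ge0// ltW.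
apply: eq_Rintegral => z _.
have -> : a + expR (z + ln rho) = rho * (a / rho + expR z).
  by rewrite expRD lnK ?posrE//; field; rewrite gt_eqF.
have t0 : 0 < a / rho + expR z by rewrite addr_gt0 ?divr_gt0 ?expR_gt0.
rewrite /heat_term /heat lnM ?posrE//.
have -> : rho / (rho * (a / rho + expR z)) = 1 / (a / rho + expR z).
  by field; rewrite !gt_eqF//=; rewrite addr_gt0// mulr_gt0 ?expR_gt0.
rewrite (_ : b * (z + ln rho) = b * z + b * ln rho); last by ring.
rewrite (_ : - (n%:R / 2 * _) = - (n%:R / 2 * ln (a / rho + expR z)) + - (n%:R / 2 * ln rho)); last by ring.
rewrite (_ : - (m%:R * _) = - (m%:R * ln (a / rho + expR z)) + - (m%:R * ln rho)); last by ring.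
rewrite (_ : - (g * ln rho) = b * ln rho + - (n%:R / 2 * ln rho) + - (m%:R * ln rho)); last by rewrite /g; ring.
rewrite !expRD; move: (expR _) (expR _) (expR _) (expR _) (expR _) (expR _) (_.[_]) => *; ring.
Qed.

(* At infinity the potential is dominated by the singularity of [|xi|^s] at the
   origin; the leading coefficient does not vanish because [s] is not an even
   integer. *)
Lemma potential0_low : exists2 c, 0 < c & exists2 r0, 1 <= r0 &
  forall x : 'rV[R]_n, r0 <= pi * nsq x ->
    c * expR (- (g * ln (pi * nsq x))) <= `|potential m b a 0 x|.
Proof.
have [e e0 H] := I_low; have gb := gam_gt0 b0.
exists ((gam b)^-1 * (`|I 0| / 2)).
  by rewrite mulr_gt0 ?invr_gt0// divr_gt0// normr_gt0.
(* The second term forces a / rho < e; the 1 ensures rho >= 1, so that exponents can later be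
   compared through ln rho >= 0. *)
exists (1 + 2 * a / e); first by rewrite lerDl divr_ge0 ?mulr_ge0// ltW.
move=> x xr; have r0 : 0 < pi * nsq x.
  by apply: lt_le_trans xr; rewrite ltr_pwDl// divr_ge0 ?mulr_ge0// ltW.
have x0 : 0 < nsq x by rewrite -(pmulr_rgt0 _ (pi_gt0 R)).
rewrite potential0E// normrM (ger0_norm (_ : 0 <= (gam b)^-1)) ?invr_ge0 ?(ltW gb)//.
rewrite -mulrA; apply: ler_wpM2l; first by rewrite invr_ge0 ltW.
rewrite normrM (ger0_norm (expR_ge0 _)) mulrC; apply: ler_wpM2l; first exact: expR_ge0.
apply: H; first by rewrite divr_ge0 ?(ltW a0) ?(ltW r0).
rewrite ltr_pdivrMr// mulrC -ltr_pdivrMr//; apply: lt_le_trans xr.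
by have := divr_gt0 a0 e0; rewrite -mulrA; lra.
Qed.

End asymptotics.

(** * Divergence of the L^r norm *)

Section divergence.
Context (R : realType).
Local Notation mu := (@lebesgue_measure R).
Local Notation leb n := (lebesgue_rV R n).

Lemma heatM n (s t : R) : 0 < s -> 0 < t -> heat n (s * t) = heat n s * heat n t.
Proof. by move=> s0 t0; rewrite /heat lnM ?posrE// mulrDr opprD expRD. Qed.

Lemma heat_sqr n (u : R) : 0 < u -> heat n (u ^+ 2) = u^-1 ^+ n.
Proof.
move=> u0; rewrite /heat lnXn// -mulr_natr (_ : - _ = n%:R * - ln u); last by field.
by rewrite expRM_natl expRN lnK ?posrE.
Qed.

Lemma heat_le n (s t : R) : 0 < s -> s <= t -> heat n t <= heat n s.
Proof.
move=> s0 st; rewrite /heat ler_expR lerN2; apply: ler_wpM2l; first by rewrite divr_ge0.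
by rewrite ler_ln ?posrE// (lt_le_trans s0).
Qed.

(* Each dyadic cube [2^k, 2^(k+1)[^n contributes at least the same constant. *)
Lemma ge0_integral_nsq_oo n (f : 'rV[R]_n -> R) (c r0 : R) : (0 < n)%N -> 0 < c ->
  measurable_fun setT f -> (forall x, 0 <= f x) ->
  (forall x, 0 < nsq x -> r0 <= nsq x -> c * heat n (nsq x) <= f x) ->
  (\int[leb n]_x (f x)%:E = +oo)%E.
Proof.
move=> n0 c0 mf f0 H.
pose u (k : nat) : R := 2 ^+ k; have u0 k : 0 < u k by rewrite exprn_gt0.
pose Q k := [set v : 'rV[R]_n | forall i : 'I_n, `[u k, u k.+1[%classic (v ord0 i)].
have mQ k : measurable (Q k).
  rewrite (_ : Q k = \bigcap_(i : 'I_n)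
      ((fun v : 'rV[R]_n => v ord0 i) @^-1` `[u k, u k.+1[%classic)).
    apply: fin_bigcap_measurable => // i _.
    by rewrite -[X in measurable X]setTI; apply: measurable_coord_rV.
  by apply/seteqP; split => v /= vA i; [move=> _|]; exact: vA.
have QE k : (leb n (Q k) = (u k ^+ n)%:E)%E.
  rewrite /Q (lebesgue_rV_box (fun=> measurable_itv _)).
  under eq_bigr do rewrite lebesgue_measure_itv/= lte_fin ltr_eXn2l ?ltr1n// ltnSn.
  rewrite -EFinD (_ : u k.+1 - u k = u k); last by rewrite /u exprS; ring.
  by rewrite prodEFin prodr_const card_ord.
have [k0 hk0] : exists k, r0 <= u k.
  exists (Num.trunc r0).+1; apply: le_trans (ltW (truncnS_gt r0)) _.
  by rewrite /u -natrX ler_nat ltnW// ltn_expl.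
(* On the cube of side u one has u^2 <= |x|^2 <= 4 n u^2, so f is at least c (4 n)^(- n / 2) u^(-
   n), and the volume of the cube is u^n. *)
pose c1 := c * heat n (n%:R * 4).
have n0R : (0 : R) < n%:R by rewrite ltr0n.
have c10 : 0 < c1 by rewrite mulr_gt0// heat_gt0.
have Qf k : (c1%:E <= \int[leb n]_(x in Q (k0 + k)%N) (f x)%:E)%E.
  set j := (k0 + k)%N.
  apply: (@le_trans _ _ (\int[leb n]_(x in Q j) (c1 * (u j)^-1 ^+ n)%:E)%E).
    rewrite (integral_cst _ (mQ j)) [X in (_ <= _ * X)%E](QE j) -EFinM exprVn -mulrA mulVf ?mulr1//.
    by rewrite expf_neq0// gt_eqF.
  apply: ge0_le_integral => //.
  - by move=> x _; rewrite lee_fin mulr_ge0 ?exprn_ge0 ?invr_ge0 ?(ltW (u0 _)) ?(ltW c10).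
  - apply/measurable_EFinP; exact: measurable_funTS.
  move=> x Qx; rewrite lee_fin.
  have uj i : u j <= x ord0 i < 2 * u j.
    by have := Qx i; rewrite /= in_itv /= -exprS.
  have lo : u j ^+ 2 <= nsq x.
    apply: le_trans (nsq_coord x (Ordinal n0)); have /andP[h _] := uj (Ordinal n0).
    by rewrite lerXn2r ?nnegrE ?(ltW (u0 _))// (le_trans _ h)// ltW.
  have hi : nsq x <= n%:R * 4 * u j ^+ 2.
    rewrite -mulrA mulr_natl -[X in _ *+ X]card_ord -sumr_const /nsq; apply: ler_sum => i _.
    have /andP[h1 h2] := uj i; have := u0 j; nra.
  have p0 : 0 < nsq x by apply: lt_le_trans lo; rewrite exprn_gt0.
  apply: le_trans (H x p0 _).
    rewrite /c1 -mulrA; apply: ler_wpM2l; first exact: ltW.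
    rewrite -heat_sqr// -heatM ?mulr_gt0 ?exprn_gt0//.
    exact: heat_le.
  apply: le_trans lo; apply: le_trans hk0 _; apply: (@le_trans _ _ (u j)).
    by rewrite /u ler_eXn2l ?ltr1n// leq_addr.
  by rewrite expr2 ler_peMr ?(ltW (u0 _))// /u exprn_ege1// ler1n.
have dQ : trivIset setT (fun k => Q (k0 + k)%N).
  have D i j : (i < j)%N -> Q (k0 + i)%N `&` Q (k0 + j)%N = set0.
    move=> ij; apply/seteqP; split => // x [/(_ (Ordinal n0)) + /(_ (Ordinal n0))] /=.
    rewrite !in_itv /= => /andP[_ h1] /andP[h2 _].
    suff : u (k0 + i).+1 <= u (k0 + j)%N by have := le_lt_trans h2 h1; lra.
    by rewrite /u ler_eXn2l ?ltr1n// -addnS leq_add2l.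
  apply/trivIsetP => i j _ _; rewrite neq_ltn => /orP[] ij; first exact: D.
  by rewrite setIC; exact: D.
apply/eqyP => A A0.
have [N HN] : exists N : nat, A <= N%:R * c1.
  exists (Num.trunc (A / c1)).+1; rewrite -ler_pdivrMr//; exact: ltW (truncnS_gt _).
apply: (@le_trans _ _ (\int[leb n]_(x in \big[setU/set0]_(k <- iota 0 N) Q (k0 + k)%N) (f x)%:E)%E); last first.
  apply: ge0_subset_integral => //; first by apply: bigsetU_measurable.
    by apply/measurable_EFinP.
  by move=> x _; rewrite lee_fin.
rewrite (@ge0_integral_bigsetU _ _ _ _ _ (fun k => Q (k0 + k)%N) (fun x => (f x)%:E)) //.
- apply: (@le_trans _ _ (\sum_(k <- iota 0 N) c1%:E)%E); last exact: lee_sum.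
  by rewrite sumEFin lee_fin big_const_seq count_predT size_iota iter_addr addr0 -mulr_natl.
- exact: iota_uniq.
- exact: sub_trivIset dQ.
- by apply/measurable_EFinP; exact: measurable_funTS.
- by move=> x _; rewrite lee_fin.
Qed.

Lemma potential_powR_oo n m (b a r : R) : (0 < n)%N -> (0 < m)%N -> 0 < b -> b < 1 ->
  0 < a -> 0 < r -> r * (n%:R / 2 + m%:R - b) <= n%:R / 2 ->
  (\int[leb n]_x (`|potential m b a 0 x| `^ r)%:E = +oo)%E.
Proof.
move=> n0 m0 b0 b1 a0 r0 hr.
have [c c0 [rho rho1 H]] := potential0_low n b0 b1 m0 a0.
have bm : b < m%:R by rewrite (lt_le_trans b1)// ler1n.
have p0 := pi_gt0 R.
apply: (@ge0_integral_nsq_oo n _ (c `^ r * heat n pi) (rho / pi)) => //.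
- by rewrite mulr_gt0 ?powR_gt0// heat_gt0.
- by apply: meas_powR; apply: meas_norm; exact: meas_potential.
move=> x x0; rewrite ler_pdivrMr// mulrC => hx.
apply: (@le_trans _ _ ((c * expR (- ((n%:R / 2 + m%:R - b) * ln (pi * nsq x)))) `^ r)); last first.
  by apply: ge0_ler_powR; rewrite ?nnegrE ?(ltW r0)//; [rewrite mulr_ge0 ?expR_ge0 ?ltW|exact: H].
rewrite powRM ?expR_ge0 ?(ltW c0)// -mulrA -heatM//.
apply: ler_wpM2l; first exact: powR_ge0.
rewrite /powR gt_eqF ?expR_gt0// expRK /heat ler_expR.
have l0 : 0 <= ln (pi * nsq x) by rewrite ln_ge0// (le_trans rho1).
by have := ler_wpM2r l0 hr; lra.
Qed.

End divergence.

(** * Complex-valued functions and their norms *)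

Section complex_functions.
Context (R : realType).
Implicit Types (z w : R[i]).
Local Notation Re := complex.Re.
Local Notation Im := complex.Im.
Local Open Scope complex_scope.
Import ComplexField.Normc.

Lemma complex_ext z w : Re z = Re w -> Im z = Im w -> z = w.
Proof. by case: z w => [a b] [c d] /= -> ->. Qed.

Lemma cReM z w : Re (z * w) = Re z * Re w - Im z * Im w.
Proof. by case: z w => [a b] [c d]. Qed.

Lemma cImM z w : Im (z * w) = Re z * Im w + Im z * Re w.
Proof. by case: z w => [a b] [c d]. Qed.

Lemma cReMr (r : R) z : Re (r%:C * z) = r * Re z.
Proof. by rewrite cReM /= mul0r subr0. Qed.

Lemma cImMr (r : R) z : Im (r%:C * z) = r * Im z.
Proof. by rewrite cImM /= mul0r addr0. Qed.

Lemma cReD z w : Re (z + w) = Re z + Re w.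
Proof. by case: z w => [a b] [c d]. Qed.

Lemma cImD z w : Im (z + w) = Im z + Im w.
Proof. by case: z w => [a b] [c d]. Qed.

Lemma cRe_sum (I : Type) (s : seq I) (F : I -> R[i]) :
  Re (\sum_(i <- s) F i) = \sum_(i <- s) Re (F i).
Proof. exact: (big_morph _ cReD). Qed.

Lemma cIm_sum (I : Type) (s : seq I) (F : I -> R[i]) :
  Im (\sum_(i <- s) F i) = \sum_(i <- s) Im (F i).
Proof. exact: (big_morph _ cImD). Qed.

Lemma normcE z : normc z = Num.sqrt (Re z ^+ 2 + Im z ^+ 2).
Proof. by case: z. Qed.

Lemma normc_ge0 z : 0 <= normc z.
Proof. by rewrite normcE sqrtr_ge0. Qed.

Lemma sqr_normcE z : normc z ^+ 2 = Re z ^+ 2 + Im z ^+ 2.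
Proof. by rewrite normcE sqr_sqrtr// addr_ge0 ?sqr_ge0. Qed.

Lemma normcR (r : R) : normc r%:C = `|r|.
Proof. by rewrite normcE /= expr0n addr0 sqrtr_sqr. Qed.

Lemma normc_Re z : `|Re z| <= normc z.
Proof.
rewrite -(@ler_pXn2r _ 2) ?nnegrE ?normc_ge0// sqr_normcE real_normK ?num_real//.
by rewrite lerDl sqr_ge0.
Qed.

Lemma normc_Im z : `|Im z| <= normc z.
Proof.
rewrite -(@ler_pXn2r _ 2) ?nnegrE ?normc_ge0// sqr_normcE real_normK ?num_real//.
by rewrite lerDr sqr_ge0.
Qed.

Lemma normc_le z : normc z <= `|Re z| + `|Im z|.
Proof.
rewrite -(@ler_pXn2r _ 2) ?nnegrE ?normc_ge0 ?addr_ge0// sqr_normcE.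
rewrite sqrrD !real_normK ?num_real//.
by rewrite addrAC lerDl mulrn_wge0// mulr_ge0.
Qed.

Lemma normc_sum (I : Type) (s : seq I) (F : I -> R[i]) :
  normc (\sum_(i <- s) F i) <= \sum_(i <- s) normc (F i).
Proof.
elim: s => [|i s IH]; first by rewrite !big_nil normc0.
by rewrite !big_cons (le_trans (le_normcD _ _))// lerD2l.
Qed.

Lemma expiD (a b : R) : expi (a + b) = expi a * expi b.
Proof.
apply: complex_ext; first by rewrite cReM /= cosD.
by rewrite cImM /= sinD addrC [sin a * _]mulrC [cos a * _]mulrC addrC mulrC [sin b * _]mulrC.
Qed.

Lemma expi0 : expi 0 = 1 :> R[i].
Proof. by rewrite /expi cos0 sin0. Qed.

Lemma expiMn (a : R) k : expi (k%:R * a) = expi a ^+ k.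
Proof.
elim: k => [|k IH]; first by rewrite mul0r expr0 expi0.
by rewrite -natr1 mulrDl mul1r expiD IH exprSr.
Qed.

Lemma normc_expi (a : R) : normc (expi a) = 1.
Proof. by rewrite normcE /= cos2Dsin2 sqrtr1. Qed.

Lemma sin_cos (a : R) : sin a = cos (a + - (pi / 2)).
Proof. by rewrite cosB cos_pihalf sin_pihalf mulr0 add0r mulr1. Qed.

Lemma meas_normc d (T : measurableType d) (h : T -> R[i]) :
  measurable_fun setT (fun x => Re (h x)) -> measurable_fun setT (fun x => Im (h x)) ->
  measurable_fun setT (fun x => normc (h x)).
Proof.
move=> mr mi; under eq_fun do rewrite normcE.
apply: (@meas_continuous _ _ _ Num.sqrt); first exact: sqrt_continuous.
by apply: measD; exact: measX.
Qed.

Variable n : nat.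
Local Notation leb := (lebesgue_rV R n).

Lemma cintegral_sum (I : Type) (s : seq I) (a : I -> R) (h : I -> 'rV[R]_n -> R[i]) :
  (forall i, cintegrable (h i)) ->
  cintegrable (fun x => \sum_(i <- s) (a i)%:C * h i x) /\
  cintegral (fun x => \sum_(i <- s) (a i)%:C * h i x) = \sum_(i <- s) (a i)%:C * cintegral (h i).
Proof.
move=> ih; rewrite /cintegrable /cintegral.
have r1 i := integrableZ (a i) (ih i).1; have r2 i := integrableZ (a i) (ih i).2.
rewrite (_ : (fun x => (Re _)%:E) = EFin \o (fun x => \sum_(i <- s) (a i * Re (h i x)))); last first.
  by apply/funext => x /=; rewrite cRe_sum; congr EFin; apply: eq_bigr => i _; rewrite cReMr.
rewrite (_ : (fun x => (Im _)%:E) = EFin \o (fun x => \sum_(i <- s) (a i * Im (h i x)))); last first.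
  by apply/funext => x /=; rewrite cIm_sum; congr EFin; apply: eq_bigr => i _; rewrite cImMr.
split; first by split; apply: integrable_sumr.
apply: complex_ext; rewrite /= ?cRe_sum ?cIm_sum.
  transitivity (\int[leb]_x (\sum_(i <- s) (a i * Re (h i x)))).
    by apply: eq_Rintegral => x _; rewrite cRe_sum; apply: eq_bigr => i _; rewrite cReMr.
  rewrite Rintegral_sum//; apply: eq_bigr => i _.
  by rewrite cReMr /= (RintegralZl _ measurableT (ih i).1).
transitivity (\int[leb]_x (\sum_(i <- s) (a i * Im (h i x)))).
  by apply: eq_Rintegral => x _; rewrite cIm_sum; apply: eq_bigr => i _; rewrite cImMr.
rewrite Rintegral_sum//; apply: eq_bigr => i _.
by rewrite cImMr /= (RintegralZl _ measurableT (ih i).2).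
Qed.

Lemma LpnormE p (h : 'rV[R]_n -> R[i]) : p != 0 ->
  Lpnorm p h = ((\int[leb]_x (normc (h x) `^ p)%:E) `^ p^-1)%E.
Proof.
move=> p0; rewrite /Lpnorm unlock; congr poweR; apply: eq_integral => x _.
by rewrite /= ger0_norm ?normc_ge0.
Qed.

Definition wgtnorm (p : R) := fine (\int[leb]_x (wgt x `^ p)%:E) `^ p^-1.

Lemma Lpnorm_le p (h : 'rV[R]_n -> R[i]) K : 1 < p -> 0 <= K ->
  (forall x, normc (h x) <= K * wgt x) -> (Lpnorm p h <= (K * wgtnorm p)%:E)%E.
Proof.
move=> p1 K0 H; have p0 : 0 < p by apply: lt_trans p1.
have ii := integrable_wgt n p1; have w0 (x : 'rV[R]_n) := wgt_gt0 x.
rewrite LpnormE ?gt_eqF//.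
have -> : (K * wgtnorm p)%:E = ((\int[leb]_x ((K * wgt x) `^ p)%:E) `^ p^-1)%E.
  under eq_integral do rewrite powRM ?(ltW (w0 _))// EFinM.
  rewrite integralZl// -(ge0_integral_fin ii) -?EFinM ?poweR_EFin//; congr EFin.
  rewrite powRM ?powR_ge0//; last first.
    by apply: Rintegral_ge0 => x _; exact: powR_ge0.
  by rewrite -powRrM mulfV ?gt_eqF// powRr1.
apply: gt0_ler_poweR; rewrite ?invr_ge0 ?(ltW p0)// ?in_itv/= ?leey ?andbT.
- by apply: integral_ge0 => x _; rewrite lee_fin powR_ge0.
- by apply: integral_ge0 => x _; rewrite lee_fin powR_ge0.
apply: ge0_le_integralT => x; first by rewrite lee_fin powR_ge0.
rewrite lee_fin; apply: ge0_ler_powR; rewrite ?nnegrE ?(ltW p0) ?normc_ge0//.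
by rewrite mulr_ge0// ltW.
Qed.

Lemma LpnormZ p z (h : 'rV[R]_n -> R[i]) : 0 < p ->
  measurable_fun setT (fun x => normc (h x)) ->
  Lpnorm p (fun x => z * h x) = ((normc z)%:E * Lpnorm p h)%E.
Proof.
move=> p0 mh; rewrite !LpnormE ?gt_eqF//.
under eq_integral do rewrite normcM powRM ?normc_ge0// EFinM.
rewrite ge0_integralZl ?lee_fin ?powR_ge0//; last 2 first.
- by apply/measurable_EFinP; exact: meas_powR.
- by move=> x _; rewrite lee_fin powR_ge0.
rewrite poweRM ?lee_fin ?powR_ge0//; last first.
  by apply: integral_ge0 => x _; rewrite lee_fin powR_ge0.
by rewrite poweR_EFin -powRrM mulfV ?gt_eqF// powRr1 ?normc_ge0.
Qed.

Lemma Lpnorm_dilate p (e : R) (h : 'rV[R]_n -> R[i]) : 0 < p -> 0 < e ->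
  measurable_fun setT (fun x => normc (h x)) ->
  Lpnorm p (fun x => h (e *: x)) = ((e `^ (- (n%:R / p)))%:E * Lpnorm p h)%E.
Proof.
move=> p0 e0 mh; rewrite !LpnormE ?gt_eqF//.
have m1 : measurable_fun setT (fun x => (normc (h x) `^ p)%:E).
  by apply/measurable_EFinP; exact: meas_powR.
rewrite (ge0_integral_rV_affine 0 e0 m1); last by move=> x; rewrite lee_fin powR_ge0.
under [in RHS]eq_integral do rewrite addr0.
set J := (\int[_]_x _)%E.
have J0 : (0 <= J)%E by apply: integral_ge0 => x _; rewrite lee_fin powR_ge0.
rewrite poweRM ?lee_fin ?exprn_ge0 ?(ltW e0)// muleA poweR_EFin -EFinM.
rewrite -powR_mulrn ?(ltW e0)// -powRrM -powRD; last by rewrite (gt_eqF e0) implybT.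
rewrite addNr.
by rewrite powRr0 mul1e.
Qed.

End complex_functions.

(** * Modulated Gaussians and Schwartz functions *)

Section continuity.
Context (R : realType) (T : topologicalType).
Implicit Types f g : T -> R.

Lemma cont_cst (c : R) : continuous (fun _ : T => c).
Proof. by move=> x; exact: cvg_cst. Qed.

Lemma contD f g : continuous f -> continuous g -> continuous (fun x => f x + g x).
Proof. by move=> cf cg x; exact: cvgD (cf x) (cg x). Qed.

Lemma contB f g : continuous f -> continuous g -> continuous (fun x => f x - g x).
Proof. by move=> cf cg x; exact: cvgB (cf x) (cg x). Qed.

Lemma contN f : continuous f -> continuous (fun x => - f x).
Proof. by move=> cf x; exact: cvgN (cf x). Qed.

Lemma contM f g : continuous f -> continuous g -> continuous (fun x => f x * g x).
Proof. by move=> cf cg x; exact: cvgM (cf x) (cg x). Qed.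

Lemma cont_comp (h : R -> R) f : continuous h -> continuous f -> continuous (fun x => h (f x)).
Proof. by move=> ch cf x; exact: (cvg_comp _ _ (cf x) (ch (f x))). Qed.

Lemma cont_sum I (s : seq I) (F : I -> T -> R) : (forall i, continuous (F i)) ->
  continuous (fun x => \sum_(i <- s) F i x).
Proof.
move=> cF; elim: s => [|i s IH].
  by under eq_fun do rewrite big_nil; exact: cont_cst.
by under eq_fun do rewrite big_cons; exact: contD.
Qed.

End continuity.

Section modulated_gaussians.
Context (R : realType) (n : nat).
Implicit Types (x v c xi : 'rV[R]_n).
Local Notation Re := complex.Re.
Local Notation Im := complex.Im.
Local Notation leb := (lebesgue_rV R n).
Local Open Scope complex_scope.
Import ComplexField.Normc.

Lemma dotpC x xi : dotp x xi = dotp xi x.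
Proof. by apply: eq_bigr => i _; rewrite mulrC. Qed.

Lemma dotpDr x v xi : dotp x (v + xi) = dotp x v + dotp x xi.
Proof. by rewrite /dotp -big_split/=; apply: eq_bigr => i _; rewrite mxE mulrDr. Qed.

Lemma dotpNr x v : dotp x (- v) = - dotp x v.
Proof. by rewrite /dotp -sumrN; apply: eq_bigr => i _; rewrite mxE mulrN. Qed.

Lemma dotpZr (a : R) x v : dotp x (a *: v) = a * dotp x v.
Proof. by rewrite /dotp mulr_sumr; apply: eq_bigr => i _; rewrite mxE mulrCA. Qed.

Lemma nsq_dotp x : nsq x = dotp x x.
Proof. by apply: eq_bigr => i _; rewrite expr2. Qed.

Lemma nsqD x v : nsq (x + v) = nsq x + 2 * dotp x v + nsq v.
Proof.
rewrite !nsq_dotp !(dotpDr, dotpC (x + v)) (dotpC v x); ring.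
Qed.

Lemma nsqZ (a : R) x : nsq (a *: x) = a ^+ 2 * nsq x.
Proof. by rewrite !nsq_dotp dotpZr dotpC dotpZr expr2 mulrA. Qed.

Lemma nsqN x : nsq (- x) = nsq x.
Proof. by apply: eq_bigr => i _; rewrite mxE sqrrN. Qed.

Lemma nsq0 : nsq (0 : 'rV[R]_n) = 0.
Proof. by rewrite /nsq big1// => i _; rewrite mxE expr0n. Qed.

Lemma nsq_eq0 x : nsq x = 0 -> x = 0.
Proof.
move=> /eqP; rewrite psumr_eq0 => [/allP h|i _]; last exact: sqr_ge0.

apply/rowP => i; rewrite mxE; apply/eqP; rewrite -sqrf_eq0.
exact: h (mem_index_enum _).
Qed.

Definition modgauss (t : R) v c : 'rV[R]_n -> R[i] :=
  fun x => (expR (- (pi * t * nsq (x - v))))%:C * expi (2 * pi * dotp c x).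

Lemma gauss_cos_translate t v y th : 0 < t ->
  leb.-integrable setT (EFin \o (fun x =>
    expR (- (pi * t * nsq (x - v))) * cos (2 * pi * dotp y x + th))) /\
  \int[leb]_x (expR (- (pi * t * nsq (x - v))) * cos (2 * pi * dotp y x + th)) =
  heat n t * expR (- (pi * nsq y / t)) * cos (2 * pi * dotp y v + th).
Proof.
move=> t0; pose F x := expR (- (pi * t * nsq x)) *
  cos (2 * pi * dotp y x + (2 * pi * dotp y v + th)).
have iF : leb.-integrable setT (EFin \o F).
  apply: (@integrable_gauss_cos _ _ _ _ 0 1) => //.
    apply: meas_cos; apply: measD; last exact: measurable_cst.
    by apply: measM; [exact: measurable_cst|exact: meas_dotp].
  by move=> z; rewrite expr0 mulr1 cos_max.
have E x : F (1 *: x - v) = expR (- (pi * t * nsq (x - v))) * cos (2 * pi * dotp y x + th).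
  by rewrite /F scale1r; congr (_ * cos _); rewrite dotpDr dotpNr; ring.
have [i1 i2] := Rintegral_rV_affine (- v) ltr01 iF.
split; first by apply: eq_integrable i1 => // x _; rewrite /= E.
transitivity (\int[leb]_x F x); last exact: gauss_cos.
by rewrite i2 expr1n mul1r; apply: eq_Rintegral => x _; rewrite E.
Qed.

Lemma modgauss_fourierE t v c xi x :
  modgauss t v c x * expi (- (2 * pi * dotp x xi)) =
  (expR (- (pi * t * nsq (x - v))))%:C * expi (2 * pi * dotp (c - xi) x).
Proof.
rewrite /modgauss -mulrA -expiD; congr (_ * expi _).
by rewrite (dotpC (c - xi)) dotpDr dotpNr (dotpC c); ring.
Qed.

Lemma cintegrable_modgauss t v c xi : 0 < t ->
  cintegrable (fun x => modgauss t v c x * expi (- (2 * pi * dotp x xi))).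
Proof.
move=> t0; split.
- have [h _] := gauss_cos_translate v (c - xi) 0 t0.
  by apply: eq_integrable h => // x _; rewrite modgauss_fourierE cReMr /= addr0.
- have [h _] := gauss_cos_translate v (c - xi) (- (pi / 2)) t0.
  by apply: eq_integrable h => // x _; rewrite modgauss_fourierE cImMr /= sin_cos.
Qed.

Lemma fourier_modgauss t v c xi : 0 < t ->
  fourier (modgauss t v c) xi =
  (heat n t * expR (- (pi * nsq (xi - c) / t)))%:C * expi (2 * pi * dotp (c - xi) v).
Proof.
move=> t0; rewrite -nsqN opprB; apply: complex_ext; rewrite ?cReMr ?cImMr.
- have [_ h] := gauss_cos_translate v (c - xi) 0 t0; rewrite addr0 in h; rewrite -h.
  by apply: eq_Rintegral => x _; rewrite modgauss_fourierE cReMr /= addr0.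
- have [_ h] := gauss_cos_translate v (c - xi) (- (pi / 2)) t0.
  rewrite [Im (expi _)]sin_cos -h.
  by apply: eq_Rintegral => x _; rewrite modgauss_fourierE cImMr /= sin_cos.
Qed.

Lemma modgaussM t v c t' v' c' w x : t + t' != 0 -> (t + t') *: w = t *: v + t' *: v' ->
  modgauss t v c x * modgauss t' v' c' x =
  (expR (- (pi * (t * t' / (t + t')) * nsq (v - v'))))%:C * modgauss (t + t') w (c + c') x.
Proof.
move=> t0 wE; rewrite /modgauss mulrACA -expiD [RHS]mulrA; congr (_ * expi _); last first.
  by rewrite (dotpC (c + c')) dotpDr !(dotpC x); ring.
rewrite -!rmorphM/= -!expRD; congr (expR _)%:C.
have -> : w = (t + t')^-1 *: (t *: v + t' *: v') by rewrite -wE scalerA mulVf// scale1r.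
rewrite !nsqD !nsqN !dotpNr !nsqZ !nsqD !nsqZ !(dotpZr, dotpDr) ![dotp (t *: _) _]dotpC !dotpZr.
rewrite (dotpC v' v).
move: (pi) (nsq x) (nsq v) (nsq v') (dotp x v) (dotp x v') (dotp v v') => *.
by field.
Qed.

Lemma normc_modgauss t v c x : normc (modgauss t v c x) = expR (- (pi * t * nsq (x - v))).
Proof. by rewrite normcM normc_expi mulr1 normcR ger0_norm ?expR_ge0. Qed.

(** The constant does not depend on the frequency [c], which keeps the norms of f and g bounded
    while their frequencies tend to infinity. *)
Lemma modgauss_bound t v K : 0 < t -> exists2 C, 0 < C & forall c x,
  (1 + nsq x) ^+ K * normc (modgauss t v c x) <= C * wgt x.
Proof.
move=> t0; have c0 : 0 < pi * t / 2 by rewrite divr_gt0 ?mulr_gt0 ?pi_gt0.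
have [C C0 H] := exp_wgt_bound n K c0.
exists (expR (pi * t * nsq v) * C); first by rewrite mulr_gt0 ?expR_gt0.
move=> c x; rewrite normc_modgauss.
apply: (@le_trans _ _ (expR (pi * t * nsq v) * ((1 + nsq x) ^+ K * expR (- (pi * t / 2 * nsq x))))); last first.
  rewrite -[leRHS]mulrA; apply: ler_wpM2l; first exact: expR_ge0.
  apply: le_trans (H x) _; apply: ler_wpM2l; [exact: ltW|exact: wgt2_le].
rewrite mulrCA -expRD; apply: ler_wpM2l; first by rewrite exprn_ge0// addr_ge0// nsq_ge0.
rewrite ler_expR.
(* The difference of the two sides is |x - 2 v|^2 / 2. *)
have h : nsq x / 2 <= nsq (x - v) + nsq v.
  have := nsq_ge0 (x - 2 *: v); rewrite !nsqD !nsqN nsqZ !dotpNr dotpZr; lra.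
have := ler_wpM2l (ltW (mulr_gt0 (pi_gt0 R) t0)) h; move: (pi * t) => p.
lra.
Qed.

(* Directional derivatives are taken along lines, which reduces them to the
   one-variable calculus. *)
Definition has_partial (F : 'rV[R]_n -> R) (i : 'I_n) x (a : R) :=
  hasder (fun h => F (h *: delta_mx ord0 i + x)) 0 a.

Lemma has_partialP F i x a : has_partial F i x a ->
  derivable F x (delta_mx ord0 i) /\ 'D_(delta_mx ord0 i) F x = a.
Proof.
move=> [h1 h2].
have E : (fun h => h^-1 *: ((F \o shift x) (h *: delta_mx ord0 i) - F x)) =
    (fun h : R => h^-1 *: (((fun h => F (h *: delta_mx ord0 i + x)) \o shift 0) (h *: 1) - F (0 *: delta_mx ord0 i + x))).
  by apply/funext => h /=; rewrite addr0 scale0r add0r [h *: 1]mulr1.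
by rewrite /derivable /derive E; split.
Qed.

Lemma dotp_delta (y : 'rV[R]_n) i : dotp y (delta_mx ord0 i) = y ord0 i.
Proof.
rewrite /dotp (bigD1 i)//= mxE !eqxx mulr1 big1 ?addr0// => j ji.
by rewrite mxE (negbTE ji) andbF mulr0.
Qed.

Lemma nsq_delta i : nsq (delta_mx ord0 i : 'rV[R]_n) = 1.
Proof. by rewrite nsq_dotp dotp_delta mxE !eqxx. Qed.

Lemma has_partial_mg t v c i x th :
  has_partial (fun x => expR (- (pi * t * nsq (x - v))) * cos (2 * pi * dotp c x + th)) i x
   (expR (- (pi * t * nsq (x - v))) * (- (2 * pi * t * (x ord0 i - v ord0 i)) * cos (2 * pi * dotp c x + th)
     - 2 * pi * c ord0 i * sin (2 * pi * dotp c x + th))).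
Proof.
have dE y (h : R) : dotp y (h *: delta_mx ord0 i + x) = h * y ord0 i + dotp y x.
  by rewrite dotpDr dotpZr dotp_delta.
have nE (h : R) : nsq (h *: delta_mx ord0 i + x - v) =
    nsq (x - v) + 2 * h * (x ord0 i - v ord0 i) + h ^+ 2.
  rewrite -addrA [LHS]nsqD nsqZ nsq_delta dotpC dotpZr dotp_delta !mxE; ring.
rewrite /has_partial; under eq_fun do rewrite nE dE.
apply: derE; first by dtac.
rewrite !(mulr0, mul0r, expr0n, addr0, add0r) /=.
move: (expR (- (pi * t * nsq (x - v)))) (cos (2 * pi * dotp c x + th)) (sin (2 * pi * dotp c x + th)) (pi) => E C S p; ring.
Qed.

(** Coordinates times modulated Gaussians, closed under linear combinations, hence stable under
    partial derivatives. Differentiability, continuity and decay of all iterated derivatives then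
    reduce to one induction each. *)
Inductive gauss_class (t : R) : ('rV[R]_n -> R[i]) -> Prop :=
| gauss_class_mg v c : gauss_class t (modgauss t v c)
| gauss_class_coord i f : gauss_class t f -> gauss_class t (fun x => (x ord0 i)%:C * f x)
| gauss_classZ z f : gauss_class t f -> gauss_class t (fun x => z * f x)
| gauss_classD f g : gauss_class t f -> gauss_class t g -> gauss_class t (fun x => f x + g x).

Lemma gauss_class_sum t I (s : seq I) (F : I -> 'rV[R]_n -> R[i]) :
  (forall i, gauss_class t (F i)) -> gauss_class t (fun x => \sum_(i <- s) F i x).
Proof.
move=> h; elim: s => [|i s IH].
  rewrite (_ : (fun x => _) = (fun x => 0 * modgauss t 0 0 x)).
    by apply: gauss_classZ; exact: gauss_class_mg.
  by apply/funext => x; rewrite big_nil mul0r.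
rewrite (_ : (fun x => _) = (fun x => F i x + \sum_(j <- s) F j x)).
  exact: gauss_classD.
by apply/funext => x; rewrite big_cons.
Qed.

Lemma gauss_class_partial t f : gauss_class t f -> forall i, exists2 f', gauss_class t f' &
  forall x, has_partial (fun x => Re (f x)) i x (Re (f' x)) /\
            has_partial (fun x => Im (f x)) i x (Im (f' x)).
Proof.
elim => {f} [v c i|j f gf IH i|z f gf IH i|f g gf IHf gg IHg i].
- exists (fun x => (- (2 * pi * t))%:C * ((x ord0 i)%:C * modgauss t v c x) +
    ((2 * pi * t * v ord0 i) +i* (2 * pi * c ord0 i)) * modgauss t v c x).
    apply: gauss_classD; apply: gauss_classZ; last exact: gauss_class_mg.
    by apply: gauss_class_coord; exact: gauss_class_mg.
  move=> x; split.
    have := has_partial_mg t v c i x 0; rewrite /modgauss.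
    under eq_fun do rewrite addr0.
    rewrite addr0 => h; under eq_fun do rewrite cReMr /=.
    apply: derE h _; rewrite /= .
    by move: (expR (- (pi * t * nsq (x - v)))) (cos (2 * pi * dotp c x)) (sin (2 * pi * dotp c x)) (pi) => E C S p; ring.
  have := has_partial_mg t v c i x (- (pi / 2)); rewrite /modgauss.
  under eq_fun do rewrite -sin_cos.
  rewrite -sin_cos => h; under eq_fun do rewrite cImMr /=.
  apply: derE h _; rewrite /= sinB cos_pihalf sin_pihalf.
    by move: (expR (- (pi * t * nsq (x - v)))) (cos (2 * pi * dotp c x)) (sin (2 * pi * dotp c x)) (pi) => E C S p; ring.
- have [f' gf' H] := IH i.
  exists (fun x => (j == i)%:R * f x + (x ord0 j)%:C * f' x).
    apply: gauss_classD; first exact: gauss_classZ.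
    exact: gauss_class_coord.
  have hx x : has_partial (fun x => x ord0 j) i x (j == i)%:R.
    rewrite /has_partial; under eq_fun do rewrite !mxE eqxx /=.
    by apply: derE; [dtac|rewrite mul1r mulr0 !addr0].
  have e : ((j == i)%:R : R[i]) = ((j == i)%:R)%:C by case: (j == i).
  move=> x; have [h1 h2] := H x; rewrite e; split.
    under eq_fun do rewrite cReMr.
    apply: derE; first exact: derM (hx x) h1.
    by rewrite /= scale0r add0r cReD !cReMr.
  under eq_fun do rewrite cImMr.
  apply: derE; first exact: derM (hx x) h2.
  by rewrite /= scale0r add0r cImD !cImMr.
- have [f' gf' H] := IH i; exists (fun x => z * f' x); first exact: gauss_classZ.
  move=> x; have [h1 h2] := H x; split.
    under eq_fun do rewrite cReM.
    apply: derE; first exact: derB (derM (derC (Re z) 0) h1) (derM (derC (Im z) 0) h2).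
    by rewrite cReM !mul0r !add0r.
  under eq_fun do rewrite cImM.
  apply: derE; first exact: derD (derM (derC (Re z) 0) h2) (derM (derC (Im z) 0) h1).
  by rewrite cImM !mul0r !add0r.
- have [f' gf' Hf] := IHf i; have [g' gg' Hg] := IHg i.
  exists (fun x => f' x + g' x); first exact: gauss_classD.
  move=> x; have [h1 h2] := Hf x; have [h3 h4] := Hg x; split.
    under eq_fun do rewrite cReD.
    by rewrite cReD; exact: derD.
  under eq_fun do rewrite cImD.
  by rewrite cImD; exact: derD.
Qed.

Let continuous_coord i : continuous (fun x : 'rV[R]_n => x ord0 i).
Proof. exact: coord_continuous. Qed.

Let continuous_dotp c : continuous (fun x => dotp c x).
Proof.
apply: cont_sum => i; apply: contM; first exact: cont_cst.
exact: continuous_coord.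
Qed.

Let continuous_nsq v : continuous (fun x => nsq (x - v)).
Proof.
apply: cont_sum => i; rewrite (_ : (fun x => _) = (fun x => (x ord0 i - v ord0 i) * (x ord0 i - v ord0 i))).
  by apply: contM; apply: contB; [exact: continuous_coord|exact: cont_cst|exact: continuous_coord|exact: cont_cst].
by apply/funext => x; rewrite !mxE expr2.
Qed.

Let continuous_mg t v c th : continuous (fun x =>
  expR (- (pi * t * nsq (x - v))) * cos (2 * pi * dotp c x + th)).
Proof.
apply: contM.
  apply: (cont_comp (@continuous_expR R)); apply: contN; apply: contM; first exact: cont_cst.
  exact: continuous_nsq.
apply: (cont_comp (@continuous_cos R)); apply: contD; last exact: cont_cst.
by apply: contM; [exact: cont_cst|exact: continuous_dotp].
Qed.

Lemma gauss_class_continuous t f : gauss_class t f ->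
  continuous (fun x => Re (f x)) /\ continuous (fun x => Im (f x)).
Proof.
elim => {f} [v c|j f gf [h1 h2]|z f gf [h1 h2]|f g gf [h1 h2] gg [h3 h4]].
- split.
    rewrite (_ : (fun x => _) = (fun x =>
      expR (- (pi * t * nsq (x - v))) * cos (2 * pi * dotp c x + 0))).
      exact: continuous_mg.
    by apply/funext => y; rewrite cReMr addr0.
  rewrite (_ : (fun x => _) = (fun x =>
    expR (- (pi * t * nsq (x - v))) * cos (2 * pi * dotp c x + - (pi / 2)))).
    exact: continuous_mg.
  by apply/funext => y; rewrite cImMr /= sin_cos.
- split.
    under eq_fun do rewrite cReMr.
    by apply: contM; [exact: continuous_coord|exact: h1].
  under eq_fun do rewrite cImMr.
  by apply: contM; [exact: continuous_coord|exact: h2].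
- split.
    under eq_fun do rewrite cReM.
    by apply: contB; apply: contM => //; exact: cont_cst.
  under eq_fun do rewrite cImM.
  by apply: contD; apply: contM => //; exact: cont_cst.
- split.
    by under eq_fun do rewrite cReD; exact: contD.
  by under eq_fun do rewrite cImD; exact: contD.
Qed.

Lemma gauss_class_bound t f K : 0 < t -> gauss_class t f -> exists2 C, 0 < C &
  forall x, (1 + nsq x) ^+ K * normc (f x) <= C.
Proof.
move=> t0 gf; elim: gf K => {f} [v c|j f gf IH|z f gf IH|f g gf IHf gg IHg] K.
- have [C C0 H] := modgauss_bound v K t0; exists C => // x.
  apply: le_trans (H c x) _; rewrite ler_piMr ?(ltW C0)//; exact: wgt_le1.
- have [C C0 H] := IH K.+1; exists C => // x; apply: le_trans (H x).
  rewrite normcM normcR mulrA exprSr; apply: ler_wpM2r; first exact: normc_ge0.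
  apply: ler_wpM2l; first by rewrite exprn_ge0// addr_ge0 ?nsq_ge0.
  have := nsq_coord x j; rewrite -real_normK ?num_real//.
  by have := normr_ge0 (x ord0 j); nra.
- have [C C0 H] := IH K; exists (normc z * C + 1).
    by rewrite ltr_wpDl// mulr_ge0 ?normc_ge0 ?ltW.
  move=> x; rewrite normcM mulrCA; have := ler_wpM2l (normc_ge0 z) (H x); lra.
- have [C C0 H] := IHf K; have [D D0 L] := IHg K; exists (C + D); first exact: addr_gt0.
  move=> x; have := lerD (H x) (L x); rewrite -mulrDr; apply: le_trans.
  apply: ler_wpM2l; first by rewrite exprn_ge0// addr_ge0 ?nsq_ge0.
  exact: le_normcD.
Qed.

Lemma gauss_class_partials t f a : gauss_class t f -> gauss_class t (partials a f).
Proof.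
move=> gf; elim: a => [//|i a IH] /=.
have [f' gf' H] := gauss_class_partial IH i.
suff -> : partial i (partials a f) = f' by [].
apply/funext => x; have [/has_partialP[_ h1] /has_partialP[_ h2]] := H x.
by rewrite /partial h1 h2; case: (f' x).
Qed.

Lemma gauss_class_schwartz t f : 0 < t -> gauss_class t f -> schwartz f.
Proof.
move=> t0 gf; split => [a|b a].
  have ga := gauss_class_partials a gf; have [c1 c2] := gauss_class_continuous ga.
  split => // i x; have [f' _ H] := gauss_class_partial ga i.
  by have [/has_partialP[? _] /has_partialP[? _]] := H x.
have ga := gauss_class_partials a gf.
have [C C0 H] := gauss_class_bound (\sum_(i < n) b i) t0 ga.
exists C => x; apply: le_trans (H x); apply: ler_wpM2r; first exact: normc_ge0.
rewrite normr_prod expr_sum; apply: ler_prod => i _.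
rewrite normr_ge0/= normrX; apply: lerXn2r; rewrite ?nnegrE ?addr_ge0 ?nsq_ge0//.
have := nsq_coord x i; rewrite -real_normK ?num_real//.
by have := normr_ge0 (x ord0 i); nra.
Qed.

End modulated_gaussians.

(** * Failure for positive order *)

Section symbols.
Context (R : realType) (n : nat).
Local Notation Re := complex.Re.
Local Notation Im := complex.Im.
Local Notation leb := (lebesgue_rV R n).
Local Open Scope complex_scope.
Import ComplexField.Normc.

(* [pi^(- s / 2) (d + pi |xi|^2)^(s / 2)] is the symbol of [D^s] for [d = 0],
   and that of [J^s] for [d = pi]. *)
Definition symb (d s : R) (xi : 'rV[R]_n) : R :=
  pi `^ (- (s / 2)) * (d + pi * nsq xi) `^ (s / 2).

Let pi_scale s (u : R) : 0 <= u -> pi `^ (- (s / 2)) * (pi * u) `^ (s / 2) = u `^ (s / 2).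
Proof.
move=> u0; rewrite powRM ?pi_ge0// mulrA -powRD; last by apply/implyP => _; rewrite gt_eqF ?pi_gt0.
by rewrite addNr powRr0 mul1r.
Qed.

Lemma DsymbolE s : Dsymbol s = symb 0 s.
Proof.
apply/funext => xi; rewrite /symb add0r pi_scale ?nsq_ge0// /Dsymbol /enorm.
rewrite -[Num.sqrt _]powR12_sqrt ?nsq_ge0// -powRrM.
by rewrite [2^-1 * s]mulrC.
Qed.

Lemma JsymbolE s : Jsymbol s = symb pi s.
Proof.
apply/funext => xi; rewrite /symb /Jsymbol /enorm sqr_sqrtr ?nsq_ge0//.
have -> : pi + pi * nsq xi = pi * (1 + nsq xi) by rewrite mulrDr mulr1.
by rewrite pi_scale// addr_ge0 ?nsq_ge0.
Qed.

Lemma meas_symb d s : measurable_fun setT (symb d s).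
Proof.
apply: measM; first exact: measurable_cst.
apply: meas_powR; apply: measD; first exact: measurable_cst.
by apply: measM; [exact: measurable_cst|exact: meas_nsq].
Qed.

(** The terms are ordered as in the inequality for D^s. That for J^s has the operator on the other
    factor of each term, and follows by exchanging the two pairs of exponents. *)
Definition fails (d s p1 q1 p2 q2 r : R) := forall C : R,
  exists f g : 'rV[R]_n -> R[i],
  [/\ schwartz f /\ schwartz g,
      [/\ fmultiplier_defined (symb d s) f, fmultiplier_defined (symb d s) g &
          fmultiplier_defined (symb d s) (fun x => f x * g x)] &
      (C%:E * (Lpnorm p1 (fmultiplier (symb d s) f) * Lpnorm q1 g +
               Lpnorm p2 f * Lpnorm q2 (fmultiplier (symb d s) g)) <
       Lpnorm r (fmultiplier (symb d s) (fun x => f x * g x)%R))%E].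

Lemma fatou_bound (f_ : nat -> 'rV[R]_n -> R) (f : 'rV[R]_n -> R) (B : \bar R) :
  (forall k, measurable_fun setT (f_ k)) -> (forall k x, 0 <= f_ k x) ->
  (forall x, f_ k x @[k --> \oo] --> f x) ->
  (forall k, \int[leb]_x (f_ k x)%:E <= B)%E -> (\int[leb]_x (f x)%:E <= B)%E.
Proof.
move=> mf f0 cf fB.
have mE k : measurable_fun setT (fun x => (f_ k x)%:E) by apply/measurable_EFinP.
have := @fatou _ _ _ leb setT measurableT (fun k x => (f_ k x)%:E) mE (fun k x _ => f0 k x).
rewrite (_ : (fun x => limn_einf _) = (fun x => (f x)%:E)); last first.
  apply/funext => x; apply: (cvg_limn_einf_sup _).1.
  by apply: cvg_EFin; [exact: nearW|exact: cf].
move=> h; apply: (le_trans h); rewrite limn_einf_lim.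
apply: lime_le; first exact: is_cvg_einfs.
by apply: nearW => k; apply: le_trans (fB k); apply: ereal_inf_lbound; exists k => /=.
Qed.

(** Common form of both constructions: a Gaussian gives a single term, a train gives one term per
    translate. The operator is thereby reduced to real cosine integrals with a phase. *)
Lemma fmultiplier_phase (mult : 'rV[R]_n -> R) (f : 'rV[R]_n -> R[i]) N
    (c : 'I_N -> R) (v : 'I_N -> 'rV[R]_n) (F : 'rV[R]_n -> R) :
  leb.-integrable setT (EFin \o F) ->
  (forall xi, (mult xi)%:C * fourier f xi =
     \sum_(l < N) (c l)%:C * ((F xi)%:C * expi (- (2 * pi * dotp (v l) xi)))) ->
  fmultiplier_defined mult f /\
  forall x, fmultiplier mult f x = \sum_(l < N) (c l)%:C *
     ((\int[leb]_xi (F xi * cos (2 * pi * dotp (x - v l) xi + 0))) +i*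
      (\int[leb]_xi (F xi * cos (2 * pi * dotp (x - v l) xi + - (pi / 2))))).
Proof.
move=> iF E.
have iC y th : leb.-integrable setT (EFin \o (fun xi => F xi * cos (2 * pi * dotp y xi + th))).
  apply: (@integrable_le _ _ _ leb _ (fun xi => `|F xi|)).
  - apply: measM; first exact: measurable_of_integrable iF.
    apply: meas_cos; apply: measD; last exact: measurable_cst.
    by apply: measM; [exact: measurable_cst|exact: meas_dotp].
  - by move=> xi; rewrite normrM ler_piMr// cos_max.
  - exact: integrable_norm iF.
have P y xi : (F xi)%:C * expi (2 * pi * dotp y xi) =
    (F xi * cos (2 * pi * dotp y xi + 0)) +i* (F xi * cos (2 * pi * dotp y xi + - (pi / 2))).
  by apply: complex_ext; rewrite ?cReMr ?cImMr /= ?addr0// sin_cos.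
have ci y : cintegrable (fun xi => (F xi)%:C * expi (2 * pi * dotp y xi)).
  split; [have h := iC y 0|have h := iC y (- (pi / 2))];
    by apply: eq_integrable h => // xi _; rewrite P.
have dN (y z : 'rV[R]_n) : - (2 * pi * dotp y z) = 2 * pi * dotp (- y) z :> R.
  by rewrite (dotpC (- y)) dotpNr mulrN dotpC.
split.
  rewrite /fmultiplier_defined; under eq_fun do rewrite E.
  apply: (cintegral_sum _ _ _).1 => l.
  by under eq_fun do rewrite dN; exact: ci.
move=> x; rewrite /fmultiplier.
have {}E xi : (mult xi)%:C * fourier f xi * expi (2 * pi * dotp xi x) =
    \sum_(l < N) (c l)%:C * ((F xi)%:C * expi (2 * pi * dotp (x - v l) xi)).
  rewrite E mulr_suml; apply: eq_bigr => l _.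
  rewrite -[LHS]mulrA -[X in _ * X]mulrA -expiD; congr (_ * (_ * expi _)).
  by rewrite dN (dotpC (- v l)) -mulrDr -dotpDr (dotpC xi) addrC.
under eq_fun do rewrite E.
rewrite (cintegral_sum _ _ _).2; last by move=> l; exact: ci.
apply: eq_bigr => l _; congr (_ * _).
by apply: complex_ext; apply: eq_Rintegral => xi _; rewrite P.
Qed.

Lemma cvg_powR (u : nat -> R) (l r : R) : 0 < r -> (forall k, 0 <= u k) ->
  u k @[k --> \oo] --> l -> u k `^ r @[k --> \oo] --> l `^ r.
Proof.
move=> r0 u0 ul; have l0 : 0 <= l.
  by apply: (ler_cvg_to (cvg_cst 0) ul); exact: nearW.
(* [powR] is defined through [ln], which is not continuous at 0, so the limit 0 is treated
   directly. *)
move: l0; rewrite le_eqVlt => /predU1P[l0|l0].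
  rewrite -l0 powR0 ?gt_eqF//; apply/cvgrPdist_lt => e e0.
  have er : 0 < e `^ r^-1 by rewrite powR_gt0.
  move/cvgrPdist_lt : ul => /(_ _ er); rewrite -l0.
  apply: filterS => k; rewrite !sub0r !normrN !ger0_norm ?powR_ge0// => h.
  have := @gt0_ltr_powR R r r0 _ _ _ _ h.
  by rewrite !nnegrE u0 powR_ge0 -powRrM mulVf ?gt_eqF// powRr1 ?(ltW e0)// => /(_ isT isT).
have E : {near \oo, (fun k => expR (r * ln (u k))) =1 (fun k => u k `^ r)}.
  have : \forall k \near \oo, 0 < u k by apply: (cvgr_gt l).
  apply: filterS => k uk.
  by rewrite /powR gt_eqF.
apply: cvg_trans (near_eq_cvg E) _.
rewrite /powR gt_eqF//; apply: (@continuous_cvg _ _ _ _ _ _ expR).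
  exact: continuous_expR.
apply: cvgM; first exact: cvg_cst.
by apply: continuous_cvg => //; exact: continuous_ln.
Qed.

Section positive_order.
Variables (m : nat) (b : R).
Hypotheses (b0 : 0 < b) (bm : b < m%:R).

(** Substitute xi -> e xi in [potentialE] and use the homogeneity of d + pi |xi|^2. The condition e
    >= 1 keeps d / e^2 below pi. *)
Lemma potential_dilate (a d e : R) (x : 'rV[R]_n) : 0 < a -> 0 <= d -> d <= pi -> 1 <= e ->
  potential m b (a / e ^+ 2) d x =
  e ^+ n * ((e ^+ 2) `^ (m%:R - b) * potential m b a (d / e ^+ 2) (e *: x)).
Proof.
move=> a0 d0 dpi e1; have e0 : 0 < e by rewrite (lt_le_trans _ e1).
have ee : 0 < e ^+ 2 by rewrite exprn_gt0.
have ae : 0 < a / e ^+ 2 by rewrite divr_gt0.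
have de0 : 0 <= d / e ^+ 2 by rewrite divr_ge0// ltW.
have depi : d / e ^+ 2 <= pi.
  apply: le_trans dpi; rewrite ler_pdivrMr// ler_peMr// exprn_ege1//.
have H := potentialE b0 bm ae x 0 d0 dpi.
rewrite cos0 mulr1 in H; rewrite -H.
have mc y : measurable_fun setT (fun xi : 'rV[R]_n => cos (2 * pi * dotp y xi + 0)).
  apply: meas_cos; apply: measD; last exact: measurable_cst.
  by apply: measM; [exact: measurable_cst|exact: meas_dotp].
have iF := integrable_symbol b0 bm ae d0 (mc x) (fun xi => cos_max _).
have [_ ->] := Rintegral_rV_affine 0 e0 iF.
have K := potentialE b0 bm a0 (e *: x) 0 de0 depi.
rewrite cos0 mulr1 in K; rewrite -K.
have iK := integrable_symbol b0 bm a0 de0 (mc (e *: x)) (fun xi => cos_max _).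
rewrite -(RintegralZl _ measurableT iK); congr (_ * _); apply: eq_Rintegral => y _.
rewrite [e *: y + 0]addr0 nsqZ [RHS]mulrA -powRM ?(ltW ee)//; last first.
  by apply: addr_ge0 => //; rewrite mulr_ge0 ?pi_ge0 ?nsq_ge0.
congr (_ `^ _ * (expR _ * cos _)).
- by move: (pi) (nsq y) => p q; field; rewrite gt_eqF.
- by move: (pi) (nsq y) => p q; field; rewrite gt_eqF.
- by rewrite dotpZr (dotpC (e *: x)) dotpZr (dotpC y).
Qed.

Let s := 2 * (m%:R - b).

Let sE : s / 2 = m%:R - b. Proof. by rewrite /s; field. Qed.

Lemma fourier_gauss t (xi : 'rV[R]_n) : 0 < t ->
  fourier (modgauss t 0 0) xi = (heat n t * expR (- (pi * t^-1 * nsq xi)))%:C.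
Proof.
move=> t0; rewrite fourier_modgauss// subr0 (_ : dotp _ _ = 0); last first.
  by rewrite /dotp big1// => i _; rewrite [X in _ * X]mxE mulr0.
by rewrite mulr0 expi0 mulr1; congr (heat n t * expR _)%:C; ring.
Qed.

Lemma fmultiplier_gauss t d : 0 < t -> 0 <= d -> d <= pi ->
  fmultiplier_defined (symb d s) (modgauss t 0 0) /\
  fmultiplier (symb d s) (modgauss t 0 0) =
  (fun x => (pi `^ (- (s / 2)) * heat n t)%:C * (potential m b t^-1 d x)%:C).
Proof.
move=> t0 d0 dpi; have tV : 0 < t^-1 by rewrite invr_gt0.
pose F (xi : 'rV[R]_n) := (d + pi * nsq xi) `^ (m%:R - b) * (expR (- (pi * t^-1 * nsq xi)) * 1).
have iF : leb.-integrable setT (EFin \o F).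
  apply: (integrable_symbol b0 bm tV d0 (@measurable_cst _ _ _ _ _ (1 : R))).
  by move=> xi; rewrite normr1.
have E xi : (symb d s xi)%:C * fourier (modgauss t 0 0) xi =
    \sum_(l < 1) (pi `^ (- (s / 2)) * heat n t)%:C * ((F xi)%:C * expi (- (2 * pi * dotp 0 xi))).
  rewrite big_ord1 fourier_gauss// -rmorphM (_ : dotp 0 xi = 0); last first.
    by rewrite /dotp big1// => i _; rewrite mxE mul0r.
  rewrite mulr0 oppr0 expi0 mulr1 -rmorphM /symb sE /F mulr1; congr (_%:C).
  by move: (_ `^ _) (_ `^ _) (heat _ _) (expR _) => *; ring.
have [h1 h2] := fmultiplier_phase iF E; split => //.
apply/funext => x; rewrite h2 big_ord1 subr0; congr (_ * _).
have K th : \int[leb]_xi (F xi * cos (2 * pi * dotp x xi + th)) = potential m b t^-1 d x * cos th.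
  rewrite -(potentialE b0 bm tV x th d0 dpi); apply: eq_Rintegral => xi _.
  by rewrite /F mulr1 mulrA.
by rewrite !K cos0 mulr1 cosN cos_pihalf mulr0.
Qed.

Lemma modgauss_dilate e (x : 'rV[R]_n) : modgauss (e ^+ 2) 0 0 x = modgauss 1 0 0 (e *: x).
Proof.
rewrite /modgauss !subr0 nsqZ !mulr1 mulrA.
by congr (_ * expi (_ * _)); rewrite /dotp !big1// => i _; rewrite mxE mul0r.
Qed.

Lemma modgauss_sqr t (x : 'rV[R]_n) : 0 < t ->
  modgauss t 0 0 x * modgauss t 0 0 x = modgauss (2 * t) 0 0 x.
Proof.
move=> t0; rewrite (@modgaussM _ _ _ _ _ _ _ _ 0); last 2 first.
- by rewrite gt_eqF// addr_gt0.
- by rewrite !scaler0 addr0.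
by rewrite subr0 nsq0 mulr0 oppr0 expR0 mul1r addr0 mulr2n mulrDl mul1r.
Qed.

Hypotheses (b1 : b < 1) (n0 : (0 < n)%N).

(* Dilating by [e] turns [d] into [d / e^2]; by Fatou the norms are unbounded as
   [e] tends to infinity, the limit [d = 0] having infinite norm. *)
Lemma Lpnorm_potential_unbounded (a d r B : R) : 0 < a -> 0 <= d -> d <= pi -> 0 < r ->
  r * (n%:R + s) <= n%:R ->
  exists2 e, 1 <= e & (B%:E < Lpnorm r (fun x : 'rV[R]_n => (potential m b a (d / e ^+ 2) x)%:C))%E.
Proof.
move=> a0 d0 dpi r0 hr; apply: contrapT => H.
have m0 : (0 < m)%N by rewrite -(ltr_nat R) (lt_trans b0 bm).
have := @potential_powR_oo R n m b a r n0 m0 b0 b1 a0 r0.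
have hr' : r * (n%:R / 2 + m%:R - b) <= n%:R / 2.
  by move: hr; rewrite /s; lra.
move=> /(_ hr') oo.
pose d_ (k : nat) := d / k.+1%:R ^+ 2.
have d_0 k : 0 <= d_ k by rewrite divr_ge0// exprn_ge0.
have d_le k : d_ k <= d / k.+1%:R.
  rewrite ler_wpM2l// lef_pV2 ?posrE ?exprn_gt0// ler_eXnr ?ler1n//.
have d_pi k : d_ k <= pi.
  by apply: le_trans (d_le k) _; apply: le_trans dpi; rewrite ler_pdivrMr// ler_peMr// ler1n.
have d_cvg : d_ k @[k --> \oo] --> (0 : R).
  apply: (@squeeze_cvgr _ _ _ _ (fun=> 0) (fun k => d * harmonic k)).
  - by apply: nearW => k; rewrite d_0 d_le.
  - exact: cvg_cst.
  - by rewrite -(mulr0 d); apply: cvgM; [exact: cvg_cst|exact: cvg_harmonic].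
have mP k : measurable_fun setT (fun x : 'rV[R]_n => `|potential m b a (d_ k) x| `^ r).
  by apply: meas_powR; apply: meas_norm; exact: meas_potential.
have Bk k : (\int[leb]_x (`|potential m b a (d_ k) x| `^ r)%:E <= (B `^ r)%:E)%E.
  have hB : (Lpnorm r (fun x : 'rV[R]_n => (potential m b a (d_ k) x)%:C) <= B%:E)%E.
    rewrite leNgt; apply/negP => K; apply: H; exists k.+1%:R => //; by rewrite ler1n.
  rewrite LpnormE ?gt_eqF// in hB.
  have I0 : (0 <= \int[leb]_x (`|potential m b a (d_ k) x| `^ r)%:E)%E.
    by apply: integral_ge0 => x _; rewrite lee_fin powR_ge0.
  rewrite (_ : (\int[leb]_x _ = \int[leb]_x (`|potential m b a (d_ k) x| `^ r)%:E)%E) in hB; last first.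
    by apply: eq_integral => x _; rewrite normcR.
  have J0 : (0 <= (\int[leb]_x (`|potential m b a (d_ k) x| `^ r)%:E) `^ r^-1)%E.
    exact: poweR_ge0.
  have := @gt0_ler_poweR R r (ltW r0) _ _ _ _ hB.
  rewrite !in_itv/= !leey !andbT J0 (le_trans J0 hB) => /(_ isT isT).
  by rewrite -poweRrM mulVf ?gt_eqF// poweRe1.
have := fatou_bound mP (fun k x => powR_ge0 _ _) _ Bk.
move=> /(_ (fun x => `|potential m b a 0 x| `^ r)) F.
have : (\int[leb]_x (`|potential m b a 0 x| `^ r)%:E <= (B `^ r)%:E)%E.
  apply: F => x.
  have c1 := potential_cvg b0 bm a0 (x := x) d_0 d_pi d_cvg.
  have c2 : `|potential m b a (d_ k) x| @[k --> \oo] --> `|potential m b a 0 x| by exact: cvg_norm.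
  exact: cvg_powR.
by rewrite oo leNgt ltry.
Qed.

Lemma fails_positive_order (d p1 q1 p2 q2 r : R) : 0 <= d -> d <= pi ->
  1 < p1 -> 1 < q1 -> 1 < p2 -> 1 < q2 ->
  r^-1 = p1^-1 + q1^-1 -> r^-1 = p2^-1 + q2^-1 ->
  r * (n%:R + s) <= n%:R -> fails d s p1 q1 p2 q2 r.
Proof.
move=> d0 dpi p11 q11 p21 q21 rE1 rE2 hr C.
have r0 : 0 < r.
  by rewrite -invr_gt0 rE1 addr_gt0// invr_gt0 (lt_trans ltr01).
pose K0 := pi `^ (- (s / 2)).
have K00 : 0 < K0 by rewrite powR_gt0 ?pi_gt0.
have [P P0 HP] := potential_bound n b0 bm (@ltr01 R).
have [G G0 HG] := modgauss_bound (0 : 'rV[R]_n) 0 (@ltr01 R).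
pose N p := @wgtnorm R n p.
pose B := `|C| * (K0 * P * N p1 * (G * N q1) + G * N p2 * (K0 * P * N q2)).
have h0 : 0 < (2 : R)^-1 by rewrite invr_gt0.
have hh : 0 < heat n (2 : R) by exact: heat_gt0.
(* [B] is uniform over all d / e^2, so it is fixed before [e]. After dilation both sides carry the
   factor S e^(- n / r); the left one also carries K0 and, from the doubled parameter of the squared
   Gaussian, [heat n 2]. Hence this threshold. *)
have [e e1 HE] := Lpnorm_potential_unbounded (B / (K0 * heat n 2)) h0 d0 dpi r0 hr.
have e0 : 0 < e by rewrite (lt_le_trans _ e1).
have ee : 0 < e ^+ 2 by rewrite exprn_gt0.
exists (modgauss (e ^+ 2) 0 0), (modgauss (e ^+ 2) 0 0).
have sg : schwartz (modgauss (e ^+ 2) (0 : 'rV[R]_n) 0).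
  by apply: (gauss_class_schwartz ee); exact: gauss_class_mg.
have [df Ef] := fmultiplier_gauss ee d0 dpi.
have e20 : 0 < 2 * e ^+ 2 by rewrite mulr_gt0.
have [dfg Efg] := fmultiplier_gauss e20 d0 dpi.
rewrite (_ : (fun x => modgauss _ _ _ x * _) = modgauss (2 * e ^+ 2) 0 0); last first.
  by apply/funext => x; rewrite modgauss_sqr.
split => //.
have de0 : 0 <= d / e ^+ 2 by rewrite divr_ge0// ltW.
have depi : d / e ^+ 2 <= pi.
  by apply: le_trans dpi; rewrite ler_pdivrMr// ler_peMr// exprn_ege1.
pose S := (e ^+ 2) `^ (m%:R - b).
have S0 : 0 < S by rewrite powR_gt0.
pose h (x : 'rV[R]_n) := (potential m b 1 (d / e ^+ 2) x)%:C.
have Hf : fmultiplier (symb d s) (modgauss (e ^+ 2) 0 0) = (fun x => (K0 * S)%:C * h (e *: x)).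
  rewrite Ef; apply/funext => x; rewrite -[(e ^+ 2)^-1]mul1r potential_dilate//.
  rewrite heat_sqr// /h -!rmorphM; congr (_%:C).
  rewrite -/K0 -/S exprVn; field.
  by rewrite expf_neq0// gt_eqF.
pose h2 (x : 'rV[R]_n) := (potential m b 2^-1 (d / e ^+ 2) x)%:C.
have Hfg : fmultiplier (symb d s) (modgauss (2 * e ^+ 2) 0 0) = (fun x => (K0 * heat n 2 * S)%:C * h2 (e *: x)).
  rewrite Efg; apply/funext => x; rewrite invfM potential_dilate//.
  rewrite heatM// heat_sqr// /h2 -!rmorphM; congr (_%:C).
  rewrite -/K0 -/S exprVn; field.
  by rewrite expf_neq0// gt_eqF.
have mh : measurable_fun setT (fun x => normc (h x)).
  by under eq_fun do rewrite normcR; apply: meas_norm; exact: meas_potential.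
have mh2 : measurable_fun setT (fun x => normc (h2 x)).
  by under eq_fun do rewrite normcR; apply: meas_norm; exact: meas_potential.
have Df p : 1 < p -> (Lpnorm p (fmultiplier (symb d s) (modgauss (e ^+ 2) 0 0)) <=
    (S * e `^ (- (n%:R / p)) * (K0 * P * N p))%:E)%E.
  move=> pp1; have p0 : 0 < p by apply: lt_trans pp1.
  rewrite Hf (@LpnormZ R n p (K0 * S)%:C (fun x => h (e *: x)) p0); last first.
    have := meas_rV_affine e 0 mh; apply: eq_measurable_fun => x _.
    by rewrite addr0.
  rewrite Lpnorm_dilate// normcR gtr0_norm ?mulr_gt0//.
  have LB : (Lpnorm p h <= (P * N p)%:E)%E.
    apply: Lpnorm_le => //; first exact: ltW.
    by move=> x; rewrite normcR; exact: HP.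
  rewrite muleA -EFinM (_ : S * _ * _ = (K0 * S * e `^ (- (n%:R / p))) * (P * N p)); last by ring.
  by rewrite [X in (_ <= X)%E]EFinM; apply: lee_wpmul2l LB; rewrite lee_fin !mulr_ge0 ?powR_ge0// ltW.
have Gf p : 1 < p -> (Lpnorm p (modgauss (e ^+ 2) (0 : 'rV[R]_n) 0) <= (e `^ (- (n%:R / p)) * (G * N p))%:E)%E.
  move=> pp1; have p0 : 0 < p by apply: lt_trans pp1.
  rewrite (_ : modgauss _ _ _ = (fun x => modgauss 1 0 0 (e *: x))); last first.
    by apply/funext => x; exact: modgauss_dilate.
  rewrite Lpnorm_dilate//; last first.
    under eq_fun do rewrite normc_modgauss subr0.
    by apply: meas_exp; apply: measN; apply: measM; [exact: measurable_cst|exact: meas_nsq].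
  rewrite EFinM; apply: lee_wpmul2l; first by rewrite lee_fin powR_ge0.
  apply: Lpnorm_le => //; first exact: ltW.
  by move=> x; have := HG 0 x; rewrite expr0 mul1r.
(* The Hölder relation makes both terms on the right scale exactly like the L^r norm on the left. *)
have eE p q : r^-1 = p^-1 + q^-1 -> e `^ (- (n%:R / p)) * e `^ (- (n%:R / q)) = e `^ (- (n%:R / r)).
  by move=> rE; rewrite -powRD ?(gt_eqF e0) ?implybT// -opprD -mulrDr rE.
have R1 (u v w y z : R) : u * v * y * (w * z) = u * (v * w) * (y * z) by ring.
have R2 (u v w y z : R) : v * z * (u * w * y) = u * (v * w) * (z * y) by ring.
have N0 p : 0 <= N p by exact: powR_ge0.
pose E := S * e `^ (- (n%:R / r)).
have E0 : 0 < E by rewrite mulr_gt0// powR_gt0.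
rewrite Hfg (@LpnormZ R n r (K0 * heat n 2 * S)%:C (fun x => h2 (e *: x)) r0); last first.
  have := meas_rV_affine e 0 mh2; apply: eq_measurable_fun => x _.
  by rewrite addr0.
rewrite Lpnorm_dilate// normcR gtr0_norm ?mulr_gt0//.
apply: (@le_lt_trans _ _ (E * B)%:E).
  apply: (@le_trans _ _ (`|C|%:E * (E * (K0 * P * N p1 * (G * N q1) + G * N p2 * (K0 * P * N q2)))%:E)%E); last first.
    by rewrite -EFinM lee_fin /B mulrCA.
  apply: (@le_trans _ _ (`|C|%:E * (Lpnorm p1 (fmultiplier (symb d s) (modgauss (e ^+ 2) 0%R 0%R)) *
   Lpnorm q1 (modgauss (e ^+ 2) 0%R 0%R) +
   Lpnorm p2 (modgauss (e ^+ 2) 0%R 0%R) *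
   Lpnorm q2 (fmultiplier (symb d s) (modgauss (e ^+ 2) 0%R 0%R))))%E).
    apply: lee_wpmul2r; last by rewrite lee_fin ler_norm.
    by rewrite adde_ge0 ?mule_ge0 ?Lnorm_ge0.
  apply: lee_wpmul2l; first by rewrite lee_fin.
  rewrite mulrDr EFinD; apply: leeD.
    apply: le_trans (lee_pmul _ _ (Df p1 p11) (Gf q1 q11)) _; rewrite ?Lnorm_ge0//.
    by rewrite -EFinM lee_fin /E -(eE _ _ rE1) R1.
  apply: le_trans (lee_pmul _ _ (Gf p2 p21) (Df q2 q21)) _; rewrite ?Lnorm_ge0//.
  by rewrite -EFinM lee_fin /E -(eE _ _ rE2) (R2 S).
rewrite muleA -EFinM (_ : _ * S * _ = E * (K0 * heat n 2)); last by rewrite /E; ring.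
rewrite (_ : E * B = E * (K0 * heat n 2) * (B / (K0 * heat n 2))); last first.
  by field; rewrite !gt_eqF.
have EK : 0 < E * (K0 * heat n 2) by apply: mulr_gt0 => //; exact: mulr_gt0.
rewrite [X in (X < _)%E]EFinM lte_pmul2l//.

Qed.

End positive_order.

End symbols.

(** * Frequency bumps moving to infinity *)

Section oscillation.
Context (R : realType).
Local Notation mu := (@lebesgue_measure R).

Lemma sin_le (u : R) : `|sin u| <= `|u|.
Proof.
wlog u0 : u / 0 <= u => [H|].
  have [/H//|/ltW un] := leP 0 u.
  by have := H (- u); rewrite sinN !normrN oppr_ge0 => /(_ un).
have [c _] := @MVT_segment R sin cos 0 u u0 (fun x _ => is_derive_sin x)
  (continuous_subspaceT (@continuous_sin R)).
by rewrite sin0 !subr0 => ->; rewrite normrM ler_piMl// cos_max.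
Qed.

(* [|1 - e^(- 2 pi i a)|^(2 (i + 2))]: the modulus of the Fourier series of a
   train of Gaussians with coefficients those of [(1 - X)^(2 (i + 2))]. *)
Definition osc (i : nat) (a : R) := ((2 * sin (pi * a)) ^+ 2) ^+ i.+2.

Lemma osc_le i a : 0 <= osc i a <= 4 ^+ i.+2.
Proof.
rewrite /osc exprn_ge0 ?sqr_ge0//=; apply: lerXn2r; rewrite ?nnegrE ?sqr_ge0//.
rewrite exprMn; have := sin_max (pi * a); rewrite -(@expr_le1 _ 2)// real_normK ?num_real//.
lra.
Qed.

Lemma osc_le_sqr i (a : R) : osc i a <= (4 * pi ^+ 2) ^+ i.+2 * (a ^+ 2) ^+ i.+2.
Proof.
rewrite /osc -exprMn; apply: lerXn2r; rewrite ?nnegrE ?sqr_ge0//.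
  by apply: mulr_ge0; [apply: mulr_ge0 => //|]; exact: sqr_ge0.
rewrite (_ : 4 * pi ^+ 2 * a ^+ 2 = 4 * (pi * a) ^+ 2); last by rewrite exprMn [RHS]mulrA.
rewrite exprMn; have h := sin_le (pi * a).
by rewrite -ler_sqr ?nnegrE// !real_normK ?num_real// in h; lra.
Qed.

(** Add 4 sin^2 <= 4 pi^2 and t times 4 sin^2 <= 4 pi^2 a^2, with sin taken at pi a. The zero at a =
    0 is thus converted into decay in t. *)
Let sigma_bound (t a : R) : 0 <= t ->
  (2 * sin (pi * a)) ^+ 2 <= 4 * pi ^+ 2 * ((1 + t * a ^+ 2) * (1 + t)^-1).
Proof.
move=> t0; rewrite mulrA ler_pdivlMr ?ltr_pwDl//.
have h1 := sin_max (pi * a); rewrite -(@expr_le1 _ 2)// real_normK ?num_real// in h1.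
have h2 := sin_le (pi * a).
rewrite -ler_sqr ?nnegrE// !real_normK ?num_real// exprMn in h2.
have h3 : 1 <= (pi : R) ^+ 2 by rewrite exprn_ege1// (le_trans _ (pi_ge2 R))// ler1n.
rewrite exprMn; move: h1 h2 h3; move: (sin _ ^+ 2) (pi ^+ 2) (a ^+ 2) => s p a2 h1 h2 h3.
have := ler_wpM2l t0 h2; nra.
Qed.

Let amp i (t k a : R) := osc i a * expR (- (pi * t * a ^+ 2) - pi * (a - k) ^+ 2).

Let amp' i (t k a : R) :=
  (i.+2%:R * ((2 * sin (pi * a)) ^+ 2) ^+ i.+1 * (2 * (2 * sin (pi * a)) * (2 * (pi * cos (pi * a)))) -
   osc i a * (2 * pi * (t * a + (a - k)))) * expR (- (pi * t * a ^+ 2) - pi * (a - k) ^+ 2).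

Let der_amp i t k a : hasder (amp i t k) a (amp' i t k a).
Proof.
apply: derE; first by rewrite /amp /osc; dtac.
rewrite /amp' /osc /= !(mul0r, add0r, mulr1, subr0, expr1).
rewrite (exprS _ i.+1); move: (((2 * sin (pi * a)) ^+ 2) ^+ i.+1) => p.
move: (expR (- (pi * t * a ^+ 2) - pi * (a - k) ^+ 2)) => E.
move: (sin (pi * a)) (cos (pi * a)) (i.+2%:R : R) (pi) => S C m P.
by ring.
Qed.

Let der_amp' i t k a : exists e, hasder (amp' i t k) a e.
Proof. by eexists; rewrite /amp' /osc; dtac. Qed.

(** Completing the square gives t a^2 + (a - k)^2 >= t k^2 / (1 + t). Half of the exponent is spent
    on this; the other half remains to absorb polynomials. *)
Let gauss_split (t k a : R) : 0 <= t ->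
  expR (- (pi * t * a ^+ 2) - pi * (a - k) ^+ 2) <=
  expR (- (pi / 2 * (t * a ^+ 2))) * expR (- (pi / 2 * (a - k) ^+ 2)) *
  expR (- (pi / 2 * (t * k ^+ 2 / (1 + t)))).
Proof.
move=> t0; rewrite -!expRD ler_expR.
have h : t * k ^+ 2 / (1 + t) <= t * a ^+ 2 + (a - k) ^+ 2.
  rewrite ler_pdivrMr ?ltr_pwDl//; have := sqr_ge0 ((1 + t) * a - k); nra.
have := ler_wpM2l (divr_ge0 (pi_ge0 R) (ler0n _ 2)) h.
rewrite -(mulrA pi t); move: (pi) (t * a ^+ 2) ((a - k) ^+ 2) (t * k ^+ 2 / (1 + t)) => p u v w; lra.
Qed.

(** This explains the exponent i + 2 in [osc]. Differentiation lowers the power of sin^2 to i + 1,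
    which gives (1 + t)^(- i - 1) by [sigma_bound], and the derivative of the Gaussian costs one
    factor 1 + t; (1 + t)^(- i) is left. *)
Let amp_bound i : exists2 C, 0 < C & forall t k a, 0 <= t ->
  `|amp i t k a| + `|amp' i t k a| <=
  C * ((1 + t)^-1 ^+ i * expR (- (pi / 2 * (t * k ^+ 2 / (1 + t))))) * (1 + `|a - k|)^-1 ^+ 2.
Proof.
have p20 : (0 : R) < pi / 2 by rewrite divr_gt0 ?pi_gt0.
have [D D0 HD] := polynomial_exp_bound i.+2 p20.
have [E E0 HE] := exp_inv1D_bound 1 p20.
pose K : R := (4 * pi ^+ 2) ^+ i.+1.
have K0 : 0 < K by rewrite exprn_gt0// mulr_gt0 ?exprn_gt0 ?pi_gt0.
pose A : R := 4 + 8 * pi * i.+2%:R + 8 * pi.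
have A0 : 0 < A by rewrite /A; have := pi_gt0 R; move: (pi) => p p0; rewrite !addr_gt0 ?mulr_gt0.
exists (A * K * 2 * D * E) => [|t k a t0]; first by rewrite !mulr_gt0.
set G := expR (- (pi * t * a ^+ 2) - pi * (a - k) ^+ 2).
have t1 : 0 < 1 + t by rewrite ltr_pwDl.
pose s := (2 * sin (pi * a)) ^+ 2; have s0 : 0 <= s by exact: sqr_ge0.
have s4 : s <= 4.
  have := sin_max (pi * a); rewrite /s exprMn -(@expr_le1 _ 2)// real_normK ?num_real//.
  lra.
have si0 : 0 <= s ^+ i.+1 by rewrite exprn_ge0.
have oE : osc i a = s * s ^+ i.+1 by rewrite /osc -exprS.
have o0 : 0 <= osc i a by have /andP[] := osc_le i a.
have u0 : 0 <= 1 + t * `|a| + `|a - k| by rewrite !addr_ge0// mulr_ge0.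
have S1 : `|amp i t k a| + `|amp' i t k a| <= A * (1 + t * `|a| + `|a - k|) * s ^+ i.+1 * G.
  rewrite /amp /amp' -/G !(normrM _ G) (ger0_norm o0) (ger0_norm (expR_ge0 _)) -mulrDl.
  apply: ler_wpM2r; first exact: expR_ge0.
  have b1 : osc i a <= 4 * s ^+ i.+1 by rewrite oE ler_wpM2r.
  have b2 : `|i.+2%:R * s ^+ i.+1 * (2 * (2 * sin (pi * a)) * (2 * (pi * cos (pi * a))))| <=
      8 * pi * i.+2%:R * s ^+ i.+1.
    rewrite !normrM (ger0_norm si0) !normr_nat (ger0_norm (pi_ge0 R)).
    have h1 := sin_max (pi * a); have h2 := cos_max (pi * a).
    have -> : i.+2%:R * s ^+ i.+1 * (2 * (2 * `|sin (pi * a)|) * (2 * (pi * `|cos (pi * a)|))) =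
      8 * pi * i.+2%:R * s ^+ i.+1 * (`|sin (pi * a)| * `|cos (pi * a)|) by ring.
    by rewrite ler_piMr ?mulr_ge0 ?pi_ge0// mulr_ile1.
  have b3 : `|osc i a * (2 * pi * (t * a + (a - k)))| <= 8 * pi * (t * `|a| + `|a - k|) * s ^+ i.+1.
    rewrite normrM (ger0_norm o0) !normrM normr_nat (ger0_norm (pi_ge0 R)).
    have h : `|t * a + (a - k)| <= t * `|a| + `|a - k|.
      by apply: le_trans (ler_normD _ _) _; rewrite normrM (ger0_norm t0).
    apply: (@le_trans _ _ (4 * s ^+ i.+1 * (2 * pi * (t * `|a| + `|a - k|)))).
      apply: ler_pM => //; first by rewrite !mulr_ge0 ?pi_ge0.
      by apply: ler_wpM2l => //; rewrite mulr_ge0 ?pi_ge0.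
    by rewrite le_eqVlt; apply/orP; left; apply/eqP; ring.
  have b4 := ler_normB (i.+2%:R * s ^+ i.+1 * (2 * (2 * sin (pi * a)) * (2 * (pi * cos (pi * a)))))
    (osc i a * (2 * pi * (t * a + (a - k)))).
  apply: (@le_trans _ _ ((4 + 8 * pi * i.+2%:R + 8 * pi * (t * `|a| + `|a - k|)) * s ^+ i.+1)).
    apply: le_trans (lerD b1 (le_trans b4 (lerD b2 b3))) _.
    by rewrite le_eqVlt; apply/orP; left; apply/eqP; ring.
  apply: ler_wpM2r => //; rewrite /A; have := pi_ge0 R.
  have v0 : 0 <= t * `|a| + `|a - k| by rewrite addr_ge0// mulr_ge0.
  have m0 : (0 : R) <= i.+2%:R by [].
  rewrite -(addrA 1 (t * `|a|)); move: v0 m0; move: (t * `|a| + `|a - k|) (i.+2%:R : R) (pi) => v m p v0 m0 p0.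
  have := mulr_ge0 p0 v0; have := mulr_ge0 (mulr_ge0 p0 m0) v0; nra.
have S2 : (1 + t * `|a| + `|a - k|) <= 2 * (1 + t) * (1 + t * a ^+ 2) * (1 + (a - k) ^+ 2).
  have h1 : `|a| <= 1 + a ^+ 2.
    by rewrite -real_normK ?num_real//; have := normr_ge0 a; nra.
  have h2 : `|a - k| <= 1 + (a - k) ^+ 2.
    by rewrite -(real_normK (num_real (a - k))); have := normr_ge0 (a - k); nra.
  have a0 := sqr_ge0 a; have ak0 := sqr_ge0 (a - k).
  have h3 := ler_wpM2l t0 h1.
  have h4 : 0 <= t * a ^+ 2 by rewrite mulr_ge0.
  have h5 : 0 <= t * (t * a ^+ 2) by rewrite mulr_ge0.
  have h6 : 0 <= (t + t * a ^+ 2 + t * (t * a ^+ 2)) * (a - k) ^+ 2 by rewrite mulr_ge0// !addr_ge0.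
  move: h2 h3 h4 h5 h6 ak0; move: ((a - k) ^+ 2) (`|a - k|) (t * `|a|) => w y z.
  rewrite mulrDr mulr1; move: (a ^+ 2) => a2; lra.
have S3 : s ^+ i.+1 <= K * ((1 + t * a ^+ 2) ^+ i.+1 * (1 + t)^-1 ^+ i.+1).
  rewrite /K -!exprMn; apply: lerXn2r; rewrite ?nnegrE//; last exact: sigma_bound.
  exact: le_trans s0 (sigma_bound a t0).
have S4 := gauss_split k a t0.
have q0 : 0 <= t * a ^+ 2 by rewrite mulr_ge0 ?sqr_ge0.
have S5 := HD _ q0; have S6 := HE (a - k).
apply: (le_trans S1).
have x1 : 0 <= 1 + t * a ^+ 2 by rewrite addr_ge0.
have x2 : 0 <= 1 + (a - k) ^+ 2 by rewrite addr_ge0 ?sqr_ge0.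
have x3 : 0 <= (1 + t)^-1 by rewrite invr_ge0 ltW.
set F := expR (- (pi / 2 * (t * k ^+ 2 / (1 + t)))) in S4 *.
have F0 : 0 <= F by exact: expR_ge0.
apply: (@le_trans _ _ (A * (2 * (1 + t) * (1 + t * a ^+ 2) * (1 + (a - k) ^+ 2)) *
   (K * ((1 + t * a ^+ 2) ^+ i.+1 * (1 + t)^-1 ^+ i.+1)) *
   (expR (- (pi / 2 * (t * a ^+ 2))) * expR (- (pi / 2 * (a - k) ^+ 2)) * F))).
  apply: ler_pM => //; [by rewrite !mulr_ge0// ltW|exact: expR_ge0|].
  by apply: ler_pM => //; [rewrite mulr_ge0// ltW|rewrite ler_wpM2l// ltW].
have -> : A * (2 * (1 + t) * (1 + t * a ^+ 2) * (1 + (a - k) ^+ 2)) *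
   (K * ((1 + t * a ^+ 2) ^+ i.+1 * (1 + t)^-1 ^+ i.+1)) *
   (expR (- (pi / 2 * (t * a ^+ 2))) * expR (- (pi / 2 * (a - k) ^+ 2)) * F) =
   (A * K * 2 * ((1 + t)^-1 ^+ i * F)) *
   (((1 + t * a ^+ 2) ^+ i.+2 * expR (- (pi / 2 * (t * a ^+ 2)))) *
    ((1 + (a - k) ^+ 2) ^+ 1 * expR (- (pi / 2 * (a - k) ^+ 2)))).
  have e1 : (1 + t) * (1 + t)^-1 ^+ i.+1 = (1 + t)^-1 ^+ i by rewrite exprS mulVKf// gt_eqF.
  rewrite -e1 expr1 (exprS (1 + t * a ^+ 2) i.+1).
  move: (expR (- (pi / 2 * (t * a ^+ 2)))) (expR (- (pi / 2 * (a - k) ^+ 2))).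
  move: ((1 + t * a ^+ 2) ^+ i.+1) ((1 + t)^-1 ^+ i.+1) ((a - k) ^+ 2) (K) (A) (F) => y1 y2 y3 y4 y5 y6 y7 y8.
  by ring.
apply: (@le_trans _ _ ((A * K * 2 * ((1 + t)^-1 ^+ i * F)) * (D * (E * (1 + `|a - k|)^-1 ^+ 2)))).
  apply: ler_wpM2l; first by rewrite !mulr_ge0 ?(ltW A0) ?(ltW K0) ?exprn_ge0.
  by apply: ler_pM => //; rewrite mulr_ge0 ?expR_ge0// ?exprn_ge0// expr1.
rewrite le_eqVlt; apply/orP; left; apply/eqP.
by move: (A) (K) (_ ^+ i) (F) (_ ^+ 2) => *; ring.
Qed.

(* Integration by parts provides the decay in [x]. *)
Lemma osc_integral_bound i : exists2 C, 0 < C & forall t k x th, 0 <= t ->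
  `|\int[mu]_a (osc i a * expR (- (pi * t * a ^+ 2) - pi * (a - k) ^+ 2) * cos (2 * pi * x * a + th))| <=
  C * ((1 + t)^-1 ^+ i * expR (- (pi / 2 * (t * k ^+ 2 / (1 + t))))) * (1 + `|x|)^-1.
Proof.
have [C C0 H] := amp_bound i.
pose Z := \int[mu]_(a in setT) ((1 + `|a|)^-1 ^+ 2).
have Z0 : 0 <= Z by apply: Rintegral_ge0 => a _; rewrite exprn_ge0// invr_ge0 addr_ge0.
exists (2 * C * Z + 1) => [|t k x th t0]; first by rewrite ltr_wpDl// !mulr_ge0// ltW.
set B := _ * expR _ in H *.
pose D := (1 + t)^-1 ^+ i * expR (- (pi / 2 * (t * k ^+ 2 / (1 + t)))).
have D0 : 0 <= D by rewrite mulr_ge0 ?expR_ge0// exprn_ge0// invr_ge0 addr_ge0.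
pose I := \int[mu]_a (amp i t k a * cos (2 * pi * x * a + th)).
have [ZE iZ] := integral_inv1D2_translate (- k).
have iB : mu.-integrable setT (EFin \o (fun a => C * D * (1 + `|a - k|)^-1 ^+ 2)).
  exact: integrableZ.
have BE : \int[mu]_a (C * D * (1 + `|a - k|)^-1 ^+ 2) = C * D * Z.
  by rewrite RintegralZl// ZE.
have mA : measurable_fun setT (amp i t k).
  by apply: continuous_measurable_fun => a; apply: der_continuous; exact: der_amp.
have mA' : measurable_fun setT (amp' i t k).
  by apply: continuous_measurable_fun => a; have [e] := der_amp' i t k a; exact: der_continuous.
have mc : measurable_fun setT (fun a : R => cos (2 * pi * x * a + th)) by mtac.
have ms : measurable_fun setT (fun a : R => sin (2 * pi * x * a + th)) by mtac.
have HA a : `|amp i t k a| <= C * D * (1 + `|a - k|)^-1 ^+ 2.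
  by apply: le_trans (H t k a t0); rewrite lerDl.
have HA' a : `|amp' i t k a| <= C * D * (1 + `|a - k|)^-1 ^+ 2.
  by apply: le_trans (H t k a t0); rewrite lerDr.
(* Moving the centre from k to 0 costs a factor depending on k. It serves only the vanishing at
   infinity in the integration by parts and does not enter the final constant. *)
have W a : C * D * (1 + `|a - k|)^-1 ^+ 2 <= C * D * (1 + `|k|) ^+ 2 * (1 + `|a|)^-1 ^+ 2.
  rewrite -[leRHS]mulrA; apply: ler_wpM2l; first by rewrite mulr_ge0// ltW.
  have v1 : 0 < 1 + `|a| by rewrite ltr_pwDl.
  have v2 : 0 < 1 + `|a - k| by rewrite ltr_pwDl.
  rewrite -exprMn; apply: lerXn2r; rewrite ?nnegrE ?divr_ge0 ?invr_ge0 ?addr_ge0//.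
  rewrite ler_pdivlMr// mulrC ler_pdivrMr//.
  have : `|a| <= `|a - k| + `|k| by rewrite -{1}(subrK k a) ler_normD.
  by have := normr_ge0 (a - k); have := normr_ge0 k; nra.
have Q0 : 0 <= C * D * (1 + `|k|) ^+ 2.
  by rewrite mulr_ge0 ?exprn_ge0 ?addr_ge0// mulr_ge0// ltW.
have I1 : `|I| <= C * D * Z.
  rewrite -BE; apply: normr_Rintegral_le => //; first exact: measM.
  by move=> a; apply: le_trans (HA a); rewrite normrM ler_piMr// cos_max.
have I2 : `|2 * pi * x * I| <= C * D * Z.
  have iAc : mu.-integrable setT (EFin \o (fun a => amp i t k a * cos (2 * pi * x * a + th))).
    apply: (@integrable_le _ _ _ mu _ _ _ _ iB); first exact: measM.
    by move=> a; apply: le_trans (HA a); rewrite normrM ler_piMr// cos_max.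
  have iAs : mu.-integrable setT (EFin \o (fun a => amp' i t k a * sin (2 * pi * x * a + th))).
    apply: (@integrable_le _ _ _ mu _ _ _ _ iB); first exact: measM.
    by move=> a; apply: le_trans (HA' a); rewrite normrM ler_piMr// sin_max.
  have parts : \int[mu]_a (amp' i t k a * sin (2 * pi * x * a + th) +
      2 * pi * x * (amp i t k a * cos (2 * pi * x * a + th))) = 0.
    apply: (@Rintegral_derive0_bound R (fun a => amp i t k a * sin (2 * pi * x * a + th)) _
      ((C * D * (1 + `|k|) ^+ 2) * (1 + `|2 * pi * x|))).
    - move=> a; apply: derE; first by apply: derM; [exact: der_amp|dtac].
      rewrite /= !(mul0r, add0r, mulr1, addr0).
      move: (amp i t k a) (amp' i t k a) (sin (2 * pi * x * a + th)) (cos (2 * pi * x * a + th)) (pi) => *; ring.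
    - move=> a; have [e he] := der_amp' i t k a; have h := der_amp i t k a.
      by apply: der_continuous; dtac.
    - move=> a; apply: (@le_trans _ _ (C * D * (1 + `|k|) ^+ 2 * (1 + `|a|)^-1 ^+ 2)).
        by apply: le_trans (W a); rewrite normrM; apply: le_trans (HA a); rewrite ler_piMr// sin_max.
      by apply: ler_wpM2r; [rewrite exprn_ge0// invr_ge0 addr_ge0|rewrite ler_peMr ?lerDl].
    - move=> a; apply: le_trans (ler_normD _ _) _.
      rewrite [leRHS]mulrAC [leRHS]mulrDr mulr1; apply: lerD.
        by apply: le_trans (W a); rewrite normrM; apply: le_trans (HA' a); rewrite ler_piMr// sin_max.
      rewrite normrM mulrC; apply: ler_wpM2r => //.
      by apply: le_trans (W a); rewrite normrM; apply: le_trans (HA a); rewrite ler_piMr// cos_max.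
  rewrite RintegralD// in parts; last exact: integrableZ.
  rewrite (RintegralZl _ measurableT iAc) -/I in parts.
  have -> : 2 * pi * x * I = - \int[mu]_a (amp' i t k a * sin (2 * pi * x * a + th)) by lra.
  rewrite normrN -BE; apply: normr_Rintegral_le => //; first exact: measM.
  by move=> a; apply: le_trans (HA' a); rewrite normrM ler_piMr// sin_max.
rewrite -/(amp i t k _) in I1 I2 *.
have pi1 : 1 <= 2 * (pi : R) by have := pi_ge2 R; lra.
have I3 : `|x| * `|I| <= C * D * Z.
  apply: le_trans I2; rewrite !normrM normr_nat (ger0_norm (pi_ge0 R)) -mulrA.
  by rewrite [leRHS](_ : _ = 2 * pi * (`|x| * `|I|)) ?ler_peMl ?mulr_ge0//; ring.
have CDZ : 0 <= C * D * Z by exact: le_trans (normr_ge0 _) I1.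
rewrite -/I ler_pdivlMr ?ltr_pwDl// mulrDr mulr1 [_ * `|x|]mulrC.
by rewrite /B -/D; move: I1 I3 D0; nra.
Qed.

End oscillation.

(** * The symbol of negative order on a frequency bump *)

Section bump.
Context (R : realType).
Local Notation mu := (@lebesgue_measure R).
Local Notation leb n := (lebesgue_rV R n).
Variables (n i : nat) (s d : R).
Hypotheses (s0 : s < 0) (si : - (s / 2) < i%:R) (d0 : 0 <= d).

Let b := - (s / 2).

Let b0 : 0 < b. Proof. by rewrite oppr_gt0 pmulr_llt0// invr_gt0. Qed.

Let L (xi : 'rV[R]_n.+1) := d + pi * nsq xi.

Let L_ge0 xi : 0 <= L xi.
Proof. by rewrite addr_ge0// mulr_ge0 ?pi_ge0 ?nsq_ge0. Qed.

Let mL : measurable_fun setT L.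
Proof.
by apply: measD; [exact: measurable_cst|apply: measM; [exact: measurable_cst|exact: meas_nsq]].
Qed.

Definition axis : 'rV[R]_n.+1 := delta_mx ord0 ord0.

(** The oscillating factor depends on the first coordinate alone; since |xi_1| <= |xi|, its zero
    still compensates the singularity of the symbol at the origin. *)
Definition bump (k : R) (xi : 'rV[R]_n.+1) :=
  osc i (xi ord0 ord0) * expR (- (pi * nsq (xi - k *: axis))).

Let meas_axis (k : R) : measurable_fun setT (fun xi : 'rV[R]_n.+1 => nsq (xi - k *: axis)).
Proof. by have := meas_rV_affine 1 (- (k *: axis)) (@meas_nsq R n.+1); under eq_fun do rewrite scale1r. Qed.

Let meas_osc : measurable_fun setT (osc i : R -> R).
Proof. by apply: measX; apply: measX; mtac. Qed.

Let meas_bump k : measurable_fun setT (bump k).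
Proof.
apply: measM; last first.
  by apply: meas_exp; apply: measN; apply: measM; [exact: measurable_cst|exact: meas_axis].
exact: (measurableT_comp meas_osc (measurable_coord_rV ord0)).
Qed.

Let bump_axis k xi : L xi = 0 -> bump k xi = 0.
Proof.
move=> /eqP; rewrite /L paddr_eq0 ?mulr_ge0 ?pi_ge0 ?nsq_ge0//.
move=> /andP[_]; rewrite mulf_eq0 gt_eqF ?pi_gt0//= => /eqP/nsq_eq0 ->.
by rewrite /bump /osc mxE mulr0 sin0 mulr0 expr0n /= expr0n mul0r.
Qed.

(** For |xi| >= 1 both factors are bounded. For |xi| < 1 the symbol is at most |xi|^(- 2 b), while
    [osc] is at most a constant times |xi|^(2 (i + 2)) and b < i. *)
Lemma symbol_osc_bound xi : L xi `^ (s / 2) * osc i (xi ord0 ord0) <= (4 * pi ^+ 2) ^+ i.+2.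
Proof.
have -> : s / 2 = - b by rewrite opprK.
have /andP[h0 h1] := osc_le i (xi ord0 ord0).
have p1 : 1 <= (pi : R) by apply: le_trans (pi_ge2 R); rewrite ler1n.
have p2 : 1 <= (pi : R) ^+ 2 by rewrite exprn_ege1.
have [n0|] := eqVneq (nsq xi) 0.
  rewrite (nsq_eq0 n0) /osc mxE mulr0 sin0 mulr0 expr0n /= expr0n mulr0.
  by rewrite exprn_ge0// mulr_ge0// exprn_ge0// pi_ge0.
have := nsq_ge0 xi; rewrite le_eqVlt eq_sym => /orP[->//|n0 _].
have Lb : 0 < nsq xi `^ b by rewrite powR_gt0.
rewrite powRN mulrC ler_pdivrMr; last first.
  by rewrite powR_gt0// ltr_wpDl// mulr_gt0// pi_gt0.
apply: (@le_trans _ _ ((4 * pi ^+ 2) ^+ i.+2 * nsq xi `^ b)); last first.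
  apply: ler_wpM2l; first by rewrite exprn_ge0// mulr_ge0// exprn_ge0// pi_ge0.
  apply: ge0_ler_powR; rewrite ?nnegrE ?(ltW b0) ?(ltW n0)//.
  apply: (@le_trans _ _ (pi * nsq xi)); last by rewrite /L lerDr.
  by rewrite ler_peMl// ltW.
have K0 : 0 <= (4 * (pi : R) ^+ 2) ^+ i.+2 by rewrite exprn_ge0// mulr_ge0// exprn_ge0// pi_ge0.
have [n1|n1] := leP 1 (nsq xi).
  apply: (@le_trans _ _ ((4 * pi ^+ 2) ^+ i.+2)).
    apply: (le_trans h1); apply: lerXn2r; rewrite ?nnegrE ?mulr_ge0 ?exprn_ge0 ?pi_ge0//.
    by rewrite ler_peMr.
  rewrite ler_peMr//; have := @ler_powR R (nsq xi) n1 0 b (ltW b0).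
  by rewrite powRr0.
apply: le_trans (osc_le_sqr _ _) _; apply: ler_wpM2l => //.
apply: (@le_trans _ _ (nsq xi ^+ i.+2)).
  by apply: lerXn2r; rewrite ?nnegrE ?sqr_ge0 ?nsq_ge0//; exact: nsq_coord.
rewrite -powR_mulrn ?(ltW n0)//; apply: ger_powR; first by rewrite n0 ltW.
by apply: le_trans (ltW si) _; rewrite ler_nat -[leqLHS]addn0 -[leqRHS]addn2 leq_add2l.
Qed.

Lemma integrable_symbol_bump k : (leb n.+1).-integrable setT (EFin \o (fun xi => L xi `^ (s / 2) * bump k xi)).
Proof.
have [ig _] := @gauss_cos_translate R n.+1 1 (k *: axis) 0 0 ltr01.
apply: (@integrable_le _ _ _ (leb n.+1) _ (fun xi => (4 * pi ^+ 2) ^+ i.+2 *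
   (expR (- (pi * 1 * nsq (xi - k *: axis))) * cos (2 * pi * dotp 0 xi + 0)))).
- by apply: measM => //; apply: meas_powR.
- move=> xi; rewrite (_ : dotp 0 xi = 0); last by rewrite /dotp big1// => j _; rewrite mxE mul0r.
  rewrite mulr0 addr0 cos0 !mulr1 /bump mulrA normrM (ger0_norm (expR_ge0 _)).
  apply: ler_wpM2r; first exact: expR_ge0.
  rewrite ger0_norm; first exact: symbol_osc_bound.
  by rewrite mulr_ge0 ?powR_ge0//; have /andP[] := osc_le i (xi ord0 ord0).
- exact: integrableZ.
Qed.

Let symbol_expE k xi q : L xi `^ (s / 2) * (bump k xi * q) = expR (- (b * ln (L xi))) * (bump k xi * q).
Proof.
have [/bump_axis ->|L0] := eqVneq (L xi) 0; first by rewrite !mul0r !mulr0.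
by rewrite /powR (negbTE L0) /b mulNr opprK.
Qed.

Let integrable_peak k : (leb n.+1).-integrable setT
  (EFin \o (fun xi => expR (- (pi * nsq (xi - k *: axis))))).
Proof.
have [ig _] := @gauss_cos_translate R n.+1 1 (k *: axis) 0 0 ltr01.
apply: eq_integrable ig => // xi _ /=.
rewrite (_ : dotp 0 xi = 0); last by rewrite /dotp big1// => j _; rewrite mxE mul0r.
by rewrite mulr0 addr0 cos0 !mulr1.
Qed.

Let rV_subZ m (u v : 'rV[R]_m) k j : (u - k *: v) ord0 j = u ord0 j - k * v ord0 j.
Proof. by rewrite !mxE. Qed.

(** The factor e^(b y) comes from subordination and (1 + e^y)^(- i) from the zero of [osc]; b < i
    makes their product integrable. The last factor tends to 0 as k grows, for every fixed y. *)
Let eta_fun (k : nat) (y : R) := expR (b * y) * (1 + expR y)^-1 ^+ i *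
  expR (- (pi / 2 * (expR y * k.+1%:R ^+ 2 / (1 + expR y)))).

(** The integral factors: the first coordinate is handled by [osc_integral_bound] with t = e^y, the
    others form an exact Gaussian integral at time 1 + e^y. Prescribing only the square of [kap]
    treats the frequencies k + 1 and - (k + 1) together. *)
Let bump_inner : exists2 C, 0 < C & forall (k : nat) kap (x : 'rV[R]_n.+1) th y, kap ^+ 2 = k.+1%:R ^+ 2 ->
  `|\int[leb n.+1]_xi (gamk b (L xi) y * (bump kap xi * cos (2 * pi * dotp x xi + th)))| <=
  C * wgt x * eta_fun k y.
Proof.
have [C C0 HC] := osc_integral_bound R i.
have [D D0 HD] := heat_wgt n (@ltr01 R) (pi_gt0 R).
exists (C * D) => [|k kap x th y kE]; first exact: mulr_gt0.
have T0 : 0 < expR y := expR_gt0 y; have T1 : 0 < 1 + expR y by rewrite addr_gt0.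
set x1 := x ord0 ord0; set v := rsubmx (x : 'rV_(1 + n)).
have mc (m : nat) (z : 'rV[R]_m) t : measurable_fun setT (fun xi : 'rV[R]_m => cos (2 * pi * dotp z xi + t)).
  apply: meas_cos; apply: measD; last exact: measurable_cst.
  by apply: measM; [exact: measurable_cst|exact: meas_dotp].
have E : \int[leb n.+1]_xi (gamk b (L xi) y * (bump kap xi * cos (2 * pi * dotp x xi + th))) =
    expR (b * y - d * expR y) * (heat n (1 + expR y) * expR (- (pi * nsq v / (1 + expR y)))) *
    \int[mu]_a (osc i a * expR (- (pi * expR y * a ^+ 2) - pi * (a - kap) ^+ 2) * cos (2 * pi * x1 * a + th)).
  rewrite Rintegral_rVS; last first.
    apply: (@integrable_le _ _ _ (leb n.+1) _ (fun xi =>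
      expR (b * y) * 4 ^+ i.+2 * expR (- (pi * nsq (xi - kap *: axis))))).
    - apply: measM; last exact: measM (meas_bump kap) (mc _ x th).
      exact: meas_gamk2 mL (@measurable_cst _ _ _ _ _ y).
    - move=> xi; rewrite /bump; have /andP[h0 h1] := osc_le i (xi ord0 ord0).
      rewrite normrM (ger0_norm (expR_ge0 _)) normrM (normrM (osc _ _)) (ger0_norm h0) (ger0_norm (expR_ge0 _)).
      rewrite -[leRHS]mulrA; apply: ler_pM; first exact: expR_ge0.
      + by rewrite mulr_ge0// mulr_ge0 ?expR_ge0.
      + by rewrite /gamk ler_expR gerBl mulr_ge0// ltW.
      apply: le_trans (ler_piMr _ (cos_max _)) _; first by rewrite mulr_ge0 ?expR_ge0.
      by apply: ler_wpM2r h1; exact: expR_ge0.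
    - exact: integrableZ.
  set P := expR (b * y - d * expR y); set Hv := _ * expR (- (pi * nsq v / _)).
  pose Q a := osc i a * expR (- (pi * expR y * a ^+ 2) - pi * (a - kap) ^+ 2).
  have W a : \int[leb n]_w (gamk b (L (cons_rV (a, w))) y *
      (bump kap (cons_rV (a, w)) * cos (2 * pi * dotp x (cons_rV (a, w)) + th))) =
      P * Hv * (Q a * cos (2 * pi * x1 * a + th)).
    transitivity (\int[leb n]_w (P * Q a * (expR (- (pi * (1 + expR y) * nsq w)) *
       cos (2 * pi * dotp v w + (2 * pi * x1 * a + th))))).
      apply: eq_Rintegral => w _.
      rewrite /bump cons_rV0 (_ : cons_rV (a, w) - kap *: axis = cons_rV (a - kap, w)); last first.
        apply/rowP => j; rewrite rV_subZ [axis _ _]mxE.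
        case: (unliftP ord0 j) => [j'|] ->; first by rewrite !cons_rVS /= mulr0 subr0.
        by rewrite !cons_rV0 /= mulr1.
      rewrite /gamk /L !nsq_cons [X in dotp X _]cons_rV_surj dotp_cons -/x1 -/v /P /Q.
      have -> : 2 * pi * (x1 * a + dotp v w) + th = 2 * pi * dotp v w + (2 * pi * x1 * a + th).
        by move: (pi) => p; ring.
      have -> : expR (b * y - (d + pi * (a ^+ 2 + nsq w)) * expR y) =
        expR (b * y - d * expR y) * expR (- (pi * expR y * a ^+ 2)) * expR (- (pi * expR y * nsq w)).
        by rewrite -!expRD; congr expR; move: (pi) (expR y) => p e; ring.
      have -> : expR (- (pi * (1 + expR y) * nsq w)) = expR (- (pi * nsq w)) * expR (- (pi * expR y * nsq w)).
        by rewrite -!expRD; congr expR; move: (pi) (expR y) => p e; ring.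
      rewrite mulrDr opprD !expRD; move: (cos _) => c.
      move: (expR (b * y)) (expR (- (d * expR y))) (expR (- (pi * expR y * a ^+ 2))) (expR (- (pi * expR y * nsq w))) => u1 u2 u3 u4.
      move: (expR (- (pi * (a - kap) ^+ 2))) (expR (- (pi * nsq w))) (osc i a) => u5 u6 u7.
      by ring.
    have ig : (leb n).-integrable setT (EFin \o (fun w => expR (- (pi * (1 + expR y) * nsq w)) *
       cos (2 * pi * dotp v w + (2 * pi * x1 * a + th)))).
      apply: (@integrable_gauss_cos _ _ _ _ 0 1) => //.
      by move=> w; rewrite expr0 mulr1 cos_max.
    rewrite (RintegralZl _ measurableT ig) gauss_cos// /Hv.
    by move: (heat _ _) (cos _) (Q a) => h c q; ring.
  under eq_Rintegral do rewrite W.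
  rewrite RintegralZl//.
  apply: (@integrable_le _ _ _ mu _ (fun a => 4 ^+ i.+2 * expR (- (pi * (a - kap) ^+ 2)))).
  - by apply: measM; [apply: measM; [exact: meas_osc|mtac]|mtac].
  - move=> a; rewrite /Q; have /andP[h0 h1] := osc_le i a.
    rewrite normrM (normrM (osc _ _)) (ger0_norm h0) (ger0_norm (expR_ge0 _)).
    apply: le_trans (ler_piMr _ (cos_max _)) _; first by rewrite mulr_ge0 ?expR_ge0.
    apply: ler_pM => //.
    rewrite ler_expR gerDr oppr_le0; apply: mulr_ge0; last exact: sqr_ge0.
    by rewrite mulr_ge0 ?pi_ge0 ?expR_ge0.
  - apply: integrableZ.
    have [K K0 HK] := exp_inv1D_bound 0 (pi_gt0 R).
    have [_ iZ] := integral_inv1D2_translate (- kap).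
    apply: (@integrable_le _ _ _ mu _ (fun a => K * (1 + `|a - kap|)^-1 ^+ 2)).
    + by mtac.
    + by move=> a; rewrite ger0_norm ?expR_ge0//; apply: le_trans (HK (a - kap)); rewrite expr0 mul1r.
    + exact: integrableZ.
rewrite E; clear E.
have H1 := HC (expR y) kap x1 th (ltW T0); rewrite kE in H1.
have H2 := HD (1 + expR y) v; rewrite lerDl (ltW T0) in H2; have {}H2 := H2 isT.
move: H1; set I := \int[mu]_a _ => H1.
rewrite (normrM _ I) normrM (ger0_norm (expR_ge0 _)) ger0_norm; last first.
  by rewrite mulr_ge0 ?expR_ge0// ltW// heat_gt0.
have H3 : expR (b * y - d * expR y) <= expR (b * y).
  by rewrite ler_expR gerBl mulr_ge0// ltW.
apply: (@le_trans _ _ (expR (b * y) * (D * wgt v) * (C * ((1 + expR y)^-1 ^+ i * expR (- (pi / 2 * (expR y * k.+1%:R ^+ 2 / (1 + expR y))))) *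
      (1 + `|x1|)^-1))).
  apply: ler_pM => //; first by rewrite !mulr_ge0 ?expR_ge0// ltW// heat_gt0.
  by apply: ler_pM => //; rewrite ?expR_ge0// mulr_ge0 ?expR_ge0// ltW// heat_gt0.
rewrite (_ : wgt x = (1 + `|x1|)^-1 * wgt v); last by rewrite {1}[x]cons_rV_surj wgt_cons.
rewrite /eta_fun.
move: (expR (b * y)) (expR (- _)) (wgt v) ((1 + expR y)^-1 ^+ i) ((1 + `|x1|)^-1) => u1 u2 u3 u4 u5.
by rewrite le_eqVlt; apply/orP; left; apply/eqP; ring.
Qed.

Let meas_eta k : measurable_fun setT (eta_fun k).
Proof.
have mi : measurable_fun setT (fun y : R => (1 + expR y)^-1).
  have := meas_inv1D (@measurable_expR R); apply: eq_measurable_fun => y _.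
  by rewrite ger0_norm ?expR_ge0.
apply: measM; first by apply: measM; [mtac|exact: measX].
apply: meas_exp; apply: measN; apply: measM; first exact: measurable_cst.
by apply: measM => //; apply: measM; [exact: measurable_expR|exact: measurable_cst].
Qed.

Let eta_le k y : `|eta_fun k y| <= expR (b * y) * (1 + expR y)^-1 ^+ i.
Proof.
rewrite normrM (ger0_norm (expR_ge0 _)) ger0_norm; last first.
  by rewrite mulr_ge0 ?expR_ge0// exprn_ge0// invr_ge0 addr_ge0 ?expR_ge0.
apply: ler_piMr; first by rewrite mulr_ge0 ?expR_ge0// exprn_ge0// invr_ge0 addr_ge0 ?expR_ge0.
by rewrite -[leRHS]expR0 ler_expR oppr_le0 !mulr_ge0 ?expR_ge0 ?exprn_ge0 ?pi_ge0 ?invr_ge0 ?addr_ge0 ?expR_ge0.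
Qed.

Let integrable_eta k : mu.-integrable setT (EFin \o eta_fun k).
Proof.
exact: (@integrable_le _ _ _ mu _ _ (meas_eta k) (eta_le k) (integrable_exp_frac b0 si)).
Qed.

(** Dominated convergence applied to the integral of [eta_fun k]. The bound is uniform in [x] and in
    the phase, so it covers real and imaginary parts and all translates. *)
Lemma bump_fourier_bound : exists2 eta : nat -> R, eta k @[k --> \oo] --> (0 : R) &
  forall (k : nat) kap (x : 'rV[R]_n.+1) th, kap ^+ 2 = k.+1%:R ^+ 2 ->
  0 <= eta k /\
  `|\int[leb n.+1]_xi (L xi `^ (s / 2) * (bump kap xi * cos (2 * pi * dotp x xi + th)))| <=
  eta k * wgt x.
Proof.
have [C C0 H] := bump_inner; have g0 := gam_gt0 b0.
have eta0 k : 0 <= \int[mu]_y eta_fun k y.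
  by apply: Rintegral_ge0 => y _; rewrite !mulr_ge0 ?expR_ge0// exprn_ge0// invr_ge0 addr_ge0 ?expR_ge0.
exists (fun k => (gam b)^-1 * C * \int[mu]_y eta_fun k y).
  rewrite -(mulr0 ((gam b)^-1 * C)); apply: cvgM; first exact: cvg_cst.
  have := @dominated_cvg _ _ _ mu setT measurableT (fun k y => (eta_fun k y)%:E) (fun y => 0%E)
    (fun y => (expR (b * y) * (1 + expR y)^-1 ^+ i)%:E).
  move=> DC; have {}DC : (\int[mu]_y (eta_fun k y)%:E)%E @[k --> \oo] --> 0%E.
    rewrite -(@integral0 _ _ _ mu setT); apply: DC => //.
    - by move=> k; apply/measurable_EFinP; exact: meas_eta.
    - move=> y _; apply: cvg_EFin; first exact: nearW.
      rewrite /comp /= -(mulr0 (expR (b * y) * (1 + expR y)^-1 ^+ i)).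
      apply: cvgM; first exact: cvg_cst.
      pose c := pi / 2 * (expR y / (1 + expR y)).
      have c0 : 0 < c by rewrite mulr_gt0// ?divr_gt0 ?pi_gt0 ?expR_gt0// addr_gt0 ?expR_gt0.
      apply: (@squeeze_cvgr _ _ _ _ (fun=> 0) (fun k => c^-1 * harmonic k)).
      + apply: nearW => k; rewrite expR_ge0/= /harmonic/= -invfM.
        rewrite (_ : pi / 2 * _ = c * k.+1%:R ^+ 2); last by rewrite /c; move: (pi) => p; field; rewrite gt_eqF// addr_gt0 ?expR_gt0.
        have k1 : (1 : R) <= k.+1%:R by rewrite ler1n.
        have ck : 0 < c * k.+1%:R by rewrite mulr_gt0.
        rewrite expRN lef_pV2 ?posrE ?expR_gt0//; apply: le_trans (expR_ge1Dx _).
        apply: (@le_trans _ _ (c * k.+1%:R ^+ 2)); last by rewrite lerDr.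
        by apply: ler_wpM2l; [exact: ltW|rewrite expr2 ler_peMr// ler0n].
      + exact: cvg_cst.
      + by rewrite -(mulr0 c^-1); apply: cvgM; [exact: cvg_cst|exact: cvg_harmonic].
    - exact: (integrable_exp_frac b0 si).
    - move=> k y _; rewrite lee_fin; exact: eta_le.
  rewrite -[0]/(fine 0%E); apply: fine_cvg; exact: DC.
move=> k kap x th kE; split; first by rewrite !mulr_ge0 ?invr_ge0// ltW.
have mc : measurable_fun setT (fun xi : 'rV[R]_n.+1 => cos (2 * pi * dotp x xi + th)).
  apply: meas_cos; apply: measD; last exact: measurable_cst.
  by apply: measM; [exact: measurable_cst|exact: meas_dotp].
have mA : measurable_fun setT (fun xi => bump kap xi * cos (2 * pi * dotp x xi + th)) by exact: measM.
have iA : (leb n.+1).-integrable setT (EFin \o (fun xi => expR (- (b * ln (L xi))) *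
    (bump kap xi * cos (2 * pi * dotp x xi + th)))).
  apply: (@integrable_le _ _ _ (leb n.+1) _ (fun xi => `|L xi `^ (s / 2) * bump kap xi|)).
  - apply: measM => //; apply: meas_exp; apply: measN; apply: measM; first exact: measurable_cst.
    exact: (measurableT_comp (@measurable_ln R) mL).
  - by move=> xi; rewrite -symbol_expE mulrA [leLHS]normrM ler_piMr// cos_max.
  - exact: integrable_norm (integrable_symbol_bump kap).
have LA xi : L xi = 0 -> bump kap xi * cos (2 * pi * dotp x xi + th) = 0.
  by move=> /bump_axis ->; rewrite mul0r.
have S := subordination b0 mL mA L_ge0 LA iA.
under eq_Rintegral do rewrite symbol_expE.
rewrite -(ler_pM2l g0) -{1}(ger0_norm (ltW g0)) -normrM S.
have -> : gam b * ((gam b)^-1 * C * \int[mu]_y eta_fun k y * wgt x) =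
    \int[mu]_y (C * wgt x * eta_fun k y).
  by rewrite RintegralZl// !mulrA mulfV ?gt_eqF// mul1r mulrAC.
apply: normr_Rintegral_le.
- apply: (@meas_Rintegral _ _ (measurableTypeR R) _ R (leb n.+1)
    (fun p => gamk b (L p.2) p.1 * (bump kap p.2 * cos (2 * pi * dotp x p.2 + th)))).
  apply: measM; last exact: (measurableT_comp mA measurable_snd).
  by apply: meas_gamk2; [exact: (measurableT_comp mL measurable_snd)|exact: measurable_fst].
- by move=> y; exact: H.
- exact: integrableZ.
Qed.

End bump.

(** * Trains of Gaussians with a product vanishing at frequency zero *)

Section twisted_products.
Variable F : fieldType.
Implicit Types (P Q D : {poly F}) (c : F).

(** The linear map P -> f P mod D goes from a space of dimension deg D + 1 to one of dimension deg
    D, so it has a nonzero kernel. *)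
Lemma exists_multiple D (f : {poly F} -> {poly F}) : D != 0 ->
  {morph f : P Q / P + Q} -> (forall c P, f (c *: P) = c *: f P) ->
  exists2 P, P != 0 & D %| f P.
Proof.
move=> D0 fD fZ; pose N := (size D).-1.
have sD : size D = N.+1 by rewrite prednK// size_poly_gt0.
pose A := \matrix_(a < N.+1, j < N) (f 'X^a %% D)`_j.
have : kermx A != 0.
  rewrite -mxrank_eq0 mxrank_ker subn_eq0 -ltnNge ltnS.
  exact: rank_leq_col.
case/rowV0Pn => v /sub_kermxP vA v0; exists (rVpoly v).
  by apply: contra v0 => /eqP v0; rewrite -[v]rVpolyK v0 linear0.
have f0 : f 0 = 0 by have := fZ 0 0; rewrite !scale0r.
rewrite /dvdp; apply/eqP/polyP => j; rewrite coef0.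
have E : f (rVpoly v) %% D = \sum_(a < N.+1) v ord0 a *: (f 'X^a %% D).
  rewrite /rVpoly poly_def (big_morph f fD f0) (big_morph _ (modpD D) (mod0p D)).
  apply: eq_bigr => a _; rewrite fZ modpZl.
  by case: insubP => [u _ ua|]; [congr (v _ _ *: _); exact/val_inj|rewrite ltn_ord].
have [jN|Nj] := ltnP j N; last first.
  rewrite nth_default//; apply: leq_trans Nj; rewrite -ltnS.
  by have := ltn_modp (f (rVpoly v)) D; rewrite D0 sD.
rewrite E coef_sum.
have /rowP/(_ (Ordinal jN)) := vA; rewrite !mxE => vAj; rewrite -[RHS]vAj.
by apply: eq_bigr => a _; rewrite coefZ mxE.
Qed.

(** A diagonal operator on coefficients, injective for c nonzero. Conjugating by such operators
    turns the product of trains into an ordinary product of polynomials. *)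
Definition twist c P := \poly_(j < size P) (c ^+ (j ^ 2) * P`_j).

Lemma coef_twist c P j : (twist c P)`_j = c ^+ (j ^ 2) * P`_j.
Proof.
by rewrite coef_poly; case: ltnP => // h; rewrite nth_default// mulr0.
Qed.

Lemma twistD c : {morph twist c : P Q / P + Q}.
Proof. by move=> P Q; apply/polyP => j; rewrite coefD !coef_twist coefD mulrDr. Qed.

Lemma twistZ c a P : twist c (a *: P) = a *: twist c P.
Proof. by apply/polyP => j; rewrite coefZ !coef_twist coefZ mulrCA. Qed.

Lemma twistXn c m : twist c 'X^m = c ^+ (m ^ 2) *: 'X^m.
Proof.
apply/polyP => j; rewrite coefZ !coef_twist !coefXn.
by case: eqP => [->//|_]; rewrite !mulr0.
Qed.

Lemma twist_eq0 c P : c != 0 -> twist c P = 0 -> P = 0.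
Proof.
move=> c0 h; apply/polyP => j; have := coef_twist c P j.
by rewrite h coef0 => /esym/eqP; rewrite mulf_eq0 expf_eq0 (negbTE c0) andbF => /eqP ->.
Qed.

Lemma twist_sum c I (s : seq I) (G : I -> {poly F}) :
  twist c (\sum_(i <- s) G i) = \sum_(i <- s) twist c (G i).
Proof.
apply: (big_morph _ (twistD c)).
by apply/polyP => j; rewrite coef_twist coef0 mulr0.
Qed.

(* [c^((j - l)^2) = (c^2)^(j^2) (c^2)^(l^2) (c^-1)^((j + l)^2)]. *)
Definition tprod c P Q := twist c^-1 (twist (c ^+ 2) P * twist (c ^+ 2) Q).

Lemma tprodD c P : {morph tprod c P : Q Q' / Q + Q'}.
Proof. by move=> Q Q'; rewrite /tprod twistD mulrDr twistD. Qed.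

Lemma tprodZ c P a Q : tprod c P (a *: Q) = a *: tprod c P Q.
Proof. by rewrite /tprod twistZ -scalerAr twistZ. Qed.

(** Twists are injective and polynomials over a field form a domain. This is what guarantees that f
    g is not zero. *)
Lemma tprod_neq0 c P Q : c != 0 -> P != 0 -> Q != 0 -> tprod c P Q != 0.
Proof.
move=> c0 P0 Q0; apply/negP => /eqP /twist_eq0; rewrite invr_eq0 => /(_ c0) /eqP.
have c20 : c ^+ 2 != 0 by rewrite expf_neq0.
rewrite mulf_eq0 => /orP[] /eqP /(twist_eq0 c20) E; last by rewrite E eqxx in Q0.
by rewrite E eqxx in P0.
Qed.

Lemma tprodE c P Q : tprod c P Q = \sum_(j < size P) \sum_(l < size Q)
  (P`_j * Q`_l * (c ^+ (2 * j ^ 2 + 2 * l ^ 2) * c^-1 ^+ ((j + l) ^ 2))) *: 'X^(j + l).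
Proof.
rewrite /tprod [twist _ P]poly_def [twist _ Q]poly_def big_distrl/= twist_sum.
apply: eq_bigr => j _; rewrite big_distrr/= twist_sum; apply: eq_bigr => l _.
rewrite -scalerAl -scalerAr scalerA -exprD twistZ twistXn scalerA.
have -> : c ^+ (2 * j ^ 2 + 2 * l ^ 2) = (c ^+ 2) ^+ (j ^ 2) * (c ^+ 2) ^+ (l ^ 2).
  by rewrite -!exprM -exprD.
congr (_ *: _).
by move: (_ ^+ (j ^ 2)) (_ ^+ (l ^ 2)) (_ ^+ ((j + l) ^ 2)) => u v w; ring.
Qed.

(* One unknown coefficient more than the number of linear conditions. *)
Lemma exists_tprod_multiple c D : c != 0 -> D != 0 ->
  exists Q, [/\ Q != 0, tprod c D (D * Q) != 0 & D %| tprod c D (D * Q)].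
Proof.
move=> c0 D0.
have [|a Q|Q Q0 h] := @exists_multiple D (fun Q => tprod c D (D * Q)) D0.
- by move=> Q Q'; rewrite mulrDr tprodD.
- by rewrite -scalerAr tprodZ.
by exists Q; split => //; rewrite tprod_neq0// mulf_neq0.
Qed.

End twisted_products.

(** * Trains of Gaussians and their Fourier transforms *)

Section trains.
Context (R : realType) (n : nat).
Local Notation Re := complex.Re.
Local Notation Im := complex.Im.
Local Notation leb := (lebesgue_rV R n.+1).
Local Open Scope complex_scope.
Import ComplexField.Normc.
Local Notation e1 := (axis R n).
Local Notation toC := (map_poly (real_complex R)).

Lemma horner_toC (P : {poly R}) (z : R[i]) :
  (toC P).[z] = \sum_(j < size P) (P`_j)%:C * z ^+ j.
Proof.
rewrite horner_coef size_map_poly; apply: eq_bigr => j _.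
by rewrite coef_map.
Qed.

Lemma normc_toC (P : {poly R}) (a : R) : normc ((toC P).[expi a]) <= \sum_(j < size P) `|P`_j|.
Proof.
rewrite horner_toC; apply: le_trans (normc_sum _ _) _; apply: ler_sum => j _.
by rewrite normcM normcR -expiMn normc_expi mulr1.
Qed.

(* The frequency [k] is an integer in the applications, so that on the Fourier
   side the translates [j] produce the polynomial [P] in [e^(- 2 pi i xi_1)]. *)
Definition train (P : {poly R}) (k : R) : 'rV[R]_n.+1 -> R[i] := fun x =>
  \sum_(j < size P) (P`_j)%:C * modgauss 1 (j%:R *: e1) (k *: e1) x.

Lemma train_schwartz P k : schwartz (train P k).
Proof.
apply: (gauss_class_schwartz (@ltr01 R)); apply: gauss_class_sum => j.
by apply: gauss_classZ; exact: gauss_class_mg.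
Qed.

Lemma dotp_axis (x : 'rV[R]_n.+1) a : dotp x (a *: e1) = a * x ord0 ord0.
Proof. by rewrite dotpZr dotp_delta. Qed.

Lemma nsq_axis a : nsq (a *: e1) = a ^+ 2.
Proof. by rewrite nsqZ nsq_delta mulr1. Qed.

Lemma train_bound P : exists2 C, 0 < C & forall k x, normc (train P k x) <= C * wgt x.
Proof.
have /choice[G HG] : forall j : nat, exists G, forall c (x : 'rV[R]_n.+1),
    normc (modgauss 1 (j%:R *: e1) c x) <= G * wgt x.
  move=> j; have [G G0 H] := modgauss_bound (j%:R *: e1) 0 (@ltr01 R).
  by exists G => c x; have := H c x; rewrite expr0 mul1r.
exists (\sum_(j < size P) `|P`_j| * `|G j| + 1).
  by rewrite ltr_wpDl// sumr_ge0// => j _; rewrite mulr_ge0.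
move=> k x; apply: le_trans (normc_sum _ _) _.
rewrite mulrDl mul1r; apply: (@le_trans _ _ ((\sum_(j < size P) `|P`_j| * `|G j|) * wgt x)).
  rewrite mulr_suml; apply: ler_sum => j _; rewrite normcM normcR -mulrA.
  apply: ler_wpM2l => //; apply: le_trans (HG j (k *: e1) x) _.
  by apply: ler_wpM2r; [exact: ltW (wgt_gt0 x)|exact: ler_norm].
by rewrite lerDl ltW// wgt_gt0.
Qed.

Lemma fourier_train P k xi : expi (2 * pi * k) = 1 :> R[i] ->
  fourier (train P k) xi =
  (expR (- (pi * nsq (xi - k *: e1))))%:C * (toC P).[expi (- (2 * pi * xi ord0 ord0))].
Proof.
move=> hk; rewrite horner_toC mulr_sumr /fourier /train.
transitivity (cintegral (fun x => \sum_(j < size P) (P`_j)%:C *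
    (modgauss 1 (j%:R *: e1) (k *: e1) x * expi (- (2 * pi * dotp x xi))))).
  by congr cintegral; apply/funext => x; rewrite mulr_suml; apply: eq_bigr => j _; rewrite mulrA.
rewrite (cintegral_sum _ _ _).2; last by move=> j; exact: cintegrable_modgauss.
apply: eq_bigr => j _; rewrite mulrCA; congr (_ * _).
rewrite -/(fourier _ _) fourier_modgauss// /heat ln1 mulr0 oppr0 expR0 mul1r divr1.
congr (_ * _); rewrite dotp_axis.
have -> : 2 * pi * (j%:R * (k *: e1 - xi) ord0 ord0) = j%:R * (2 * pi * k) + j%:R * (- (2 * pi * xi ord0 ord0)).
  by rewrite !mxE !eqxx mulr1; move: (pi) (j%:R : R) => p m; ring.
by rewrite expiD !expiMn hk expr1n mul1r.
Qed.

Lemma expi_square (a : R) : (1 - expi (- (2 * a))) ^+ 2 = (- (2 * sin a) ^+ 2)%:C * expi (- (2 * a)).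
Proof.
have E : expi a - expi (- a) = 0 +i* (2 * sin a) :> R[i].
  by apply: complex_ext; rewrite ?cReD ?cImD /= ?cosN ?sinN ?subrr// opprK; ring.
have E1 : expi (- a) * expi a = 1 :> R[i] by rewrite -expiD addNr expi0.
have E2 : expi (- (2 * a)) = expi (- a) * expi (- a) :> R[i].
  by rewrite -expiD; congr expi; ring.
rewrite E2 -{1}E1 -mulrBr E exprMn -expr2 mulrC; congr (_ * _).
by rewrite expr2; apply: complex_ext; rewrite ?cReM ?cImM /=; ring.
Qed.

Lemma osc_expi i (a : R) : (1 - expi (- (2 * pi * a))) ^+ (2 * i.+2) =
  ((-1) ^+ i.+2 * osc i a)%:C * expi (i.+2%:R * - (2 * pi * a)) :> R[i].
Proof.
rewrite exprM -(mulrA 2 pi) expi_square exprMn expiMn -rmorphXn /osc; congr (_%:C * _).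
by rewrite -[- _ ^+ 2]mulN1r exprMn.
Qed.

(** The even power of 1 - z is, up to sign, the real factor [osc] times a pure phase; the phase only
    shifts the translates by i + 2. *)
Lemma fourier_train_osc i (B : {poly R}) k xi : expi (2 * pi * k) = 1 :> R[i] ->
  fourier (train ((1 - 'X) ^+ (2 * i.+2) * B) k) xi =
  \sum_(l < size B) ((-1) ^+ i.+2 * B`_l)%:C *
    ((bump i k xi)%:C * expi (- (2 * pi * dotp ((l + i.+2)%:R *: e1) xi))).
Proof.
move=> hk; rewrite fourier_train// rmorphM rmorphXn rmorphB rmorph1 /= map_polyX hornerM.
have -> (z : R[i]) : ((1 - 'X) ^+ (2 * i.+2)).[z] = (1 - z) ^+ (2 * i.+2).
  by rewrite horner_exp !hornerE.
rewrite osc_expi horner_toC mulrA mulr_sumr; apply: eq_bigr => l _.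
rewrite /bump (dotpC _ xi) dotp_axis -expiMn.
have -> : - (2 * pi * ((l + i.+2)%:R * xi ord0 ord0)) =
    l%:R * - (2 * pi * xi ord0 ord0) + i.+2%:R * - (2 * pi * xi ord0 ord0).
  by rewrite natrD; move: (pi) (l%:R : R) (i.+2%:R : R) => p m q; ring.
rewrite expiD; move: (expi (l%:R * - (2 * pi * xi ord0 ord0))) (expi (i.+2%:R * - (2 * pi * xi ord0 ord0))) => u v.
move: (osc i (xi ord0 ord0)) (expR (- (pi * nsq (xi - k *: e1)))) (B`_l) ((-1) ^+ i.+2 : R) => o E b sg.
by rewrite !rmorphM /=; ring.
Qed.

Lemma wgt_axis (a : R) (x : 'rV[R]_n.+1) : wgt (x - a *: e1) <= (1 + `|a|) * wgt x.
Proof.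
rewrite /wgt !big_ord_recl mulrA; apply: ler_pM.
- by rewrite invr_ge0 addr_ge0.
- by apply: prodr_ge0 => j _; rewrite invr_ge0 addr_ge0.
- rewrite !mxE !eqxx mulr1 ler_pdivlMr ?ltr_pwDl// mulrC ler_pdivrMr ?ltr_pwDl//.
  have : `|x ord0 ord0| <= `|x ord0 ord0 - a| + `|a|.
    by rewrite -{1}(subrK a (x ord0 ord0)) ler_normD.
  by have := normr_ge0 (x ord0 ord0 - a); have := normr_ge0 a; nra.
- by rewrite le_eqVlt; apply/orP; left; apply/eqP; apply: eq_bigr => j _;
    rewrite !mxE /= mulr0 subr0.
Qed.

Lemma train_multiplier i (s d : R) (B : {poly R}) : s < 0 -> - (s / 2) < i%:R -> 0 <= d ->
  exists2 eta : nat -> R, eta k @[k --> \oo] --> (0 : R) &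
  forall k kap, kap ^+ 2 = k.+1%:R ^+ 2 -> expi (2 * pi * kap) = 1 :> R[i] ->
  let f := train ((1 - 'X) ^+ (2 * i.+2) * B) kap in
  [/\ 0 <= eta k, fmultiplier_defined (symb d s) f &
    forall x, normc (fmultiplier (symb d s) f x) <= eta k * wgt x].
Proof.
move=> s0 si d0; have [eta ec H] := bump_fourier_bound n s0 si d0.
pose c (l : 'I_(size B)) := pi `^ (- (s / 2)) * ((-1) ^+ i.+2 * B`_l).
(* The 2 counts real and imaginary parts, and 1 + (l + i + 2) is the cost of translating the
   weight. *)
pose K := \sum_(l < size B) `|c l| * (2 * (1 + (l + i.+2)%:R)).
have K0 : 0 <= K by apply: sumr_ge0 => l _; rewrite !mulr_ge0// addr_ge0.
exists (fun k => K * eta k).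
  by rewrite -(mulr0 K); apply: cvgM => //; exact: cvg_cst.
move=> k kap kE hk f.
pose F (xi : 'rV[R]_n.+1) := (d + pi * nsq xi) `^ (s / 2) * bump i kap xi.
have e0 : 0 <= eta k by have [] := H k kap 0 0 kE.
have E xi : (symb d s xi)%:C * fourier f xi =
    \sum_(l < size B) (c l)%:C * ((F xi)%:C * expi (- (2 * pi * dotp ((l + i.+2)%:R *: e1) xi))).
  rewrite fourier_train_osc// mulr_sumr; apply: eq_bigr => l _.
  rewrite /symb /c /F; move: (expi (- (2 * pi * dotp ((l + i.+2)%:R *: e1) xi))) => u.
  move: (bump i kap xi) (pi `^ (- (s / 2))) ((d + pi * nsq xi) `^ (s / 2)) (B`_l) ((-1) ^+ i.+2 : R) => w p q b sg.
  by rewrite !rmorphM /=; ring.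
have [h1 h2] := fmultiplier_phase (integrable_symbol_bump n s0 si d0 kap) E.
split; [exact: mulr_ge0|exact: h1|move=> x].
rewrite h2; apply: le_trans (normc_sum _ _) _; rewrite /K -mulrA mulr_suml.
apply: ler_sum => l _; rewrite normcM normcR -mulrA; apply: ler_wpM2l => //.
apply: le_trans (normc_le _) _ => /=.
have W th : `|\int[leb]_xi (F xi * cos (2 * pi * dotp (x - (l + i.+2)%:R *: e1) xi + th))| <=
    eta k * ((1 + (l + i.+2)%:R) * wgt x).
  under eq_Rintegral do rewrite /F -mulrA.
  have [_ h] := H k kap (x - (l + i.+2)%:R *: e1) th kE.
  apply: (le_trans h); apply: ler_wpM2l => //.
  by have := wgt_axis (l + i.+2)%:R x; rewrite normr_nat.
apply: le_trans (lerD (W 0) (W (- (pi / 2)))) _.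
rewrite le_eqVlt; apply/orP; left; apply/eqP.
by move: (wgt x) ((l + i.+2)%:R : R) (eta k) => w m e; ring.
Qed.

(** The phases cancel, so the product is real, as the Parseval identity below requires. The overlap
    of the Gaussians centred at j and l gives e^(- pi (j - l)^2 / 2), the origin of the twist. *)
Lemma trainM P Q k x : train P k x * train Q (- k) x =
  (\sum_(j < size P) \sum_(l < size Q) P`_j * Q`_l * expR (- (pi / 2 * (j%:R - l%:R) ^+ 2)) *
    expR (- (pi * 2 * nsq (x - ((j + l)%:R / 2) *: e1))))%:C.
Proof.
rewrite /train big_distrl/= rmorph_sum/=; apply: eq_bigr => j _.
rewrite big_distrr/= rmorph_sum/=; apply: eq_bigr => l _.
rewrite mulrACA (@modgaussM _ _ _ _ _ _ _ _ (((j + l)%:R / 2) *: e1)); last 2 first.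
- by rewrite (_ : 1 + 1 = 2 :> R) ?pnatr_eq0.
- by rewrite !scale1r -scalerDl scalerA natrD; congr (_ *: _); field.
rewrite -scalerBl nsq_axis !mul1r -scalerDl subrr scale0r /modgauss.
rewrite (_ : dotp 0 x = 0); last by rewrite /dotp big1// => a _; rewrite mxE mul0r.
rewrite mulr0 expi0 mulr1 -!rmorphM; congr (_%:C).
by rewrite mulrA; congr (_ * expR _ * expR _).
Qed.

(** The centres (j + l) / 2 are half-integers, hence a polynomial in e^(- pi i xi_1), where the
    factors have e^(- 2 pi i xi_1). *)
Lemma fourier_trainM P Q k xi :
  fourier (fun x => train P k x * train Q (- k) x) xi =
  (heat n.+1 2 * expR (- (pi * nsq xi / 2)))%:C *
  (toC (tprod (expR (- (pi / 2))) P Q)).[expi (- (pi * xi ord0 ord0))].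
Proof.
pose c (j : 'I_(size P)) (l : 'I_(size Q)) := P`_j * Q`_l * expR (- (pi / 2 * (j%:R - l%:R) ^+ 2)).
pose v (j : 'I_(size P)) (l : 'I_(size Q)) := ((j + l)%:R / 2) *: e1.
have ci jl := @cintegrable_modgauss R n.+1 2 (v jl.1 jl.2) 0 xi (ltr0n _ 2).
rewrite /fourier.
transitivity (cintegral (fun x => \sum_(jl : 'I_(size P) * 'I_(size Q)) (c jl.1 jl.2)%:C *
    (modgauss 2 (v jl.1 jl.2) 0 x * expi (- (2 * pi * dotp x xi))))).
  congr cintegral; apply/funext => x; rewrite trainM pair_big/= rmorph_sum/= mulr_suml.
  apply: eq_bigr => -[j l] _ /=; rewrite mulrA; congr (_ * _).
  rewrite /modgauss (_ : dotp 0 x = 0); last by rewrite /dotp big1// => a _; rewrite mxE mul0r.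
  by rewrite mulr0 expi0 mulr1 -rmorphM.
rewrite (cintegral_sum _ _ _).2//.
rewrite -(pair_bigA _ (fun j l => (c j l)%:C *
  cintegral (fun x => modgauss 2 (v j l) 0 x * expi (- (2 * pi * dotp x xi)))))/=.
rewrite tprodE rmorph_sum/= horner_sum mulr_sumr; apply: eq_bigr => j _.
rewrite rmorph_sum/= horner_sum mulr_sumr; apply: eq_bigr => l _.
rewrite -/(fourier _ _) fourier_modgauss// sub0r subr0 map_polyZ map_polyXn hornerZ hornerXn.
rewrite dotp_axis -expiMn.
have -> : 2 * pi * ((j + l)%:R / 2 * (- xi) ord0 ord0) = (j + l)%:R * - (pi * xi ord0 ord0).
  by rewrite mxE; move: (pi) ((j + l)%:R : R) => p m; field.
(* This is 2 j^2 + 2 l^2 - (j + l)^2 = (j - l)^2 in the exponent. *)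
have K : expR (- (pi / 2)) ^+ (2 * j ^ 2 + 2 * l ^ 2) * (expR (- (pi / 2)))^-1 ^+ ((j + l) ^ 2) =
    expR (- (pi / 2 * (j%:R - l%:R) ^+ 2)) :> R.
  rewrite -expRN opprK -!expRM_natl -expRD; congr expR.
  rewrite natrD (natrM _ 2 (j ^ 2)) (natrM _ 2 (l ^ 2)) !natrX natrD; move: (pi) (j%:R : R) (l%:R : R) => p m q.
  by field.
rewrite K -/(c j l) mulrA [RHS]mulrA -!rmorphM; congr (_%:C * _).
by rewrite mulrC.
Qed.

End trains.

(** * Parseval and nonvanishing of the left-hand side *)

Section parseval.
Context (R : realType) (n : nat).
Local Notation Re := complex.Re.
Local Notation Im := complex.Im.
Local Notation leb := (lebesgue_rV R n).
Local Open Scope complex_scope.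
Import ComplexField.Normc.

Variables (h m : 'rV[R]_n -> R).
Let f : 'rV[R]_n -> R[i] := fun x => (h x)%:C.
Hypotheses (ih : leb.-integrable setT (EFin \o h)) (df : fmultiplier_defined m f).

Let A xi := Re ((m xi)%:C * fourier f xi).
Let B xi := Im ((m xi)%:C * fourier f xi).
Let iA : leb.-integrable setT (EFin \o A). Proof. exact: df.1. Qed.
Let iB : leb.-integrable setT (EFin \o B). Proof. exact: df.2. Qed.
Let mh := measurable_of_integrable ih.
Let mA := measurable_of_integrable iA.
Let mB := measurable_of_integrable iB.

Let meas_dotp2 : measurable_fun setT (fun p : 'rV[R]_n * 'rV[R]_n => 2 * pi * dotp p.1 p.2).
Proof.
apply: measM; first exact: measurable_cst.
apply: meas_sum => i; apply: measM.
  exact: (measurableT_comp (measurable_coord_rV i) measurable_fst).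
exact: (measurableT_comp (measurable_coord_rV i) measurable_snd).
Qed.

Let meas_dotp2' : measurable_fun setT (fun p : 'rV[R]_n * 'rV[R]_n => 2 * pi * dotp p.2 p.1).
Proof. by under eq_fun do rewrite dotpC. Qed.

Let multiplierE x : Re (fmultiplier m f x) =
    \int[leb]_xi (A xi * cos (2 * pi * dotp xi x) - B xi * sin (2 * pi * dotp xi x)) /\
  Im (fmultiplier m f x) =
    \int[leb]_xi (A xi * sin (2 * pi * dotp xi x) + B xi * cos (2 * pi * dotp xi x)).
Proof.
by split; apply: eq_Rintegral => xi _; rewrite ?cReM ?cImM.
Qed.

Let fourierE xi : Re (fourier f xi) = \int[leb]_x (h x * cos (2 * pi * dotp x xi)) /\
  Im (fourier f xi) = - \int[leb]_x (h x * sin (2 * pi * dotp x xi)).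
Proof.
have ms : measurable_fun setT (fun x => h x * sin (2 * pi * dotp x xi)).
  apply: measM => //; apply: meas_sin; apply: measM; first exact: measurable_cst.
  by under eq_fun do rewrite dotpC; exact: meas_dotp.
have is_ : leb.-integrable setT (EFin \o (fun x => h x * sin (2 * pi * dotp x xi))).
  apply: (integrable_le ms) (integrable_norm ih) => x.
  by rewrite normrM ler_piMr// sin_max.
split; first by apply: eq_Rintegral => x _; rewrite /f cReMr /= cosN.
rewrite -[RHS]mulN1r -(RintegralZl _ measurableT is_).
by apply: eq_Rintegral => x _; rewrite /f cImMr /= sinN mulrN mulN1r.
Qed.

Lemma meas_fmultiplier : measurable_fun setT (fun x => Re (fmultiplier m f x)) /\
  measurable_fun setT (fun x => Im (fmultiplier m f x)).
Proof.
split.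
  under eq_fun do rewrite (multiplierE _).1.
  apply: (@meas_Rintegral _ _ 'rV[R]_n 'rV[R]_n R leb (fun p => A p.2 * cos (2 * pi * dotp p.2 p.1) - B p.2 * sin (2 * pi * dotp p.2 p.1))).
  by apply: measB; apply: measM;
    [exact: (measurableT_comp mA measurable_snd)|exact: meas_cos|
     exact: (measurableT_comp mB measurable_snd)|exact: meas_sin].
under eq_fun do rewrite (multiplierE _).2.
apply: (@meas_Rintegral _ _ 'rV[R]_n 'rV[R]_n R leb (fun p => A p.2 * sin (2 * pi * dotp p.2 p.1) + B p.2 * cos (2 * pi * dotp p.2 p.1))).
by apply: measD; apply: measM;
  [exact: (measurableT_comp mA measurable_snd)|exact: meas_sin|
   exact: (measurableT_comp mB measurable_snd)|exact: meas_cos].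
Qed.

Let energyE xi : m xi * normc (fourier f xi) ^+ 2 =
  A xi * Re (fourier f xi) + B xi * Im (fourier f xi).
Proof. by rewrite sqr_normcE /A /B cReMr cImMr; ring. Qed.

Let iAB : leb.-integrable setT (EFin \o (fun xi => `|A xi| + `|B xi|)).
Proof. by apply: integrable_plus; exact: integrable_norm. Qed.

Let integrable_AB x : leb.-integrable setT
  (EFin \o (fun xi => A xi * cos (2 * pi * dotp xi x) - B xi * sin (2 * pi * dotp xi x))).
Proof.
have md : measurable_fun setT (fun xi => 2 * pi * dotp xi x).
  apply: measM; first exact: measurable_cst.
  by under eq_fun do rewrite dotpC; exact: meas_dotp.
apply: (integrable_le _ _ iAB).
  by apply: measB; apply: measM => //; [exact: meas_cos|exact: meas_sin].
move=> xi; apply: le_trans (ler_normB _ _) _; rewrite !normrM.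
by apply: lerD; rewrite ler_piMr// ?cos_max ?sin_max.
Qed.

(** The output is paired with [h] instead of with itself: integrability of [h] and of the symbol
    times its transform makes the double integrand integrable, and Fubini applies. *)
Lemma parseval : \int[leb]_x (h x * Re (fmultiplier m f x)) =
  \int[leb]_xi (m xi * normc (fourier f xi) ^+ 2).
Proof.
pose G (p : 'rV[R]_n * 'rV[R]_n) := h p.1 *
  (A p.2 * cos (2 * pi * dotp p.2 p.1) - B p.2 * sin (2 * pi * dotp p.2 p.1)).
have mG : measurable_fun setT G.
  apply: measM; first exact: (measurableT_comp mh measurable_fst).
  by apply: measB; apply: measM;
    [exact: (measurableT_comp mA measurable_snd)|exact: meas_cos|
     exact: (measurableT_comp mB measurable_snd)|exact: meas_sin].
have GE p : `|G p| <= `|h p.1| * (`|A p.2| + `|B p.2|).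
  rewrite normrM; apply: ler_wpM2l => //; apply: le_trans (ler_normB _ _) _; rewrite !normrM.
  by apply: lerD; rewrite ler_piMr// ?cos_max ?sin_max.
have iG : (leb \x leb)%E.-integrable setT (EFin \o G).
  apply/integrable12ltyP; first exact/measurable_EFinP.
  pose c := \int[leb]_xi (`|A xi| + `|B xi|).
  apply: (@le_lt_trans _ _ (\int[leb]_x (c * `|h x|)%:E)%E).
    apply: ge0_le_integralT => x; first by apply: integral_ge0.
    have iZ := integrableZ `|h x| iAB.
    apply: (@le_trans _ _ (\int[leb]_xi (`|h x| * (`|A xi| + `|B xi|))%:E)%E).
      by apply: ge0_le_integralT => xi //; rewrite lee_fin; exact: GE.
    by rewrite -(ge0_integral_fin iZ)// lee_fin (RintegralZl _ measurableT iAB) mulrC.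
  have iZ := integrableZ c (integrable_norm ih).
  have := ge0_integral_fin iZ; rewrite /comp /= => <-; first exact: ltry.
transitivity (\int[leb]_x \int[leb]_xi G (x, xi)).
  by apply: eq_Rintegral => x _; rewrite (multiplierE x).1 -(RintegralZl _ measurableT (integrable_AB x)).
rewrite (RFubini iG); apply: eq_Rintegral => xi _.
rewrite energyE (fourierE xi).1 (fourierE xi).2.
have md : measurable_fun setT (fun x => 2 * pi * dotp xi x).
  by apply: measM; [exact: measurable_cst|exact: meas_dotp].
have ic : leb.-integrable setT (EFin \o (fun x => h x * cos (2 * pi * dotp xi x))).
  apply: (integrable_le _ _ (integrable_norm ih)); first by apply: measM => //; exact: meas_cos.
  by move=> x; rewrite normrM ler_piMr// cos_max.
have is_ : leb.-integrable setT (EFin \o (fun x => h x * sin (2 * pi * dotp xi x))).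
  apply: (integrable_le _ _ (integrable_norm ih)); first by apply: measM => //; exact: meas_sin.
  by move=> x; rewrite normrM ler_piMr// sin_max.
transitivity (\int[leb]_x (A xi * (h x * cos (2 * pi * dotp xi x)) + (- B xi) * (h x * sin (2 * pi * dotp xi x)))).
  by apply: eq_Rintegral => x _; rewrite /G /=; ring.
rewrite RintegralD//; [|exact: integrableZ|exact: integrableZ].
rewrite (RintegralZl _ measurableT ic) (RintegralZl _ measurableT is_) mulrN mulNr.
by congr (_ * _ - _ * _); apply: eq_Rintegral => x _; rewrite dotpC.
Qed.

Let energy_integrable : leb.-integrable setT
  (EFin \o (fun xi => m xi * normc (fourier f xi) ^+ 2)).
Proof.
pose c := \int[leb]_x `|h x|.
have c1 xi : `|Re (fourier f xi)| <= c.
  rewrite (fourierE xi).1; apply: normr_Rintegral_le (integrable_norm ih).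
    apply: measM => //; apply: meas_cos; apply: measM; first exact: measurable_cst.
    by under eq_fun do rewrite dotpC; exact: meas_dotp.
  by move=> x; rewrite normrM ler_piMr// cos_max.
have c2 xi : `|Im (fourier f xi)| <= c.
  rewrite (fourierE xi).2 normrN; apply: normr_Rintegral_le (integrable_norm ih).
    apply: measM => //; apply: meas_sin; apply: measM; first exact: measurable_cst.
    by under eq_fun do rewrite dotpC; exact: meas_dotp.
  by move=> x; rewrite normrM ler_piMr// sin_max.
under eq_fun do rewrite /= energyE.
apply: (integrable_le _ _ (integrableZ c iAB)).
  apply: measD; apply: measM => //.
    under eq_fun do rewrite (fourierE _).1.
    apply: (@meas_Rintegral _ _ 'rV[R]_n 'rV[R]_n R leb (fun p => h p.2 * cos (2 * pi * dotp p.2 p.1))).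
    by apply: measM; [exact: (measurableT_comp mh measurable_snd)|exact: meas_cos].
  under eq_fun do rewrite (fourierE _).2.
  apply: measN; apply: (@meas_Rintegral _ _ 'rV[R]_n 'rV[R]_n R leb (fun p => h p.2 * sin (2 * pi * dotp p.2 p.1))).
  by apply: measM; [exact: (measurableT_comp mh measurable_snd)|exact: meas_sin].
move=> xi; apply: le_trans (ler_normD _ _) _; rewrite mulrDr !normrM [c * `|A xi|]mulrC [c * `|B xi|]mulrC.
by apply: lerD; apply: ler_wpM2l.
Qed.

(** A vanishing norm, for any r > 0, makes the output zero almost everywhere. Its pairing with [h]
    is then 0, against the positive energy on [S]. *)
Lemma Lpnorm_fmultiplier_gt0 (r : R) (S : set 'rV[R]_n) : 0 < r ->
  (forall xi, 0 <= m xi) -> measurable S -> (0 < leb S)%E ->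
  (forall xi, S xi -> 0 < m xi * normc (fourier f xi) ^+ 2) ->
  (0 < Lpnorm r (fmultiplier m f))%E.
Proof.
move=> r0 m0 mS S0 HS; rewrite lt0e Lnorm_ge0 andbT; apply/eqP => N0.
have [mr mi] := meas_fmultiplier.
have mn : measurable_fun setT (fun x => (normc (fmultiplier m f x))%:E).
  by apply/measurable_EFinP; exact: meas_normc.
have r0' : (0 < r%:E)%E by rewrite lte_fin.
have H0 := Lnorm_eq0_eq0 mn r0' N0.
have I0 : (\int[leb]_x (h x * Re (fmultiplier m f x))%:E = 0)%E.
  rewrite -[RHS](@integral0 _ _ _ leb setT); apply: ae_eq_integral => //.
    by apply/measurable_EFinP; exact: measM.
  apply: filterS H0 => x Hx _; have E : normc (fmultiplier m f x) = 0 := congr1 fine (Hx I).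
  by have := normc_Re (fmultiplier m f x); rewrite E normr_le0 => /eqP ->; rewrite mulr0.
have E0 : (\int[leb]_xi (m xi * normc (fourier f xi) ^+ 2)%:E = 0)%E.
  by rewrite -(ge0_integral_fin energy_integrable) -parseval /Rintegral I0.
have mE := measurable_int _ energy_integrable.
have /(ae_eq_integral_abs leb measurableT mE) [Z [mZ Z0 HZ]] :
    (\int[leb]_xi `|(EFin \o (fun xi => m xi * normc (fourier f xi) ^+ 2)%R) xi| = 0)%E.
  rewrite -[RHS]E0; apply: eq_integral => xi _ /=.
  by rewrite ger0_norm// mulr_ge0// sqr_ge0.
have : (leb S <= leb Z)%E.
  apply: le_measure; rewrite ?inE// => xi /HS h0; apply: HZ => /(_ I) /= [h1].
  by rewrite h1 ltxx in h0.
by rewrite Z0 leNgt S0.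
Qed.

End parseval.

(** * Failure for negative order *)

Section negative_order.
Context (R : realType) (n : nat).
Local Notation Re := complex.Re.
Local Notation Im := complex.Im.
Local Notation mu := (@lebesgue_measure R).
Local Notation leb := (lebesgue_rV R n.+1).
Local Open Scope complex_scope.
Import ComplexField.Normc.
Local Notation e1 := (axis R n).
Local Notation toC := (map_poly (real_complex R)).
Implicit Types (G : {poly R}).

Lemma toC_expi G (a : R) : Re (toC G).[expi a] = \sum_(j < size G) G`_j * cos (j%:R * a) /\
  Im (toC G).[expi a] = \sum_(j < size G) G`_j * sin (j%:R * a).
Proof.
rewrite horner_toC cRe_sum cIm_sum; split; apply: eq_bigr => j _;
  by rewrite -expiMn ?cReMr ?cImMr.
Qed.

Lemma toC_expi_neq0 G : G != 0 -> exists2 t : R, 0 < t < 1 & (toC G).[expi (- (pi * t))] != 0.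
Proof.
move=> G0; apply: contrapT => H.
(* The angles pi / (j + 2) lie in (0, pi), where cosine is injective, so the points of [rs] are
   distinct: as many as the size of G, one too many to be roots. *)
pose t (j : nat) : R := j.+2%:R^-1.
have t01 j : 0 < t j < 1 by rewrite invr_gt0 ltr0n/= invf_lt1 ?ltr0n// ltr1n.
pose rs := [seq expi (- (pi * t j)) | j <- iota 0 (size G)].
have := @max_poly_roots _ (toC G) rs; rewrite map_poly_eq0 => /(_ G0).
rewrite size_map size_iota size_map_poly ltnn => K.
suff : false by [].
apply: K.
  apply/allP => _ /mapP[j _ ->]; rewrite /root; apply/negPn/negP => h.
  by apply: H; exists (t j).
rewrite map_inj_uniq ?iota_uniq// => j l [] + _.
have tpi k : pi * t k \in `[0, pi].
  have /andP[h1 h2] := t01 k; have p0 := pi_ge0 R.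
  by rewrite in_itv/= mulr_ge0 ?ler_piMr// ltW.
rewrite !cosN => /(cos_inj (tpi j) (tpi l)) /(mulfI (lt0r_neq0 (pi_gt0 R))) /invr_inj /eqP.
by rewrite eqr_nat => /eqP[].
Qed.

(** The condition e <= t keeps the interval among positive frequencies, away from the origin, where
    the symbol for d = 0 has the default value 0. *)
Lemma toC_expi_neq0_near G : G != 0 -> exists t e : R, [/\ 0 < e, e <= t &
  forall a, t - e < a < t + e -> (toC G).[expi (- (pi * a))] != 0].
Proof.
move=> G0; have [t /andP[t0 t1] Ht] := toC_expi_neq0 G0.
pose q (a : R) := normc (toC G).[expi (- (pi * a))] ^+ 2.
have cq : continuous q.
  have ca (j : nat) : continuous (fun a : R => j%:R * - (pi * a)).
    by apply: contM; [exact: cont_cst|apply: contN; apply: contM; [exact: cont_cst|move=> x; exact: cvg_id]].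
  have c1 : continuous (fun a : R => \sum_(j < size G) G`_j * cos (j%:R * - (pi * a))).
    by apply: cont_sum => j; apply: contM; [exact: cont_cst|exact: (cont_comp (@continuous_cos R))].
  have c2 : continuous (fun a : R => \sum_(j < size G) G`_j * sin (j%:R * - (pi * a))).
    by apply: cont_sum => j; apply: contM; [exact: cont_cst|exact: (cont_comp (@continuous_sin R))].
  rewrite (_ : q = (fun a => (\sum_(j < size G) G`_j * cos (j%:R * - (pi * a))) * (\sum_(j < size G) G`_j * cos (j%:R * - (pi * a))) +
    (\sum_(j < size G) G`_j * sin (j%:R * - (pi * a))) * (\sum_(j < size G) G`_j * sin (j%:R * - (pi * a))))).
    by apply: contD; exact: contM.
  by apply/funext => a; rewrite /q sqr_normcE (toC_expi _ _).1 (toC_expi _ _).2 !expr2.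
have q0 : 0 < q t.
  rewrite exprn_gt0// lt0r normc_ge0 andbT.
  by apply: contra Ht => /eqP/eq0_normc ->.
have qn : nbhs (q t) [set y : R | 0 < y].
  by apply: open_nbhs_nbhs; split => //; exact: open_gt.
have /nbhs_ballP[e /= e0 He] : nbhs t [set a | 0 < q a] := cq t _ qn.
exists t, (Num.min e t); split; first by rewrite lt_min e0.
  by rewrite ge_min lexx orbT.
move=> a /andP[a1 a2]; have : ball t e a.
  rewrite /ball/= distrC ltr_distl.
  have := ge_min e e t; rewrite lexx /= => me.
  by apply/andP; split; [apply: le_lt_trans a1; rewrite lerD2l lerN2|apply: lt_le_trans a2 _; rewrite lerD2l].
move=> /He /=; rewrite /q => h; apply: contraTneq h => ->.
by rewrite normc0 expr0n ltxx.
Qed.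

Lemma symb_ge0 d s (xi : 'rV[R]_n.+1) : 0 <= symb d s xi.
Proof. by rewrite mulr_ge0 ?powR_ge0. Qed.

Lemma trainM_defined i (s d : R) P Q k : s < 0 -> - (s / 2) < i%:R -> 0 <= d ->
  (1 - 'X) ^+ (2 * i.+2) %| tprod (expR (- (pi / 2))) P Q ->
  fmultiplier_defined (n := n.+1) (symb d s) (fun x => train P k x * train Q (- k) x).
Proof.
move=> s0 si d0 /dvdpP[G GE].
pose z (xi : 'rV[R]_n.+1) : R := - (pi * xi ord0 ord0).
pose T := tprod (expR (- (pi / 2))) P Q.
pose E (xi : 'rV[R]_n.+1) := heat n.+1 2 * expR (- (pi * nsq xi / 2)).
pose K := pi `^ (- (s / 2)) * (4 * pi ^+ 2) ^+ i.+2 * heat n.+1 2 * \sum_(j < size G) `|G`_j|.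
have bound (xi : 'rV[R]_n.+1) : normc ((symb d s xi)%:C * fourier (fun x => train P k x * train Q (- k) x) xi) <=
    K * ((1 + nsq xi) ^+ 0 * expR (- (pi / 2 * nsq xi))).
  rewrite fourier_trainM normcM normcR ger0_norm ?symb_ge0// normcM normcR ger0_norm; last first.
    by rewrite mulr_ge0 ?expR_ge0// ltW// heat_gt0.
  rewrite GE rmorphM hornerM normcM.
  have -> : normc (toC ((1 - 'X) ^+ (2 * i.+2))).[expi (- (pi * xi ord0 ord0))] = osc i (xi ord0 ord0 / 2).
    rewrite rmorphXn rmorphB rmorph1 /= map_polyX horner_exp !hornerE.
    rewrite (_ : - (pi * xi ord0 ord0) = - (2 * pi * (xi ord0 ord0 / 2))); last first.
      by move: (pi) => p; field.
    rewrite osc_expi normcM normc_expi mulr1 normcR normrM normrX normrN1 expr1n mul1r.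
    by rewrite ger0_norm//; have /andP[] := osc_le i (xi ord0 ord0 / 2).
  have h1 : (d + pi * nsq xi) `^ (s / 2) * osc i (xi ord0 ord0 / 2) <= (4 * pi ^+ 2) ^+ i.+2.
    (* The half-integer centres place [osc] at xi_1 / 2. The bound is therefore taken at xi / 2 and
       carried to xi by monotonicity, the symbol being decreasing in |xi|. *)
    have H := symbol_osc_bound s0 si d0 (2^-1 *: xi); rewrite mxE (mulrC 2^-1 (xi _ _)) in H.
    apply: le_trans H; apply: ler_wpM2r; first by have /andP[] := osc_le i (xi ord0 ord0 / 2).
    have L2 : d + pi * nsq (2^-1 *: xi) <= d + pi * nsq xi.
      rewrite lerD2l; apply: ler_wpM2l; first exact: pi_ge0.
      by rewrite nsqZ ler_piMl ?nsq_ge0// exprVn invf_le1 ?exprn_gt0// exprn_ege1// ler1n.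
    have L20 : 0 <= d + pi * nsq (2^-1 *: xi) by rewrite addr_ge0// mulr_ge0 ?pi_ge0 ?nsq_ge0.
    move: L20; rewrite le_eqVlt => /predU1P[L20|L20].
      have : nsq xi = 0.
        move/esym/eqP: L20; rewrite paddr_eq0 ?mulr_ge0 ?pi_ge0 ?nsq_ge0// => /andP[_].
        rewrite mulf_eq0 gt_eqF ?pi_gt0//= nsqZ mulf_eq0 gt_eqF ?exprn_gt0 ?invr_gt0//=.
        by move/eqP.
      by move=> xi0; rewrite nsqZ xi0 !mulr0.
    rewrite (_ : s / 2 = - - (s / 2)); last by rewrite opprK.
    have b0 : 0 <= - (s / 2) by rewrite oppr_ge0 pmulr_lle0 ?invr_gt0// ltW.
    rewrite !(powRN _ (- (s / 2))) lef_pV2 ?posrE ?powR_gt0 ?(lt_le_trans L20)//.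
    by apply: ge0_ler_powR; rewrite ?nnegrE//; [exact: ltW|exact: le_trans (ltW L20) L2].
  have h2 := normc_toC G (- (pi * xi ord0 ord0)).
  have S0 : 0 <= \sum_(j < size G) `|G`_j| by exact: sumr_ge0.
  have o0 : 0 <= osc i (xi ord0 ord0 / 2) by have /andP[] := osc_le i (xi ord0 ord0 / 2).
  have H1 := ler_pM (mulr_ge0 (powR_ge0 _ _) o0) (normc_ge0 _) h1 h2.
  have E0 : 0 <= pi `^ (- (s / 2)) * heat n.+1 2 * expR (- (pi / 2 * nsq xi)).
    by rewrite !mulr_ge0 ?powR_ge0 ?expR_ge0// ltW// heat_gt0.
  have := ler_wpM2l E0 H1; rewrite /K /symb expr0 mul1r.
  rewrite (_ : pi * nsq xi / 2 = pi / 2 * nsq xi); last by rewrite mulrAC.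
  move: (pi `^ _) (heat _ _) (expR _) (_ `^ (s / 2)) (osc _ _) (normc _) => a b c e f g.
  move: (\sum_(j < _) _) ((4 * _) ^+ _) => u v; lra.
have mE : measurable_fun setT (fun xi => symb d s xi * E xi).
  apply: measM; first exact: meas_symb.
  apply: measM; first exact: measurable_cst.
  by apply: meas_exp; apply: measN; apply: measM; [apply: measM; [exact: measurable_cst|exact: meas_nsq]|exact: measurable_cst].
have mz (j : nat) : measurable_fun setT (fun xi : 'rV[R]_n.+1 => j%:R * z xi).
  apply: measM; first exact: measurable_cst.
  by apply: measN; apply: measM; [exact: measurable_cst|exact: measurable_coord_rV].
have FE xi : (symb d s xi)%:C * fourier (fun x => train P k x * train Q (- k) x) xi =
    (symb d s xi * E xi)%:C * (toC T).[expi (z xi)].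
  by rewrite fourier_trainM mulrA -rmorphM.
have p20 : (0 : R) < pi / 2 by rewrite divr_gt0 ?pi_gt0.
split; apply: (@integrable_exp_bound R n.+1 _ 0 (pi / 2) K p20).
- under eq_fun do rewrite FE cReMr (toC_expi _ _).1.
  apply: measM => //; apply: meas_sum => j; apply: measM; first exact: measurable_cst.
  exact: meas_cos.
- by move=> xi; apply: le_trans (bound xi); exact: normc_Re.
- under eq_fun do rewrite FE cImMr (toC_expi _ _).2.
  apply: measM => //; apply: meas_sum => j; apply: measM; first exact: measurable_cst.
  exact: meas_sin.
- by move=> xi; apply: le_trans (bound xi); exact: normc_Im.
Qed.

Lemma Lpnorm_trainM_gt0 (s d r : R) P Q k : 0 <= d -> 0 < r ->
  tprod (expR (- (pi / 2))) P Q != 0 ->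
  fmultiplier_defined (n := n.+1) (symb d s) (fun x => train P k x * train Q (- k) x) ->
  (0 < Lpnorm r (fmultiplier (n := n.+1) (symb d s) (fun x => train P k x * train Q (- k) x)%R))%E.
Proof.
move=> d0 r0 T0 df.
pose h (x : 'rV[R]_n.+1) := \sum_(j < size P) \sum_(l < size Q)
  P`_j * Q`_l * expR (- (pi / 2 * (j%:R - l%:R) ^+ 2)) *
  expR (- (pi * 2 * nsq (x - ((j + l)%:R / 2) *: e1))).
have hE : (fun x => train P k x * train Q (- k) x) = (fun x => (h x)%:C).
  by apply/funext => x; rewrite trainM.
have ih : leb.-integrable setT (EFin \o h).
  have [C C0 HC] := train_bound n P; have [D D0 HD] := train_bound n Q.
  apply: (@integrable_le _ _ _ leb _ (fun x => C * D * wgt x ^+ 2)).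
  - apply: meas_sum => j; apply: meas_sum => l; apply: measM; first exact: measurable_cst.
    apply: meas_exp; apply: measN; apply: measM; first exact: measurable_cst.
    have := meas_rV_affine 1 (- (((j + l)%:R / 2) *: e1)) (@meas_nsq R n.+1).
    by under eq_fun do rewrite scale1r.
  - move=> x; rewrite -normcR -/(h x) (_ : (h x)%:C = train P k x * train Q (- k) x); last first.
      by rewrite trainM.
    rewrite normcM expr2 mulrACA; apply: ler_pM (HC k x) (HD (- k) x); exact: normc_ge0.
  - by apply: integrableZ; exact: integrable_wgt2.
have [t [e [e0 et Ht]]] := toC_expi_neq0_near T0.
(* A box of measure 2 e on which xi_1 > 0, so that both the symbol and the transform are nonzero. *)
pose I (j : 'I_n.+1) : set R := if j == ord0 then `]t - e, t + e[%classic else `[0, 1]%classic.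
have mI j : measurable (I j) by rewrite /I; case: ifP => _; exact: measurable_itv.
pose S := [set v : 'rV[R]_n.+1 | forall j, I j (v ord0 j)].
have mS : measurable S.
  rewrite (_ : S = \bigcap_(j : 'I_n.+1) ((fun v : 'rV[R]_n.+1 => v ord0 j) @^-1` I j)).
    apply: fin_bigcap_measurable => // j _.
    by rewrite -[X in measurable X]setTI; apply: measurable_coord_rV.
  by apply/seteqP; split => v /= vA j; [move=> _|]; exact: vA.
rewrite hE in df *; apply: (Lpnorm_fmultiplier_gt0 ih df r0 (S := S)) => //.
- by move=> xi; exact: symb_ge0.
- rewrite /S (lebesgue_rV_box mI) big_ord_recl big1 => [|j _].
    by rewrite mule1 /I eqxx lebesgue_measure_itv/= lte_fin ltrD2l gtrN// -EFinD lte_fin; lra.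
  by rewrite /I /= lebesgue_measure_itv/= lte_fin ltr01 oppr0 adde0.
- move=> xi HS; have Hxi : t - e < xi ord0 ord0 < t + e.
    by have := HS ord0; rewrite /I eqxx /= in_itv.
  apply: mulr_gt0.
    rewrite mulr_gt0 ?powR_gt0 ?pi_gt0// ltr_wpDl// mulr_gt0 ?pi_gt0//.
    have x0 : 0 < xi ord0 ord0 by move: Hxi => /andP[h1 _]; lra.
    by apply: lt_le_trans (nsq_coord xi ord0); rewrite exprn_gt0.
  rewrite exprn_gt0// lt0r normc_ge0 andbT -hE fourier_trainM normcM mulf_neq0//.
    by rewrite normcR gt_eqF// normr_gt0 gt_eqF// mulr_gt0 ?expR_gt0 ?heat_gt0.
  by apply: contra (Ht _ Hxi) => /eqP/eq0_normc ->.
Qed.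

Let cvg0_combination (u v : nat -> R) (a b c e f : R) :
  u k @[k --> \oo] --> (0 : R) -> v k @[k --> \oo] --> (0 : R) ->
  a * (u k * b * c + e * (v k * f)) @[k --> \oo] --> (0 : R).
Proof.
move=> cu cv; have -> : (0 : R) = a * (0 * b * c + e * (0 * f)) by ring.
apply: cvgM; first exact: cvg_cst.
apply: cvgD; apply: cvgM; try exact: cvg_cst.
  by apply: cvgM => //; exact: cvg_cst.
by apply: cvgM => //; exact: cvg_cst.
Qed.

Lemma fails_negative_order (s d p1 q1 p2 q2 r : R) : s < 0 -> 0 <= d ->
  1 < p1 -> 1 < q1 -> 1 < p2 -> 1 < q2 -> 0 < r ->
  fails n.+1 d s p1 q1 p2 q2 r.
Proof.
move=> s0 d0 p11 q11 p21 q21 r0 C.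
pose i := (Num.trunc (- (s / 2))).+1.
have si : - (s / 2) < i%:R by exact: truncnS_gt.
pose kappa : R := expR (- (pi / 2)).
pose D : {poly R} := (1 - 'X) ^+ (2 * i.+2).
have k0 : kappa != 0 by rewrite gt_eqF// expR_gt0.
have D0 : D != 0.
  rewrite expf_neq0// -opprB oppr_eq0 -[1]/(1%:P) polyXsubC_eq0//.
(* With the polynomials [D] for f and [D * B] for g, the zero of order 2 (i + 2) is present in f, in
   g and in their product. *)
have [B [B0 T0 DT]] := exists_tprod_multiple k0 D0.
have [eta1 c1 H1] := train_multiplier n 1 s0 si d0.
have [eta2 c2 H2] := train_multiplier n B s0 si d0.
rewrite -/D mulr1 in H1; rewrite -/D in H2.
have [F F0 HF] := train_bound n D; have [G G0 HG] := train_bound n (D * B).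
pose N p := @wgtnorm R n.+1 p.
pose h (k : R) := (fun x : 'rV[R]_n.+1 => train D k x * train (D * B) (- k) x).
have hE k : h k = h 0 by apply/funext => x; rewrite /h !trainM.
have dh : fmultiplier_defined (symb d s) (h 0) by exact: trainM_defined s0 si d0 DT.
have L0 : (0 < Lpnorm r (fmultiplier (symb d s) (h 0%R)))%E by exact: Lpnorm_trainM_gt0.
(* The product is the same at every frequency, so this lower bound is fixed before the frequency is
   chosen. The norm may be infinite, hence a finite [l] below it. *)
have [l l0 lL] : exists2 l : R, 0 < l & (l%:E <= Lpnorm r (fmultiplier (symb d s) (h 0%R)))%E.
  move: L0; case: (Lpnorm _ _) => [l| |//]; first by rewrite lte_fin => l0; exists l.
  by exists 1 => //; rewrite leey.
pose W k := `|C| * (eta1 k * N p1 * (G * N q1) + F * N p2 * (eta2 k * N q2)).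
have cW : W k @[k --> \oo] --> (0 : R).
  exact: cvg0_combination.
have [k _ Wk] : \forall k \near \oo, W k < l by exact: (cvgr_lt 0).
have {}Wk := Wk k (leqnn k).
pose kap : R := k.+1%:R.
have e1k : expi (2 * pi * kap) = 1 :> R[i].
  rewrite mulrC expiMn (_ : expi _ = 1) ?expr1n//.
  by apply: complex_ext => /=; rewrite mulr_natl ?cos2pi ?sin2pi.
have e2k : expi (2 * pi * - kap) = 1 :> R[i].
  have : expi (2 * pi * - kap) * expi (2 * pi * kap) = 1 :> R[i].
    by rewrite -expiD mulrN addNr expi0.
  by rewrite e1k mulr1.
have [g10 dF HFk] := H1 k kap erefl e1k.
have [g20 dG HGk] := H2 k (- kap) (sqrrN _) e2k.
exists (train D kap), (train (D * B) (- kap)).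
have hk : (fun x : 'rV[R]_n.+1 => train D kap x * train (D * B) (- kap) x) = h 0 := hE kap.
rewrite hk; split.
- by split; exact: train_schwartz.
- by split; [exact: dF|exact: dG|exact: dh].
apply: lt_le_trans lL.
apply: (@le_lt_trans _ _ (W k)%:E); last by rewrite lte_fin.
have N0 p : 0 <= N p by exact: powR_ge0.
apply: (@le_trans _ _ (`|C|%:E * (Lpnorm p1 (fmultiplier (symb d s) (train D kap)) *
   Lpnorm q1 (train (D * B) (- kap)) + Lpnorm p2 (train D kap) *
   Lpnorm q2 (fmultiplier (symb d s) (train (D * B) (- kap)))))%E).
  apply: lee_wpmul2r; last by rewrite lee_fin ler_norm.
  by rewrite adde_ge0 ?mule_ge0 ?Lnorm_ge0.
rewrite /W EFinM; apply: lee_wpmul2l; first by rewrite lee_fin.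
rewrite EFinD; apply: leeD.
  rewrite [X in (_ <= X)%E]EFinM; apply: lee_pmul; rewrite ?Lnorm_ge0//.
    exact: Lpnorm_le p11 g10 HFk.
  exact: Lpnorm_le q11 (ltW G0) (HG (- kap)).
rewrite [X in (_ <= X)%E]EFinM; apply: lee_pmul; rewrite ?Lnorm_ge0//.
  exact: Lpnorm_le p21 (ltW F0) (HF kap).
exact: Lpnorm_le q21 g20 HGk.
Qed.

End negative_order.

(** * The two signs of the order *)

Lemma fractional_leibniz_fails (R : realType) (n : nat) (d p1 q1 p2 q2 r s : R) : (0 < n)%N ->
  0 <= d -> d <= pi -> 1 < p1 -> 1 < q1 -> 1 < p2 -> 1 < q2 ->
  r^-1 = p1^-1 + q1^-1 -> r^-1 = p2^-1 + q2^-1 ->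
  s <= Num.max (n%:R / r - n%:R) 0 -> (forall k : nat, s <> (2 * k)%:R) ->
  fails n d s p1 q1 p2 q2 r.
Proof.
move=> n0 d0 dpi p11 q11 p21 q21 rE1 rE2 hs h2.
have r0 : 0 < r.
  by rewrite -invr_gt0 rE1 addr_gt0// invr_gt0 (lt_trans ltr01).
have [s0|s0|s0] := ltgtP s 0; last by have := h2 0%N; rewrite s0.
  by case: n n0 hs => // n _ _; exact: fails_negative_order.
have hs' : s <= n%:R / r - n%:R.
  by move: hs; rewrite le_max => /orP[//|]; rewrite leNgt s0.
(* With m = floor(s / 2) + 1, the number b = m - s / 2 lies in (0, 1]; the value 1 is excluded
   because s is not an even integer. *)
pose m := (Num.trunc (s / 2)).+1.
have mt : (Num.trunc (s / 2))%:R <= s / 2 by rewrite truncn_le// divr_ge0// ltW.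
have b0 : 0 < m%:R - s / 2 by rewrite subr_gt0; exact: truncnS_gt.
have b1 : m%:R - s / 2 < 1.
  rewrite /m -natr1 ltrBlDr addrC ltrD2l lt_neqAle mt andbT; apply/eqP => E.
  by apply: (h2 (Num.trunc (s / 2))); rewrite natrM E; field.
have bm : m%:R - s / 2 < m%:R by rewrite gtrBl divr_gt0.
have sE : s = 2 * (m%:R - (m%:R - s / 2)) by field.
rewrite [X in fails _ _ X]sE; apply: fails_positive_order => //.
rewrite -sE mulrDr; have := ler_wpM2l (ltW r0) hs'.
by rewrite mulrBr mulrCA mulfV ?gt_eqF// mulr1; lra.
Qed.

Theorem theorem2 (R : realType) (n : nat) (p1 q1 p2 q2 r s : R)
    (hn : (0 < n)%N)
    (hp1 : 1 < p1) (hq1 : 1 < q1) (hp2 : 1 < p2) (hq2 : 1 < q2)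
    (hr1 : r^-1 = p1^-1 + q1^-1) (hr2 : r^-1 = p2^-1 + q2^-1)
    (hs : s <= Num.max (n%:R / r - n%:R) 0)
    (hs2N : forall k : nat, s <> (2 * k)%:R) :
  (forall C : R, exists f g : 'rV[R]_n -> R[i],
    [/\ schwartz f /\ schwartz g,
        [/\ Dop_defined s f, Dop_defined s g &
            Dop_defined s (fun x => f x * g x)] &
        (C%:E * (Lpnorm p1 (Dop s f) * Lpnorm q1 g +
                 Lpnorm p2 f * Lpnorm q2 (Dop s g)) <
         Lpnorm r (Dop s (fun x => f x * g x)%R))%E]) /\
  (forall C : R, exists f g : 'rV[R]_n -> R[i],
    [/\ schwartz f /\ schwartz g,
        [/\ Jop_defined s f, Jop_defined s g &
            Jop_defined s (fun x => f x * g x)] &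
        (C%:E * (Lpnorm p1 f * Lpnorm q1 (Jop s g) +
                 Lpnorm p2 (Jop s f) * Lpnorm q2 g) <
         Lpnorm r (Jop s (fun x => f x * g x)%R))%E]).
Proof.
split=> C.
  rewrite /Dop_defined /Dop DsymbolE.
  exact: (fractional_leibniz_fails hn (lexx 0) (pi_ge0 R) hp1 hq1 hp2 hq2 hr1 hr2 hs hs2N).
rewrite /Jop_defined /Jop JsymbolE.
have [f [g [sfg dfg ineq]]] := fractional_leibniz_fails hn (pi_ge0 R) (lexx pi) hp2 hq2 hp1 hq1 hr2 hr1 hs hs2N C.
by exists f, g; split => //; rewrite addeC.
Qed.
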